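(* The map $$\mathrm{End}(\mathbb C[\mathbb C^n]_{q,\alpha})\to\mathcal D(U_n)'_q,\qquad T\mapsto\sigma(T),$$ sending an operator to its covariant symbol is a morphism of $U_q\mathfrak{su}_{n,1}$-modules.
   Context: **Notation.** Fix an integer $n\ge1$, $q\in(0,1)$ and a real number $\alpha>0$. $(a;q)_m=\prod_{j=0}^{m-1}(1-aq^j)$. For $\underline i,\underline j\in\mathbb Z_{\ge0}^n$: $|\underline i|=i_1+\dots+i_n$, $\underline i\times\underline j=(i_1j_1,\dots,i_nj_n)$; $P(n)=\{\underline k\in\mathbb Z^n_{\ge0}: k_1\ge\dots\ge k_n\}$; $\mathbf z^{\underline i}=z_n^{i_n}\cdots z_1^{i_1}$, $\mathbf z^{*\underline i}=z_1^{*i_1}\cdots z_n^{*i_n}$. **Quantum group.** $U_q\mathfrak{sl}_{n+1}$ is the unital algebra with generators $E_i,F_i,K_i^{\pm1}$ ($1\le i\le n$) and the standard Drinfeld–Jimbo relations: the $K_i$ commute and are invertible, $K_iE_j=q^{a_{ij}}E_jK_i$, $K_iF_j=q^{-a_{ij}}F_jK_i$, $E_iF_j-F_jE_i=\delta_{ij}\frac{K_i-K_i^{-1}}{q-q^{-1}}$, $E_i^2E_j-(q+q^{-1})E_iE_jE_i+E_jE_i^2=0$ and the same for $F$ when $|i-j|=1$, $[E_i,E_j]=[F_i,F_j]=0$ when $|i-j|\ne1$; $(a_{ij})$ is the Cartan matrix of type $A_n$. Hopf structure: $\Delta E_i=E_i\otimes1+K_i\otimes E_i$, $\Delta F_i=F_i\otimes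 K_i^{-1}+1\otimes F_i$, $\Delta K_i=K_i\otimes K_i$, $S(E_i)=-K_i^{-1}E_i$, $S(F_i)=-F_iK_i$, $S(K_i)=K_i^{-1}$, $\varepsilon(E_i)=\varepsilon(F_i)=0$, $\varepsilon(K_i)=1$. $U_q\mathfrak{su}_{n,1}$ is this Hopf algebra with the involution $E_n^*=-K_nF_n$, $F_n^*=-E_nK_n^{-1}$, $E_j^*=K_jF_j$, $F_j^*=E_jK_j^{-1}$ ($j\ne n$), $(K_j^{\pm1})^*=K_j^{\pm1}$. A unital $*$-algebra $F$ is a module algebra over a $*$-Hopf algebra $A$ if it is an $A$-module, multiplication $F\otimes F\to F$ is an $A$-morphism, $\xi(1)=\varepsilon(\xi)1$, and $(\xi(f))^*=S(\xi)^*(f^* )$. **Algebras.** $\mathcal P(\mathbb C^n)_q$ is the unital $*$-algebra with generators $z_1,\dots,z_n$ and relations $z_iz_j=qz_jz_i$ ($i<j$), $z_i^*z_j=qz_jz_i^*$ ($i\ne j$), $z_j^*z_j=q^2z_jz_j^*+(1-q^2)(1-\sum_{k>j}z_kz_k^* )$. $\mathbb C[\mathbb C^n]_q$ is the subalgebra generated by $z_1,\dots,z_n$; the monomials $\mathbf z^{\underline m}$ are its basis. $\mathcal F(U_n)_q$ is obtained from $\mathcal P(\mathbb C^n)_q$ by adding a generator $f_0$ with $f_0^*=f_0^2=f_0$, $z_i^*f_0=f_0z_i=0$; $\mathcal D(U_n)_q=\mathcal F(U_n)_qf_0\mathcal F(U_n)_q$ is the ideal of finite functions. $\mathcal F(U_n)_q$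 acts faithfully on the space $H$ with basis $\mathbf z^{\underline m}e_0$, where $z_i^*e_0=0$ and $f_0$ is the projection onto $\mathbb Ce_0$; under this action $\mathcal D(U_n)_q$ is the algebra of operators with finitely many nonzero matrix entries. **Module structure.** $\mathcal F(U_n)_q$ is a $U_q\mathfrak{su}_{n,1}$-module algebra (with invariant subalgebra $\mathcal D(U_n)_q$) with: for $k\ne n$: $K_kz_k=qz_k$, $K_kz_{k+1}=q^{-1}z_{k+1}$, $K_kz_i=z_i$ otherwise; $F_kz_k=q^{1/2}z_{k+1}$, $F_kz_i=0$ otherwise; $E_kz_{k+1}=q^{-1/2}z_k$, $E_kz_i=0$ otherwise; $K_nz_n=q^2z_n$, $K_nz_i=qz_i$ ($i<n$); $F_nz_n=q^{1/2}$, $F_nz_i=0$ ($i<n$); $E_nz_i=-q^{1/2}z_nz_i$ for all $i$; $K_jf_0=f_0$ for all $j$, $E_kf_0=F_kf_0=0$ ($k\ne n$), $F_nf_0=-\frac{q^{1/2}}{q^{-2}-1}f_0z_n^*$, $E_nf_0=-\frac{q^{1/2}}{1-q^2}z_nf_0$. **Distributions and invariant integral.** Put $y_i=1-z_iz_i^*-\dots-z_nz_n^*$; in $H$, $y_j\mathbf z^{\underline m}e_0=q^{2(m_j+\dots+m_n)}\mathbf z^{\underline m}e_0$, so functions on $\mathfrak M=\{(q^{2k_1},\dots,q^{2k_n}):\underline k\in P(n)\}$ can be evaluated on $(y_1,\dots,y_n)$. Each $f\in\mathcal F(U_n)_q$ is uniquely a finite sum $\sum_{\underline i\times\underline j=\underline0}\mathbf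 z^{\underline i}f_{\underline i,\underline j}(y_1,\dots,y_n)\mathbf z^{*\underline j}$ with $f_{\underline i,\underline j}$ functions on $\mathfrak M$ (finitely supported when $f\in\mathcal D(U_n)_q$). $\mathcal D(U_n)'_q$ is the space of infinite formal sums of this form with arbitrary functions $f_{\underline i,\underline j}$ on $\mathfrak M$, with the topology of pointwise convergence of coefficients; it is the completion of $\mathcal D(U_n)_q$; the right multiplication by elements of $\mathcal D(U_n)_q$ and the $U_q\mathfrak{su}_{n,1}$-action extend to it by continuity. $\int_{U_n}f\,d\nu_q=(q^2;q^2)_n\sum_{\underline k\in P(n)}f_{\underline 0,\underline 0}(q^{2k_1},\dots,q^{2k_n})q^{-2nk_1}q^{2k_2}\cdots q^{2k_n}$ for $f\in\mathcal D(U_n)_q$; it gives by continuity a nondegenerate pairing $(\psi,\varphi)\mapsto\int_{U_n}\psi\varphi\,d\nu_q$ of $\mathcal D(U_n)'_q$ with $\mathcal D(U_n)_q$. **Twisted action and Toeplitz operators.** $\int_{U_n}f\,dm_{\alpha,q}=(q^{2\alpha+2};q^2)_n\sum_{\underline k\in P(n)}f_{\underline 0,\underline 0}(q^{2k_1},\dots,q^{2k_n})q^{2k_1(\alpha+1)}q^{2k_2}\cdots q^{2k_n}$, $(f,g)_{\alpha,q}=\int_{U_n}g^*f\,dm_{\alpha,q}$; $L^2(dm_{\alpha,q})$ is the completion of $\mathcal D(U_n)_q$ (it contains $\mathcal P(\mathbb C^n)_q$), $P_{\alpha,q}$ the orthogonal projection onto the closure of $\mathbb C[\mathbb C^n]_q$.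 $\mathbb C[\mathbb C^n]_{q,\alpha}$ is $\mathbb C[\mathbb C^n]_q$ with this scalar product and the $U_q\mathfrak{su}_{n,1}$-action $\pi_\alpha$: $\pi_\alpha(E_j)f=E_jf$, $\pi_\alpha(F_j)f=F_jf$, $\pi_\alpha(K_j^{\pm1})f=K_j^{\pm1}f$ for $j\ne n$; $\pi_\alpha(E_n)f=E_nf-q^{1/2}\frac{1-q^{2\alpha+2n+2}}{1-q^2}(K_nf)z_n$, $\pi_\alpha(F_n)f=q^{-\alpha-n-1}F_nf$, $\pi_\alpha(K_n^{\pm1})f=q^{\pm(\alpha+n+1)}K_n^{\pm1}f$. $\mathrm{End}(\mathbb C[\mathbb C^n]_{q,\alpha})$ is a module via $\xi(T)=\sum_j\xi'_jTS(\xi''_j)$, $\Delta(\xi)=\sum_j\xi'_j\otimes\xi''_j$ (operators acting through $\pi_\alpha$). For $f\in\mathcal D(U_n)_q$, $T_f(\psi)=P_{\alpha,q}(f\psi)$; its matrix in the basis $\mathbf z^{\underline m}$ has finitely many nonzero entries. **Covariant symbols.** For an operator with finitely many nonzero matrix entries, $A\mathbf z^{\underline m}=\sum_{\underline k}A^{\underline m}_{\underline k}\mathbf z^{\underline k}$, set $\mathrm{Tr}_q(A)=\frac{(q^2;q^2)_n}{(q^{2+2\alpha};q^2)_n}\sum_{\underline m}A^{\underline m}_{\underline m}q^{-2n|\underline m|}q^{2(m_2+\dots+m_n)}q^{2(m_3+\dots+m_n)}\cdots q^{2m_n}$. The covariant symbol of $T\in\mathrm{End}(\mathbb C[\mathbb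 C^n]_{q,\alpha})$ is the unique $\sigma(T)\in\mathcal D(U_n)'_q$ with $\int_{U_n}\sigma(T)f\,d\nu_q=\mathrm{Tr}_q(T\,T_f)$ for all $f\in\mathcal D(U_n)_q$. *)

(* Defs.v *)
From HB Require Import structures.
From mathcomp Require Import all_boot all_order all_algebra.
From mathcomp Require Import all_classical all_reals all_analysis.
From mathcomp Require Import complex.

Set Implicit Arguments.
Unset Strict Implicit.
Unset Printing Implicit Defensive.

Import Order.TTheory GRing.Theory Num.Theory numFieldNormedType.Exports.
Local Open Scope classical_set_scope.
Local Open Scope ring_scope.

Section Terms.
Variables (K : comNzRingType) (X : Type).

(* Noncommutative polynomial expressions in the generators X; [Cst c] is the
   scalar multiple c.1 of the unit. *)
Inductive term : Type :=
  | Gen of X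
  | Cst of K
  | Add of term & term
  | Mul of term & term.

HB.instance Definition _ := gen_eqMixin term.
HB.instance Definition _ := gen_choiceMixin term.

Definition Scale (c : K) (t : term) := Mul (Cst c) t.
Definition Sub (s t : term) := Add s (Scale (-1) t).

(* The least congruence containing r whose quotient is an associative unital
   K-algebra. *)
Inductive pres_eq (r : term -> term -> Prop) : term -> term -> Prop :=
  | PresRel s t : r s t -> pres_eq r s t
  | PresRefl t : pres_eq r t t
  | PresSym s t : pres_eq r s t -> pres_eq r t s
  | PresTrans s t u : pres_eq r s t -> pres_eq r t u -> pres_eq r s u
  | PresAdd s s' t t' : pres_eq r s s' -> pres_eq r t t' ->
      pres_eq r (Add s t) (Add s' t')
  | PresMul s s' t t' : pres_eq r s s' -> pres_eq r t t' ->
      pres_eq r (Mul s t) (Mul s' t')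
  | PresAddA s t u : pres_eq r (Add s (Add t u)) (Add (Add s t) u)
  | PresAddC s t : pres_eq r (Add s t) (Add t s)
  | PresAdd0 t : pres_eq r (Add (Cst 0) t) t
  | PresMulA s t u : pres_eq r (Mul s (Mul t u)) (Mul (Mul s t) u)
  | PresMul1 t : pres_eq r (Mul (Cst 1) t) t
  | PresMul0 t : pres_eq r (Mul (Cst 0) t) (Cst 0)
  | PresMulDl s t u : pres_eq r (Mul (Add s t) u) (Add (Mul s u) (Mul t u))
  | PresMulDr s t u : pres_eq r (Mul s (Add t u)) (Add (Mul s t) (Mul s u))
  | PresCstD a b : pres_eq r (Cst (a + b)) (Add (Cst a) (Cst b))
  | PresCstM a b : pres_eq r (Cst (a * b)) (Mul (Cst a) (Cst b))
  | PresCstC a t : pres_eq r (Mul (Cst a) t) (Mul t (Cst a)).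

(* The antimultiplicative extension of a map g on generators, acting on scalars
   by c. *)
Fixpoint antiext (c : K -> K) (g : X -> term) (t : term) : term :=
  match t with
  | Gen x => g x
  | Cst a => Cst (c a)
  | Add s u => Add (antiext c g s) (antiext c g u)
  | Mul s u => Mul (antiext c g u) (antiext c g s)
  end.

Lemma pres_eq_antiext (r : term -> term -> Prop) (c : {rmorphism K -> K})
    (g : X -> term) :
  (forall s t, r s t -> pres_eq r (antiext c g s) (antiext c g t)) ->
  forall s t, pres_eq r s t -> pres_eq r (antiext c g s) (antiext c g t).
Proof.
move=> hr s t; elim=> {s t} /=.
- exact: hr.
- by move=> t; apply: PresRefl.
- by move=> s t _; apply: PresSym.
- by move=> s t u _ ? _; apply: PresTrans.
- by move=> s s' t t' _ ? _ ?; apply: PresAdd.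
- by move=> s s' t t' _ ? _ ?; apply: PresMul.
- by move=> s t u; apply: PresAddA.
- by move=> s t; apply: PresAddC.
- by move=> t; rewrite rmorph0; apply: PresAdd0.
- by move=> s t u; apply: PresSym; apply: PresMulA.
- move=> t; rewrite rmorph1; apply: PresTrans (PresMul1 _ _).
  by apply: PresSym; apply: PresCstC.
- move=> t; rewrite rmorph0; apply: PresTrans (PresMul0 _ _).
  by apply: PresSym; apply: PresCstC.
- by move=> s t u; apply: PresMulDr.
- by move=> s t u; apply: PresMulDl.
- by move=> a b; rewrite rmorphD; apply: PresCstD.
- move=> a b; rewrite rmorphM mulrC; apply: PresCstM.
- by move=> a t; apply: PresSym; apply: PresCstC.
Qed.

End Terms.

Arguments Gen {K X}.
Arguments Cst {K X}.

Declare Scope nterm_scope.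
Delimit Scope nterm_scope with T.
Bind Scope nterm_scope with term.
Infix "+" := Add : nterm_scope.
Infix "-" := Sub : nterm_scope.
Infix "*" := Mul : nterm_scope.
Infix "*:" := Scale : nterm_scope.

Section Presented.
Variables (K : comNzRingType) (X : Type) (r : term K X -> term K X -> Prop).

Definition pres_rel : rel (term K X) := fun s t => `[< pres_eq r s t >].

Lemma pres_rel_refl : reflexive pres_rel.
Proof. by move=> t; apply/asboolP; constructor. Qed.

Lemma pres_rel_sym : symmetric pres_rel.
Proof. by move=> s t; apply/asboolP/asboolP => ?; apply: PresSym. Qed.

Lemma pres_rel_trans : transitive pres_rel.
Proof.
by move=> s t u /asboolP ts /asboolP su; apply/asboolP; apply: PresTrans su.
Qed.

Canonical pres_equiv :=
  EquivRel pres_rel pres_rel_refl pres_rel_sym pres_rel_trans.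

Definition pres := {eq_quot pres_equiv}%qT.
HB.instance Definition _ := Choice.on pres.

Definition cls (t : term K X) : pres := (\pi_pres t)%qT.

Lemma clsP s t : cls s = cls t <-> pres_eq r s t.
Proof.
rewrite /cls; split=> [/eqP|] h; first by move: h; rewrite eqmodE => /asboolP.
by apply/eqP; rewrite eqmodE; apply/asboolP.
Qed.

Lemma cls_ind (P : pres -> Prop) : (forall t, P (cls t)) -> forall x, P x.
Proof. by move=> h x; rewrite -[x]reprK; apply: h. Qed.

Lemma repr_cls t : pres_eq r (repr (cls t)) t.
Proof. by apply/clsP; rewrite /cls reprK. Qed.

Definition pres_add (x y : pres) : pres := cls (repr x + repr y)%T.
Definition pres_mul (x y : pres) : pres := cls (repr x * repr y)%T.
Definition pres_scale (c : K) (x : pres) : pres := cls (c *: repr x)%T.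

Lemma pres_addE s t : pres_add (cls s) (cls t) = cls (s + t)%T.
Proof. by apply/clsP; apply: PresAdd; apply: repr_cls. Qed.

Lemma pres_mulE s t : pres_mul (cls s) (cls t) = cls (s * t)%T.
Proof. by apply/clsP; apply: PresMul; apply: repr_cls. Qed.

Lemma pres_scaleE c t : pres_scale c (cls t) = cls (c *: t)%T.
Proof. by apply/clsP; apply: PresMul (repr_cls _); constructor. Qed.

Let presE := (pres_addE, pres_mulE, pres_scaleE).

Fact pres_addA : associative pres_add.
Proof.
elim/cls_ind=> s; elim/cls_ind=> t; elim/cls_ind=> u.
by rewrite !presE; apply/clsP; constructor.
Qed.

Fact pres_addC : commutative pres_add.
Proof.
elim/cls_ind=> s; elim/cls_ind=> t.
by rewrite !presE; apply/clsP; constructor.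
Qed.

Fact pres_add0 : left_id (cls (Cst 0)) pres_add.
Proof. by elim/cls_ind=> s; rewrite !presE; apply/clsP; constructor. Qed.

Fact pres_addN : left_inverse (cls (Cst 0)) (pres_scale (-1)) pres_add.
Proof.
elim/cls_ind=> s; rewrite !presE; apply/clsP.
apply: PresTrans (PresMul0 _ s); rewrite -(addNr (1 : K)).
apply: (@PresTrans _ _ _ _ (((-1) *: s) + (Cst 1 * s))%T).
  by apply: PresAdd; [constructor | apply: PresSym; constructor].
apply: PresTrans (PresSym (PresMulDl _ _ _ _)) _.
by apply: PresMul; [apply: PresSym; constructor | constructor].
Qed.

HB.instance Definition _ :=
  GRing.isZmodule.Build pres pres_addA pres_addC pres_add0 pres_addN.

Fact pres_mulA : associative pres_mul.
Proof.
elim/cls_ind=> s; elim/cls_ind=> t; elim/cls_ind=> u.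
by rewrite !presE; apply/clsP; constructor.
Qed.

Fact pres_mul1l : left_id (cls (Cst 1)) pres_mul.
Proof. by elim/cls_ind=> s; rewrite !presE; apply/clsP; constructor. Qed.

Fact pres_mul1r : right_id (cls (Cst 1)) pres_mul.
Proof.
elim/cls_ind=> s; rewrite !presE; apply/clsP.
by apply: PresTrans (PresSym (PresCstC _ _ _)) _; constructor.
Qed.

Fact pres_mulDl : left_distributive pres_mul +%R.
Proof.
elim/cls_ind=> s; elim/cls_ind=> t; elim/cls_ind=> u.
by rewrite /GRing.add /= !presE; apply/clsP; constructor.
Qed.

Fact pres_mulDr : right_distributive pres_mul +%R.
Proof.
elim/cls_ind=> s; elim/cls_ind=> t; elim/cls_ind=> u.
by rewrite /GRing.add /= !presE; apply/clsP; constructor.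
Qed.

HB.instance Definition _ :=
  GRing.Zmodule_isPzRing.Build pres pres_mulA pres_mul1l pres_mul1r
    pres_mulDl pres_mulDr.

Fact pres_scaleA a b (v : pres) :
  pres_scale a (pres_scale b v) = pres_scale (a * b) v.
Proof.
elim/cls_ind: v => s; rewrite !presE; apply/clsP.
apply: PresTrans (PresMulA _ _ _ _) _; apply: PresMul; last exact: PresRefl.
by apply: PresSym; constructor.
Qed.

Fact pres_scale1 : left_id 1 pres_scale.
Proof. by elim/cls_ind=> s; rewrite !presE; apply/clsP; constructor. Qed.

Fact pres_scaleDr : right_distributive pres_scale +%R.
Proof.
move=> a; elim/cls_ind=> s; elim/cls_ind=> t.
by rewrite /GRing.add /= !presE; apply/clsP; constructor.
Qed.

Fact pres_scaleDl (v : pres) : {morph pres_scale^~ v : a b / a + b}.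
Proof.
move=> a b; elim/cls_ind: v => s.
rewrite {2}/GRing.add /= !presE; apply/clsP.
apply: PresTrans (PresMulDl _ _ _ _); apply: PresMul; last exact: PresRefl.
by constructor.
Qed.

HB.instance Definition _ :=
  GRing.Zmodule_isLmodule.Build K pres pres_scaleA pres_scale1
    pres_scaleDr pres_scaleDl.

Lemma clsD s t : cls (s + t)%T = cls s + cls t.
Proof. by apply: esym; exact: (pres_addE s t). Qed.

Lemma clsM s t : cls (s * t)%T = cls s * cls t.
Proof. by apply: esym; exact: (pres_mulE s t). Qed.

Lemma clsZ c t : cls (c *: t)%T = c *: cls t.
Proof. by apply: esym; exact: (pres_scaleE c t). Qed.

Lemma cls1 : cls (Cst 1) = 1. Proof. by []. Qed.
Lemma cls0 : cls (Cst 0) = 0. Proof. by []. Qed.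

Lemma pres_scalerAl c (x y : pres) : c *: (x * y) = (c *: x) * y.
Proof.
elim/cls_ind: x => s; elim/cls_ind: y => t.
rewrite -(clsM s t) -(clsZ c s) -(clsZ c (s * t)%T) -(clsM (c *: s)%T t).
by apply/clsP; constructor.
Qed.

Lemma pres_scalerAr c (x y : pres) : c *: (x * y) = x * (c *: y).
Proof.
elim/cls_ind: x => s; elim/cls_ind: y => t.
rewrite -(clsM s t) -(clsZ c t) -(clsZ c (s * t)%T) -(clsM s (c *: t)%T).
apply/clsP; apply: PresTrans (PresMulA _ _ _ _) _.
apply: PresTrans (PresSym (PresMulA _ _ _ _)).
by apply: PresMul; constructor.
Qed.

Lemma cls_Cst c : cls (Cst c) = c *: (1 : pres).
Proof.
rewrite -cls1 -(clsZ c (Cst 1)); apply/clsP; apply: PresTrans (PresCstC _ _ _).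
by apply: PresSym; constructor.
Qed.

End Presented.

(* R[i], as a numClosedFieldType so that it inherits its usual topology. *)
Definition Cx (R : realType) : numClosedFieldType := R[i].

Definition toCx {R : realType} (x : R) : Cx R := (x%:C)%C.

Lemma toCx_conj (R : realType) (x : R) : (toCx x)^* = toCx x.
Proof. by rewrite /toCx; apply/eqP; rewrite eq_complex /= oppr0 !eqxx. Qed.

Definition qpoch {R : realType} (a b : R) (m : nat) : R :=
  \prod_(j < m) (1 - a * b ^+ j).

Definition midx (n : nat) := {ffun 'I_n -> nat}.

Definition midx0 {n} : midx n := [ffun => 0%N].

(* P(n); its element k stands for the point (q^(2 k_1), ..., q^(2 k_n)) of the
   set on which coefficient functions are defined. *)
Definition is_part {n} (k : midx n) : bool :=
  [forall i : 'I_n, forall j : 'I_n, (i <= j)%N ==> (k j <= k i)%N].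

Definition Pn (n : nat) := {k : midx n | is_part k}.

Definition tail {n} (m : midx n) : midx n :=
  [ffun j : 'I_n => \sum_(l < n | (j <= l)%N) m l]%N.

Lemma tail_part n (m : midx n) : is_part (tail m).
Proof.
apply/forallP => i; apply/forallP => j; apply/implyP => ij; rewrite !ffunE.
rewrite [leqRHS](bigID (fun l : 'I_n => (j <= l)%N)) /=.
rewrite [X in (_ <= X + _)%N](eq_bigl (fun l : 'I_n => (j <= l)%N)) ?leq_addr //.
by move=> l; case: (leqP j l) => [jl|]; rewrite ?andbF // (leq_trans ij jl).
Qed.

Definition ptail {n} (m : midx n) : Pn n := exist _ (tail m) (tail_part m).

Definition disj_pair {n} (p : midx n * midx n) : bool :=
  [forall l : 'I_n, (p.1 l * p.2 l == 0)%N].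

Definition Dix (n : nat) := {p : midx n * midx n | disj_pair p}.

Lemma disj_pair0 n : disj_pair (midx0 : midx n, midx0 : midx n).
Proof. by apply/forallP => l; rewrite ffunE. Qed.

Definition Dix0 {n} : Dix n := exist _ (midx0, midx0) (disj_pair0 n).

Section Bases.
Variables (K : fieldType) (V : lmodType K) (I : choiceType).

Definition fin_comb (e : I -> V) (c : I -> K) (v : V) : Prop :=
  finite_set [set i | c i != 0] /\ v = \sum_(i \in [set: I]) c i *: e i.

Definition is_basis (e : I -> V) : Prop :=
  forall v, exists! c : I -> K, fin_comb e c v.

Definition coords (e : I -> V) (v : V) : I -> K :=
  xget (fun=> 0) [set c | fin_comb e c v].

End Bases.

Section QuantumGroup.
Variables (R : realType) (n : nat) (q : R).

Notation C := (Cx R).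

Inductive Ugen : Type :=
  UE of 'I_n | UF of 'I_n | UK of 'I_n | UKinv of 'I_n.

Definition Uterm := term C Ugen.

Definition tE i : Uterm := Gen (UE i).
Definition tF i : Uterm := Gen (UF i).
Definition tK i : Uterm := Gen (UK i).
Definition tKinv i : Uterm := Gen (UKinv i).

Definition is_last (j : 'I_n) : bool := (j.+1 == n)%N.

Definition adjacent (i j : 'I_n) : bool := (i.+1 == j) || (j.+1 == i).

Definition cartan (i j : 'I_n) : int :=
  if i == j then 2 else if adjacent i j then -1 else 0.

Definition serre (x y : Uterm) : Uterm :=
  (x * x * y - toCx (q + q^-1) *: (x * y * x) + y * x * x)%T.

Inductive Urel : Uterm -> Uterm -> Prop :=
  | URelKKinv i : Urel (tK i * tKinv i)%T (Cst 1)
  | URelKinvK i : Urel (tKinv i * tK i)%T (Cst 1)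
  | URelKK i j : Urel (tK i * tK j)%T (tK j * tK i)%T
  | URelKE i j : Urel (tK i * tE j)%T (toCx (q ^ cartan i j) *: (tE j * tK i))%T
  | URelKF i j :
      Urel (tK i * tF j)%T (toCx (q ^ (- cartan i j)) *: (tF j * tK i))%T
  | URelEF i : Urel (tE i * tF i - tF i * tE i)%T
      (toCx (q - q^-1)^-1 *: (tK i - tKinv i))%T
  | URelEF0 i j : i != j -> Urel (tE i * tF j - tF j * tE i)%T (Cst 0)
  | URelSerreE i j : adjacent i j -> Urel (serre (tE i) (tE j)) (Cst 0)
  | URelSerreF i j : adjacent i j -> Urel (serre (tF i) (tF j)) (Cst 0)
  | URelEE i j : ~~ adjacent i j -> Urel (tE i * tE j)%T (tE j * tE i)%T
  | URelFF i j : ~~ adjacent i j -> Urel (tF i * tF j)%T (tF j * tF i)%T.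

Definition Uq := pres Urel.

(* The structure maps of the Hopf *-algebra, on representatives (each preserves
   the congruence generated by Urel, up to equality of tensors): a class xi of
   Uq is [cls t] for some noncommutative polynomial t, and [coprod t] is a list
   of pairs (xi', xi'') whose tensors sum to the coproduct of xi. *)
Definition coprod_gen (x : Ugen) : seq (Uterm * Uterm) :=
  match x with
  | UE i => [:: (tE i, Cst 1); (tK i, tE i)]
  | UF i => [:: (tF i, tKinv i); (Cst 1, tF i)]
  | UK i => [:: (tK i, tK i)]
  | UKinv i => [:: (tKinv i, tKinv i)]
  end.

Fixpoint coprod (t : Uterm) : seq (Uterm * Uterm) :=
  match t with
  | Gen x => coprod_gen x
  | Cst c => [:: (Cst c, Cst 1)]
  | Add s u => coprod s ++ coprod u
  | Mul s u => [seq (a.1 * b.1, a.2 * b.2)%T | a <- coprod s, b <- coprod u]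
  end.

Fixpoint counit (t : Uterm) : C :=
  match t with
  | Gen (UE _) | Gen (UF _) => 0
  | Gen (UK _) | Gen (UKinv _) => 1
  | Cst c => c
  | Add s u => counit s + counit u
  | Mul s u => counit s * counit u
  end.

Definition antipode_gen (x : Ugen) : Uterm :=
  match x with
  | UE i => (-1) *: (tKinv i * tE i)
  | UF i => (-1) *: (tF i * tK i)
  | UK i => tKinv i
  | UKinv i => tK i
  end%T.

Definition antipode : Uterm -> Uterm := antiext id antipode_gen.

Definition Ustar_gen (x : Ugen) : Uterm :=
  match x with
  | UE j => (if is_last j then -1 else 1) *: (tK j * tF j)
  | UF j => (if is_last j then -1 else 1) *: (tE j * tKinv j)
  | UK j => tK j
  | UKinv j => tKinv j
  end%T.

Definition Ustar : Uterm -> Uterm := antiext Num.conj Ustar_gen.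

Definition is_Uq_module (V : lmodType C) (a : Uq -> V -> V) : Prop :=
  [/\ forall xi, linear (a xi),
      forall (c : C) xi eta v, a (c *: xi + eta) v = c *: a xi v + a eta v,
      forall v, a 1 v = v &
      forall xi eta v, a (xi * eta) v = a xi (a eta v)].

End QuantumGroup.

Arguments tE {R n}.
Arguments tF {R n}.
Arguments tK {R n}.
Arguments tKinv {R n}.

Section FunctionAlgebra.
Variables (R : realType) (n : nat) (q : R).

Notation C := (Cx R).

Inductive Fgen : Type := Fz of 'I_n | Fzs of 'I_n | Ff0.

Definition Fterm := term C Fgen.

Definition tz i : Fterm := Gen (Fz i).
Definition tzs i : Fterm := Gen (Fzs i).
Definition tf0 : Fterm := Gen Ff0.

(* The defining relations, together with the adjoints of those that are not
   self-adjoint. *)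
Inductive Frel : Fterm -> Fterm -> Prop :=
  | FRelzz (i j : 'I_n) : (i < j)%N -> Frel (tz i * tz j)%T (toCx q *: (tz j * tz i))%T
  | FRelzszs (i j : 'I_n) : (i < j)%N ->
      Frel (tzs j * tzs i)%T (toCx q *: (tzs i * tzs j))%T
  | FRelzsz i j : i != j -> Frel (tzs i * tz j)%T (toCx q *: (tz j * tzs i))%T
  | FRelzszD j : Frel (tzs j * tz j)%T
      (toCx (q ^+ 2) *: (tz j * tzs j) +
       toCx (1 - q ^+ 2) *:
         (Cst 1 - foldr (@Add _ _) (Cst 0)
                    [seq tz k * tzs k | k : 'I_n <- enum 'I_n & (j < k)%N]))%T
  | FRelf0 : Frel (tf0 * tf0)%T tf0
  | FRelzsf0 i : Frel (tzs i * tf0)%T (Cst 0)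
  | FRelf0z i : Frel (tf0 * tz i)%T (Cst 0).

Definition Fq := pres Frel.

Definition z (i : 'I_n) : Fq := cls Frel (tz i).
Definition zs (i : 'I_n) : Fq := cls Frel (tzs i).
Definition f0 : Fq := cls Frel tf0.

Definition Fstar_gen (x : Fgen) : Fterm :=
  match x with Fz i => tzs i | Fzs i => tz i | Ff0 => tf0 end.

Definition Fstar_term : Fterm -> Fterm := antiext Num.conj Fstar_gen.

Definition Fstar (f : Fq) : Fq := cls Frel (Fstar_term (repr f)).

Lemma Frel_star s t : Frel s t ->
  pres_eq Frel (Fstar_term s) (Fstar_term t).
Proof.
have scaleC c u : pres_eq Frel (u * Cst c)%T (c *: u)%T.
  by apply: PresSym; apply: PresCstC.
rewrite /Fstar_term; case=> {s t} /=.
- move=> i j ij; rewrite toCx_conj; apply: PresSym.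
  apply: PresTrans (scaleC _ _) _; apply: PresSym; apply: PresRel.
  exact: FRelzszs.
- move=> i j ij; rewrite toCx_conj; apply: PresSym.
  apply: PresTrans (scaleC _ _) _; apply: PresSym; apply: PresRel.
  exact: FRelzz.
- move=> i j ij; rewrite toCx_conj; apply: PresSym.
  apply: PresTrans (scaleC _ _) _; apply: PresSym; apply: PresRel.
  by apply: FRelzsz; rewrite eq_sym.
- move=> j; rewrite rmorphN !rmorph1 !toCx_conj.
  apply: PresTrans (PresRel (FRelzszD j)) _; apply: PresSym.
  apply: PresAdd; first exact: scaleC.
  apply: PresTrans (scaleC _ _) _.
  apply: PresMul; first exact: PresRefl.
  apply: PresAdd; first exact: PresRefl.
  apply: PresTrans (scaleC _ _) _.
  apply: PresMul; first exact: PresRefl.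
  elim: (X in map _ X) => [|k s IH] /=; first by rewrite rmorph0; apply: PresRefl.
  by apply: PresAdd => //; apply: PresRefl.
- by apply: PresRel; apply: FRelf0.
- by move=> i; rewrite rmorph0; apply: PresRel; apply: FRelf0z.
- by move=> i; rewrite rmorph0; apply: PresRel; apply: FRelzsf0.
Qed.

Lemma FstarE t : Fstar (cls Frel t) = cls Frel (Fstar_term t).
Proof.
apply/clsP.
exact: (pres_eq_antiext (c := Num.conj) Frel_star) (repr_cls _ _).
Qed.

(* z^m = z_n^(m_n) ... z_1^(m_1) and z^*m = z_1^*(m_1) ... z_n^*(m_n). *)
Definition zmon (m : midx n) : Fq :=
  \prod_(j < n) z (rev_ord j) ^+ m (rev_ord j).

Definition zsmon (m : midx n) : Fq := \prod_(j < n) zs j ^+ m j.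

Definition finite_fun : set Fq :=
  [set f | exists s : seq (Fq * Fq), f = \sum_(p <- s) p.1 * f0 * p.2].

Inductive holomorphic : Fq -> Prop :=
  | HoloZ i : holomorphic (z i)
  | HoloCst (c : C) : holomorphic (c *: (1 : Fq))
  | HoloAdd f g : holomorphic f -> holomorphic g -> holomorphic (f + g)
  | HoloMul f g : holomorphic f -> holomorphic g -> holomorphic (f * g).

Definition holo_pred : {pred Fq} := fun f => `[< holomorphic f >].

Fact holo_submod : submod_closed holo_pred.
Proof.
split=> [|c f g /asboolP hf /asboolP hg]; apply/asboolP.
  by rewrite -(scale0r (1 : Fq)); constructor.
apply: HoloAdd => //; rewrite -[f]mul1r pres_scalerAl.
by apply: HoloMul => //; constructor.
Qed.

HB.instance Definition _ :=
  GRing.isSubmodClosed.Build C Fq holo_pred holo_submod.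

Record holo := Holo { hval :> Fq; hvalP : hval \in holo_pred }.

HB.instance Definition _ := [isSub for hval].
HB.instance Definition _ := [Choice of holo by <:].
HB.instance Definition _ := [SubChoice_isSubLmodule of holo by <:].

End FunctionAlgebra.

Arguments z {R n}.
Arguments zs {R n}.
Arguments f0 {R n}.
Arguments zmon {R n}.
Arguments zsmon {R n}.

Section Structures.
Variables (R : realType) (n : nat) (q : R).

Notation C := (Cx R).
Notation Uq := (Uq n q).
Notation Fq := (Fq n q).
Notation holo := (holo n q).
Notation z := (z q).
Notation zs := (zs q).
Notation f0 := (@f0 R n q).
Notation Ucls := (cls (Urel q)).

(* The Uq-module algebra structure of Fq.  The formulas determine it uniquely:
   the values on the z_i^* follow from [act_star]. *)
Record module_algebra := ModuleAlgebra {
  act :> Uq -> Fq -> Fq;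
  act_module : is_Uq_module act;
  act_mul : forall t f g, act (Ucls t) (f * g) =
    \sum_(p <- coprod t) act (Ucls p.1) f * act (Ucls p.2) g;
  act_one : forall t, act (Ucls t) 1 = counit t *: (1 : Fq);
  act_star : forall t f,
    Fstar (act (Ucls t) f) = act (Ucls (Ustar (antipode t))) (Fstar f);
  act_K_same : forall k, ~~ is_last k ->
    act (Ucls (tK k)) (z k) = toCx q *: z k;
  act_K_next : forall k l : 'I_n, l = k.+1 :> nat ->
    act (Ucls (tK k)) (z l) = toCx q^-1 *: z l;
  act_K_other : forall k i : 'I_n, ~~ is_last k -> i != k -> i != k.+1 :> nat ->
    act (Ucls (tK k)) (z i) = z i;
  act_F_same : forall k l : 'I_n, l = k.+1 :> nat ->
    act (Ucls (tF k)) (z k) = toCx (Num.sqrt q) *: z l;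
  act_F_other : forall k i, ~~ is_last k -> i != k ->
    act (Ucls (tF k)) (z i) = 0;
  act_E_next : forall k l : 'I_n, l = k.+1 :> nat ->
    act (Ucls (tE k)) (z l) = toCx (Num.sqrt q)^-1 *: z k;
  act_E_other : forall k i : 'I_n, ~~ is_last k -> i != k.+1 :> nat ->
    act (Ucls (tE k)) (z i) = 0;
  act_Kn_same : forall k, is_last k ->
    act (Ucls (tK k)) (z k) = toCx (q ^+ 2) *: z k;
  act_Kn_other : forall k i, is_last k -> i != k ->
    act (Ucls (tK k)) (z i) = toCx q *: z i;
  act_Fn_same : forall k, is_last k ->
    act (Ucls (tF k)) (z k) = toCx (Num.sqrt q) *: (1 : Fq);
  act_Fn_other : forall k i, is_last k -> i != k ->
    act (Ucls (tF k)) (z i) = 0;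
  act_En : forall k i, is_last k ->
    act (Ucls (tE k)) (z i) = toCx (- Num.sqrt q) *: (z k * z i);
  act_K_f0 : forall k, act (Ucls (tK k)) f0 = f0;
  act_E_f0 : forall k, ~~ is_last k -> act (Ucls (tE k)) f0 = 0;
  act_F_f0 : forall k, ~~ is_last k -> act (Ucls (tF k)) f0 = 0;
  act_Fn_f0 : forall k, is_last k ->
    act (Ucls (tF k)) f0 =
      toCx (- (Num.sqrt q / (q ^- 2 - 1))) *: (f0 * zs k);
  act_En_f0 : forall k, is_last k ->
    act (Ucls (tE k)) f0 = toCx (- (Num.sqrt q / (1 - q ^+ 2))) *: (z k * f0)
}.

Record fock_rep := FockRep {
  fspace :> lmodType C;
  fock : Fq -> fspace -> fspace;
  vac : fspace;
  fock_linear : forall f, linear (fock f);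
  fock_linearl : forall (c : C) f g h,
    fock (c *: f + g) h = c *: fock f h + fock g h;
  fock_one : forall h, fock 1 h = h;
  fock_mul : forall f g h, fock (f * g) h = fock f (fock g h);
  fock_basis : is_basis (fun m => fock (zmon q m) vac);
  fock_zs : forall i, fock (zs i) vac = 0;
  fock_f0 : forall m,
    fock f0 (fock (zmon q m) vac) = if m == midx0 then vac else 0
}.

(* The space D(U_n)'_q of formal series sum z^i f_ij(y) z^*j, each encoded by
   its family of coefficient functions f_ij, with pointwise convergence. *)
Definition distr := {ptws (Dix n * Pn n) -> C}.

Section Fock.
Variable H : fock_rep.

Definition fbasis (m : midx n) : H := fock (zmon q m) (vac H).

(* phi(y_1, ..., y_n): y_j has the eigenvalue q^(2 (m_j + ... + m_n)) on
   z^m e_0. *)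
Definition fun_y (phi : Pn n -> C) (h : H) : H :=
  \sum_(m \in [set: midx n])
     (phi (ptail m) * coords fbasis h m) *: fbasis m.

Definition series_term (psi : distr) (ij : Dix n) (h : H) : H :=
  fock (zmon q (val ij).1)
    (fun_y (fun k => psi (ij, k)) (fock (zsmon q (val ij).2) h)).

(* The image of f in the space of distributions: the coefficient functions of
   its normal form, a finite sum whose terms act on H through functions of y. *)
Definition coeff (f : Fq) : distr :=
  xget ((fun=> 0) : distr)
    [set psi : distr |
      finite_set [set ij | exists k, psi (ij, k) != 0] /\
      forall h : H, fock f h = \sum_(ij \in [set: Dix n]) series_term psi ij h].

(* The finite functions embed densely through coeff, so that the extension is
   unique when it exists. *)
Definition cont_ext (T : topologicalType) (t0 : T) (u : Fq -> T) : distr -> T :=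
  xget (fun=> t0)
    [set G : distr -> T | continuous G /\
       forall f, finite_fun f -> G (coeff f) = u f].

Definition nu_weight (k : midx n) : R :=
  \prod_(j < n) (if j == 0%N :> nat then q ^- (2 * n * k j) else q ^+ (2 * k j)).

Definition int_nu (f : Fq) : C :=
  toCx (qpoch (q ^+ 2) (q ^+ 2) n) *
  \sum_(k \in [set: Pn n]) coeff f (Dix0, k) * toCx (nu_weight (val k)).

(* The integral of psi phi against nu, extended by continuity in psi. *)
Definition pairing (psi : distr) (phi : Fq) : C :=
  cont_ext 0 (fun f => int_nu (f * phi)) psi.

Definition act_distr (a : module_algebra) (xi : Uq) : distr -> distr :=
  cont_ext ((fun=> 0) : distr) (fun f => coeff (a xi f)).

Variable alpha : R.

Definition m_weight (k : midx n) : R :=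
  \prod_(j < n) (if j == 0%N :> nat then q `^ (2 * (k j)%:R * (alpha + 1))
                 else q ^+ (2 * k j)).

(* The series over P(n), summed along the exhaustion k_1 < N; it is absolutely
   convergent. *)
Definition int_m (f : Fq) : C :=
  toCx (qpoch (q `^ (2 * alpha + 2)) (q ^+ 2) n) *
  lim ((fun N : nat =>
    \sum_(k \in [set k : Pn n | forall j, (val k j < N)%N])
       coeff f (Dix0, k) * toCx (m_weight (val k))) @ \oo).

Definition dot_m (f g : Fq) : C := int_m (Fstar g * f).

(* The Hilbert space completion of the finite functions for dot_m.  As a vector
   space Fq is spanned by the finite functions and the polynomials in the z_i
   and z_i^*, and both embed. *)
Record L2_completion := L2Completion {
  L2 :> completeNormedModType C;
  L2dot : L2 -> L2 -> C;
  L2emb : Fq -> L2;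
  L2dot_linear : forall (c : C) u v w,
    L2dot (c *: u + v) w = c * L2dot u w + L2dot v w;
  L2dot_conj : forall u v, L2dot v u = (L2dot u v)^*;
  L2dot_norm : forall u, `|u| ^+ 2 = L2dot u u;
  L2emb_linear : linear L2emb;
  L2emb_dot : forall f g, L2dot (L2emb f) (L2emb g) = dot_m f g;
  L2emb_dense : closure (L2emb @` (@finite_fun R n q)) = setT
}.

Section Toeplitz.
Variable L : L2_completion.

Definition bergman : set L := closure (L2emb L @` (@holomorphic R n q)).

Definition is_projection (v p : L) : Prop :=
  bergman p /\ forall w, bergman w -> L2dot (v - p) w = 0.

Definition toeplitz (f : Fq) (psi : holo) : holo :=
  xget 0 [set p : holo | is_projection (L2emb L (f * hval psi))
                                       (L2emb L (hval p))].

End Toeplitz.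

End Fock.

Section Symbols.
Variables (H : fock_rep) (alpha : R) (L : L2_completion H alpha).

Fact zmon_holo (m : midx n) : zmon q m \in @holo_pred R n q.
Proof.
apply/asboolP; rewrite /zmon.
have h1 : holomorphic (1 : Fq).
  by rewrite -[1 in X in _ X](scale1r (1 : Fq)); apply: HoloCst.
elim/big_rec: _ => [//|j f _ hf]; apply: HoloMul => //.
elim: (m _) => [|k IH]; first by rewrite expr0.
by rewrite exprS; apply: HoloMul => //; apply: HoloZ.
Qed.

Definition holo_basis (m : midx n) : holo := Holo (zmon_holo m).

Definition tr_weight (m : midx n) : R :=
  q ^- (2 * n * \sum_(l < n) m l) *
  \prod_(j < n | j != 0%N :> nat) q ^+ (2 * \sum_(l < n | (j <= l)%N) m l).

Definition tr_q (A : holo -> holo) : C :=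
  toCx (qpoch (q ^+ 2) (q ^+ 2) n / qpoch (q `^ (2 + 2 * alpha)) (q ^+ 2) n) *
  \sum_(m \in [set: midx n])
     coords holo_basis (A (holo_basis m)) m * toCx (tr_weight m).

Definition is_covariant_symbol (T : holo -> holo) (s : distr) : Prop :=
  forall f : Fq, finite_fun f -> pairing H s f = tr_q (T \o toeplitz L f).

Definition covariant_symbol (T : holo -> holo) : distr :=
  xget ((fun=> 0) : distr) [set s | is_covariant_symbol T s].

End Symbols.

Record twisted_action (a : module_algebra) (alpha : R) := TwistedAction {
  tact :> Uq -> holo -> holo;
  tact_module : is_Uq_module tact;
  tact_E : forall k f, ~~ is_last k ->
    hval (tact (Ucls (tE k)) f) = a (Ucls (tE k)) (hval f);
  tact_F : forall k f, ~~ is_last k ->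
    hval (tact (Ucls (tF k)) f) = a (Ucls (tF k)) (hval f);
  tact_K : forall k f, ~~ is_last k ->
    hval (tact (Ucls (tK k)) f) = a (Ucls (tK k)) (hval f);
  tact_Kinv : forall k f, ~~ is_last k ->
    hval (tact (Ucls (tKinv k)) f) = a (Ucls (tKinv k)) (hval f);
  tact_En : forall k f, is_last k ->
    hval (tact (Ucls (tE k)) f) = a (Ucls (tE k)) (hval f) -
      toCx (Num.sqrt q * ((1 - q `^ (2 * alpha + 2 * n%:R + 2)) / (1 - q ^+ 2)))
        *: (a (Ucls (tK k)) (hval f) * z k);
  tact_Fn : forall k f, is_last k ->
    hval (tact (Ucls (tF k)) f) =
      toCx (q `^ (- alpha - n%:R - 1)) *: a (Ucls (tF k)) (hval f);
  tact_Kn : forall k f, is_last k ->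
    hval (tact (Ucls (tK k)) f) =
      toCx (q `^ (alpha + n%:R + 1)) *: a (Ucls (tK k)) (hval f);
  tact_Kninv : forall k f, is_last k ->
    hval (tact (Ucls (tKinv k)) f) =
      toCx (q `^ (- (alpha + n%:R + 1))) *: a (Ucls (tKinv k)) (hval f)
}.

(* xi(T) = sum xi' T S(xi''), for xi the class of t. *)
Definition act_End (p : Uq -> holo -> holo) (t : Uterm R n) (T : holo -> holo) :
    holo -> holo :=
  fun f => \sum_(x <- coprod t) p (Ucls x.1) (T (p (Ucls (antipode x.2)) f)).

End Structures.

(* Main.v *)
From HB Require Import structures.
From mathcomp Require Import all_boot all_order all_algebra.
From mathcomp Require Import all_classical all_reals all_analysis.
From mathcomp Require Import complex ring lra zify.
Require Import Defs.

Set Implicit Arguments.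
Unset Strict Implicit.
Unset Printing Implicit Defensive.

Import Order.TTheory GRing.Theory Num.Theory numFieldNormedType.Exports.
Local Open Scope classical_set_scope.
Local Open Scope ring_scope.

(** The symbol of A is defined by the pairing: the integral of sigma(A) f against
    the invariant measure is Tr_q(A T_f) for every finite function f. An element
    t of the quantum group can be moved across both sides of this identity, and
    each time it turns into its antipode S(t):
    - the integral of (t psi) f is that of psi (S(t) f), because the integral is
      invariant; this is [nu_adjoint] for functions and, by density of the
      finite functions, [pairing_act] for distributions;
    - Tr_q((t A) T_f) = Tr_q(A T_{S(t) f}), which is [tr_adjoint].
    Since a distribution is determined by its pairings with finite functions
    ([distr_ext]), sigma(t A) and t sigma(A) coincide.

    The identity for traces is checked on generators and extends to products,
    because t |-> (A |-> t A) is multiplicative and S reverses products. For a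
    generator it combines two facts. First, f |-> T_f is equivariant
    ([toeplitz_K], [toeplitz_E], [toeplitz_F]). The matrix entry of T_f between h
    and z^m is the integral of z^*m f h against dm ([toeplitz_hdot]), so that
    equivariance is an integration by parts. For k < n the integral is invariant
    under E_k and F_k. For the last index it is not, but E_n and F_n act as
    twisted commutators with z_n and z_n^* ([act_En_inner], [act_Fn_inner]), and
    moving z_n around the integral costs a constant ([tau_z_last]) which the
    twist of the action on polynomials absorbs. Second, Tr_q is cyclic up to a
    power of q: moving E_k or F_k around the trace costs q^(-2) or q^2
    ([tr_comm_E], [tr_comm_F]), and these factors are the ones that arise from
    commuting E_k and F_k with K_k.

    All computations take place in explicit bases. The finite functions are
    spanned by the elements z^a f0 z^*b, which multiply like matrix units
    ([munitM], [finite_ind]). The coefficients of their normal forms are point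
    masses ([coeff_munit]), and the pairs (a, b) are in bijection with the points
    at which a distribution is evaluated ([mpt_surj], [mpt_inj]). Therefore the
    matrix units form, up to scalars, a basis dual to the evaluations
    ([pairing_munit]); this gives the continuous extensions of the pairing and of
    the action, and the existence and uniqueness of symbols ([symbolP],
    [symbol_unique]). On the other side the monomials z^m are orthogonal for dm,
    with norms that are sums of n-fold q-binomial series ([qbinomial_series],
    [int_m_zszm]), so that the Bergman projection of a finite function is an
    explicit polynomial ([projectionP]). *)

(** * Real scalars inside the complex ones *)

Section RealScalars.
Variable R : realType.
Fact toCx_zmod_morphism : zmod_morphism (@toCx R).
Proof. exact: (raddfB (real_complex R)). Qed.
Fact toCx_monoid_morphism : monoid_morphism (@toCx R).
Proof. by split; [exact: (rmorph1 (real_complex R)) | exact: (rmorphM (real_complex R))]. Qed.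
HB.instance Definition _ :=
  GRing.isZmodMorphism.Build R (Cx R) (@toCx R) toCx_zmod_morphism.
HB.instance Definition _ :=
  GRing.isMonoidMorphism.Build R (Cx R) (@toCx R) toCx_monoid_morphism.
Lemma toCx_eq0 (x : R) : (toCx x == 0) = (x == 0). Proof. exact: fmorph_eq0. Qed.
Lemma toCx_norm (x : R) : `|toCx x| = toCx `|x|.
Proof. by rewrite /toCx normc_def /= expr0n /= addr0 sqrtr_sqr. Qed.

End RealScalars.

Section ScalarRules.
Variable R : realType.
Implicit Types x y : R.
Lemma toCxD x y : toCx (x + y) = toCx x + toCx y. Proof. exact: rmorphD. Qed.
Lemma toCxB x y : toCx (x - y) = toCx x - toCx y. Proof. exact: rmorphB. Qed.
Lemma toCxN x : toCx (- x) = - toCx x. Proof. exact: rmorphN. Qed.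
Lemma toCxM x y : toCx (x * y) = toCx x * toCx y. Proof. exact: rmorphM. Qed.
Lemma toCxX x k : toCx (x ^+ k) = toCx x ^+ k. Proof. exact: rmorphXn. Qed.
Lemma toCxV x : toCx (x^-1) = (toCx x)^-1. Proof. exact: fmorphV. Qed.
Lemma toCx1 : toCx (1 : R) = 1. Proof. exact: rmorph1. Qed.
Lemma toCx0 : toCx (0 : R) = 0. Proof. exact: rmorph0. Qed.

End ScalarRules.
Definition toCxE := (toCxD, toCxB, toCxN, toCxM, toCxX, toCxV, toCx1, toCx0).

(** * Multi-indices *)

Section MultiIndices.
Variable n : nat.
Implicit Types m a b c : midx n.

Definition inc m (l : 'I_n) : midx n := [ffun i => m i + (i == l)]%N.
Definition dec m (l : 'I_n) : midx n := [ffun i => m i - (i == l)]%N.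
Definition madd a b : midx n := [ffun i => a i + b i]%N.
Definition msub a b : midx n := [ffun i => a i - b i]%N.
Definition mle a b : bool := [forall i, (a i <= b i)%N].

(** In the product z_n^(m_n) ... z_1^(m_1) the letters standing to the left of
    z_l are the z_i with i > l; they are the ones that z_l has to cross. *)
Definition above m (l : 'I_n) : nat := (\sum_(i < n | l < i) m i)%N.
Definition mdeg m : nat := (\sum_(i < n) m i)%N.
Definition top_le m (l : 'I_n) : Prop := forall i : 'I_n, (l < i)%N -> m i = 0%N.

Lemma mleP a b : reflect (forall i, (a i <= b i)%N) (mle a b).
Proof. exact: forallP. Qed.

Lemma dec_inc m l : dec (inc m l) l = m.
Proof. by apply/ffunP => i; rewrite !ffunE addnK. Qed.

Lemma inc_dec m l : (0 < m l)%N -> inc (dec m l) l = m.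
Proof.
move=> ml; apply/ffunP => i; rewrite !ffunE.
by have [->|_] := eqVneq i l; rewrite ?subnK // subn0 addn0.
Qed.

Lemma inc_dec_comm m i l : i != l -> inc (dec m i) l = dec (inc m l) i.
Proof.
move=> il; apply/ffunP => k; rewrite !ffunE.
have [->|_] := eqVneq k i; last by rewrite !subn0.
by rewrite (negbTE il) !addn0.
Qed.

Lemma incC m i l : inc (inc m l) i = inc (inc m i) l.
Proof. by apply/ffunP => k; rewrite !ffunE addnAC. Qed.

Lemma madd_incl a b l : madd (inc a l) b = inc (madd a b) l.
Proof. by apply/ffunP => k; rewrite !ffunE addnAC. Qed.

Lemma madd0 a : madd midx0 a = a.
Proof. by apply/ffunP => k; rewrite !ffunE. Qed.

Lemma maddK c a : msub (madd a c) a = c.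
Proof. by apply/ffunP => i; rewrite !ffunE addnC addnK. Qed.

Lemma madd_inj a : injective (madd a).
Proof. by move=> c d e; rewrite -(maddK c a) e maddK. Qed.

Lemma msubK a b : mle a b -> madd a (msub b a) = b.
Proof. by move=> /mleP h; apply/ffunP => i; rewrite !ffunE subnKC. Qed.

Lemma mle_madd a b : mle a (madd a b).
Proof. by apply/mleP => i; rewrite !ffunE leq_addr. Qed.

Lemma maddC a b : madd a b = madd b a.
Proof. by apply/ffunP => i; rewrite !ffunE addnC. Qed.

Lemma sum_inc (P : pred 'I_n) m l :
  (\sum_(i < n | P i) inc m l i = \sum_(i < n | P i) m i + P l)%N.
Proof.
under eq_bigr do rewrite ffunE.
rewrite big_split /=; congr (_ + _)%N.
rewrite -big_mkcondr /= sum1dep_card; case: (boolP (P l)) => hl.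
  rewrite (_ : [set _ | _]%SET = [set l]%SET) ?cards1 //.
  by apply/setP => i; rewrite !inE andbC; case: eqP => // ->.
rewrite (_ : [set _ | _]%SET = finset.set0) ?cards0 //.
by apply/setP => i; rewrite !inE andbC; case: eqP => // ->; rewrite (negbTE hl).
Qed.

Lemma above_inc m l k : (above (inc m l) k = above m k + (k < l))%N.
Proof. exact: sum_inc. Qed.

Lemma mdeg_inc m l : mdeg (inc m l) = (mdeg m).+1.
Proof. by rewrite /mdeg sum_inc addn1. Qed.

Lemma above_top m l : top_le m l -> above m l = 0%N.
Proof. by move=> h; rewrite /above big1. Qed.

Lemma midx_eq0 m : (forall i, m i = 0%N) -> m = midx0.
Proof. by move=> h; apply/ffunP => i; rewrite h ffunE. Qed.

(** The induction that follows the ordered product z_n^(m_n) ... z_1^(m_1): a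
    step adds one more factor z_l on its left end, which is free of powers of q
    because no index beyond l has been used. *)
Lemma midx_ind (P : midx n -> Prop) : P midx0 ->
  (forall m l, top_le m l -> P m -> P (inc m l)) -> forall m, P m.
Proof.
move=> P0 Pb m; have [k] := ubnP (mdeg m); elim: k m => // k IH m mk.
have [/existsP[i0 hi0]|/existsPn h] := boolP [exists i, (0 < m i)%N]; last first.
  by rewrite (midx_eq0 (m := m)) // => i; apply/eqP; move: (h i); rewrite -eqn0Ngt.
(* Remove one occurrence of the largest index in use. *)
case: (@arg_maxnP _ i0 (fun i => 0 < m i)%N (fun i : 'I_n => i : nat) hi0) => l hl lmax.
rewrite -(inc_dec hl); apply: Pb.
  move=> i li; rewrite ffunE; have [] := posnP (m i); first by move=> ->.
  by move=> /lmax /=; rewrite /= leqNgt li.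
apply: IH; move: mk; rewrite -{1}(inc_dec hl) mdeg_inc ltnS; exact: id.
Qed.

End MultiIndices.

(** * Ordered monomials in the function algebra *)

Section FunctionAlgebra.
Variables (R : realType) (n : nat) (q : R).
Notation C := (Cx R).
Notation Fq := (Fq n q).
Notation z := (z q).
Notation zs := (zs q).
Notation f0 := (@f0 R n q).
Notation zmon := (zmon q).
Notation zsmon := (zsmon q).
Notation Q := (toCx q).
Implicit Types (f g h : Fq) (a b m : midx n) (i j l : 'I_n).

Lemma index_enum_ord k : index_enum 'I_k = enum 'I_k.
Proof. by rewrite enumT /index_enum; case: index_enum_key. Qed.

Lemma scale_mull (x : C) f g : (x *: f) * g = x *: (f * g).
Proof. by rewrite pres_scalerAl. Qed.

Lemma scale_mulr (x : C) f g : f * (x *: g) = x *: (f * g).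
Proof. by rewrite pres_scalerAr. Qed.

Lemma Frel_eq (s t : Fterm R n) : Frel q s t -> cls (Frel q) s = cls (Frel q) t.
Proof. by move=> h; apply/clsP; constructor. Qed.

Lemma z_comm i j : (i < j)%N -> z i * z j = Q *: (z j * z i).
Proof. by move=> ij; rewrite -!clsM -clsZ; apply: Frel_eq; by constructor. Qed.

Lemma zs_comm i j : (i < j)%N -> zs j * zs i = Q *: (zs i * zs j).
Proof. by move=> ij; rewrite -!clsM -clsZ; apply: Frel_eq; by constructor. Qed.

Lemma zs_z i j : i != j -> zs i * z j = Q *: (z j * zs i).
Proof. by move=> ij; rewrite -!clsM -clsZ; apply: Frel_eq; by constructor. Qed.

(** The one relation between the letters z and z^* that is not a q-commutation;
    on the vectors z^a f0 it is what produces the factors 1 - q^(2 a_j). *)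
Lemma zs_z_same j : zs j * z j = (Q ^+ 2) *: (z j * zs j) +
   (1 - Q ^+ 2) *: (1 - \sum_(k < n | (j < k)%N) z k * zs k).
Proof.
rewrite -clsM (Frel_eq (FRelzszD q j)) !(clsD, clsZ, clsM) cls1 rmorphXn.
rewrite rmorphB rmorph1 rmorphXn /= scaleN1r; do 4!apply: f_equal.
rewrite index_enum_ord -big_filter; elim: (seq.filter _ _) => [|k s IH]; first by rewrite big_nil.
by rewrite big_cons /= clsD IH clsM.
Qed.

Lemma f0_idem : f0 * f0 = f0.
Proof. by rewrite -clsM; apply: Frel_eq; by constructor. Qed.

Lemma zs_f0 i : zs i * f0 = 0.
Proof. by rewrite -clsM; apply: Frel_eq; by constructor. Qed.

Lemma f0_z i : f0 * z i = 0.
Proof. by rewrite -clsM; apply: Frel_eq; by constructor. Qed.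

(** Two linear maps that obey the same twisted Leibniz rule agree as soon as
    they agree on generators; this principle carries that argument. *)
Lemma Fq_ind (P : Fq -> Prop) :
  (forall c : C, P (c *: (1 : Fq))) ->
  (forall i, P (z i)) -> (forall i, P (zs i)) -> P f0 ->
  (forall f g, P f -> P g -> P (f + g)) ->
  (forall f g, P f -> P g -> P (f * g)) -> forall f, P f.
Proof.
move=> Pc Pz Pzs P0 PD PM; elim/cls_ind; elim=> [[i|i|]|c|s Ps t Pt|s Ps t Pt].
- exact: Pz.
- exact: Pzs.
- exact: P0.
- by rewrite cls_Cst.
- by rewrite clsD; exact: PD.
- by rewrite clsM; exact: PM.
Qed.

Lemma prod_inc_sorted (s : seq 'I_n) m l :
    sorted (fun i j => (j < i)%N) s -> l \in s ->
  z l * \prod_(i <- s) z i ^+ m i =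
  (Q ^+ (\sum_(i <- s | (l < i)%N) m i)) *: \prod_(i <- s) z i ^+ inc m l i.
Proof.
elim: s => // x s IH /= ps; rewrite inE !big_cons.
have xs : all (fun i : 'I_n => (i < x)%N) s.
  by apply: order_path_min ps => u v w /= h1 h2; apply: ltn_trans h2 h1.
have [-> _|lx /= ls] := eqVneq l x.
  have -> : (\sum_(i <- s | (x < i)%N) m i = 0)%N.
    rewrite big1_seq // => i /andP[li /(allP xs) /=].
    by rewrite ltnNge (ltnW li).
  rewrite ltnn expr0 scale1r ffunE eqxx addn1 exprS -mulrA; congr (_ * (_ * _)).
  apply: eq_big_seq => i /(allP xs); rewrite ffunE.
  by case: eqVneq => [->|]; rewrite ?ltnn ?addn0.
have lltx : (l < x)%N by have := allP xs _ ls.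
rewrite lltx ffunE eq_sym (negbTE lx) addn0.
have zlx p : z l * z x ^+ p = (Q ^+ p) *: (z x ^+ p * z l).
  elim: p => [|p IHp]; first by rewrite !expr0 mulr1 mul1r scale1r.
  rewrite exprSr mulrA IHp scale_mull -mulrA z_comm // scale_mulr scalerA.
  by rewrite mulrA exprSr.
rewrite mulrA zlx scale_mull -mulrA IH ?(path_sorted ps) // scale_mulr scalerA.
by rewrite exprD.
Qed.

(** The order in which the letters occur in zmon, as a sequence that can be
    split at its head. *)
Definition dords : seq 'I_n := rev (enum 'I_n).

Lemma zmonE m : zmon m = \prod_(i <- dords) z i ^+ m i.
Proof.
rewrite (_ : zmon m = \prod_(j < n) z (rev_ord j) ^+ m (rev_ord j)) //.
rewrite (_ : dords = map (@rev_ord n) (enum 'I_n)).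
  by rewrite big_map index_enum_ord.
apply: (inj_map val_inj); rewrite -map_comp /dords map_rev val_enum_ord.
case: n => [|k]; first by rewrite (size0nil (size_enum_ord 0)).
apply: (@eq_from_nth _ 0%N); first by rewrite size_rev size_map size_iota size_enum_ord.
move=> i; rewrite size_rev size_iota => ik.
rewrite nth_rev ?size_iota // nth_iota ?ltn_subrL // (nth_map ord0) ?size_enum_ord //=.
by rewrite nth_enum_ord.
Qed.

Lemma dords_sorted : sorted (fun i j : 'I_n => (j < i)%N) dords.
Proof.
rewrite /dords rev_sorted -(@sorted_map _ _ val ltn) val_enum_ord.
exact: iota_ltn_sorted.
Qed.

Lemma dords_mem l : l \in dords.
Proof. by rewrite mem_rev mem_enum. Qed.

Lemma big_dords (P : pred 'I_n) (F : 'I_n -> nat) :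
  (\sum_(i <- dords | P i) F i = \sum_(i < n | P i) F i)%N.
Proof.
rewrite (perm_big (enum 'I_n)) ?big_enum_cond //.
by rewrite /dords perm_rev.
Qed.

(** Moving z_l to its place costs one q for every letter with a larger index.
    *)
Lemma z_zmon l m : z l * zmon m = (Q ^+ above m l) *: zmon (inc m l).
Proof.
by rewrite !zmonE prod_inc_sorted ?dords_sorted ?dords_mem // big_dords.
Qed.

Lemma zmon0 : zmon (midx0 : midx n) = 1.
Proof. by rewrite zmonE big1 // => i _; rewrite ffunE expr0. Qed.

Lemma zmon_inc l m : top_le m l -> zmon (inc m l) = z l * zmon m.
Proof. by move=> h; rewrite z_zmon above_top // scale1r. Qed.

(** * The involution *)

Lemma FstarD f g : Fstar (f + g) = Fstar f + Fstar g.
Proof.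
elim/cls_ind: f => s; elim/cls_ind: g => t.
by rewrite -clsD !FstarE -clsD.
Qed.

Lemma FstarM f g : Fstar (f * g) = Fstar g * Fstar f.
Proof.
elim/cls_ind: f => s; elim/cls_ind: g => t.
by rewrite -clsM !FstarE -clsM.
Qed.

Lemma FstarZ (x : C) f : Fstar (x *: f) = x^* *: Fstar f.
Proof.
elim/cls_ind: f => s; rewrite -clsZ !FstarE -clsZ; apply/clsP.
by rewrite /Fstar_term /=; apply: PresSym; apply: PresCstC.
Qed.

Lemma Fstar1 : Fstar (1 : Fq) = 1.
Proof. by rewrite -cls1 FstarE /Fstar_term /= rmorph1. Qed.

Lemma Fstar0 : Fstar (0 : Fq) = 0.
Proof. by rewrite -(scale0r (1 : Fq)) FstarZ rmorph0 !scale0r. Qed.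

Lemma Fstar_z i : Fstar (z i) = zs i. Proof. exact: FstarE. Qed.
Lemma Fstar_zs i : Fstar (zs i) = z i. Proof. exact: FstarE. Qed.
Lemma Fstar_f0 : Fstar f0 = f0. Proof. exact: FstarE. Qed.

Lemma FstarK : involutive (@Fstar R n q).
Proof.
elim/Fq_ind => [c|i|i||f g hf hg|f g hf hg].
- by rewrite !FstarZ conjCK !Fstar1.
- by rewrite Fstar_z Fstar_zs.
- by rewrite Fstar_zs Fstar_z.
- by rewrite !Fstar_f0.
- by rewrite !FstarD hf hg.
- by rewrite !FstarM hf hg.
Qed.

Lemma Fstar_zmon m : Fstar (zmon m) = zsmon m.
Proof.
rewrite zmonE (_ : zsmon m = \prod_(j < n) zs j ^+ m j) // index_enum_ord /dords.
elim: (enum _) => [|i s IH]; first by rewrite big_nil /= Fstar1 big_nil.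
rewrite rev_cons -cats1 big_cat big_seq1 FstarM IH big_cons; congr (_ * _).
elim: (m i) => [|p IHp]; first by rewrite Fstar1.
by rewrite exprSr FstarM IHp Fstar_z -exprS.
Qed.

Lemma Fstar_zsmon m : Fstar (zsmon m) = zmon m.
Proof. by rewrite -Fstar_zmon FstarK. Qed.

Lemma zsmon0 : zsmon (midx0 : midx n) = 1.
Proof. by rewrite -Fstar_zmon zmon0 Fstar1. Qed.

Lemma zsmon_zs l m : zsmon m * zs l = (Q ^+ above m l) *: zsmon (inc m l).
Proof.
rewrite -!Fstar_zmon -Fstar_z -FstarM z_zmon FstarZ; congr (_ *: _).
by rewrite -rmorphXn toCx_conj.
Qed.

Lemma zsmon_inc l m : top_le m l -> zsmon (inc m l) = zsmon m * zs l.
Proof. by move=> h; rewrite zsmon_zs above_top // scale1r. Qed.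

(** * Annihilation operators on the vectors z^a f0 *)

(** The state z^a f0 is lowered by z_i^*. The proof adds letters on the left: a
    letter z_l with l different from i only q-commutes with z_i^*, and for l =
    i the terms z_k z_k^* with k > l in the relation annihilate the rest, in
    which no index beyond l occurs. *)
Lemma zs_zmon_f0 i a : zs i * zmon a * f0 =
  (Q ^+ above a i * (1 - Q ^+ (2 * a i))) *: (zmon (dec a i) * f0).
Proof.
elim/midx_ind: a i => [|a l al IH] i.
  by rewrite zmon0 mulr1 zs_f0 ffunE muln0 expr0 subrr mulr0 scale0r.
rewrite zmon_inc //; have [il|il|/val_inj il] := ltngtP i l.
- have nil : i != l by rewrite -val_eqE ltn_eqF.
  rewrite mulrA zs_z // !scale_mull -!mulrA [zs i * _]mulrA IH.
  rewrite scale_mulr scalerA [in z l * _]mulrA z_zmon scale_mull scalerA.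
  rewrite above_inc il inc_dec_comm // ffunE (negbTE nil) addn0.
  rewrite (_ : above (dec a i) l = 0%N); last first.
    by apply: above_top => k lk; rewrite ffunE al.
  by rewrite expr0 mulr1 addn1 exprS mulrA.
- have nil : i != l by rewrite -val_eqE gtn_eqF.
  rewrite mulrA zs_z // !scale_mull -!mulrA [zs i * _]mulrA IH.
  rewrite al // ffunE al // (negbTE nil) muln0 expr0 subrr !mulr0 scale0r.
  by rewrite mulr0 scaler0 scale0r.
rewrite {i}il mulrA zs_z_same.
rewrite !mulrDl !scale_mull mulrBl mul1r mulrBl.
rewrite !mulr_suml big1 ?subr0; last first.
  by move=> k lk; rewrite -!mulrA [zs k * _]mulrA IH al // muln0 expr0 subrr mulr0 scale0r mulr0.
rewrite -!mulrA [zs l * _]mulrA IH dec_inc above_inc ltnn addn0 above_top //.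
rewrite !expr0 !mul1r ffunE eqxx addn1.
have [al0|al0] := posnP (a l).
  by rewrite al0 muln0 expr0 subrr scale0r mulr0 scaler0 add0r.
rewrite scale_mulr mulrA z_zmon inc_dec // (_ : above (dec a l) l = 0%N); last first.
  by apply: above_top => k lk; rewrite ffunE al.
rewrite scale1r scalerA -scalerDl; congr (_ *: _).
by rewrite mulnS exprD; ring.
Qed.

End FunctionAlgebra.

(** * Finitely supported sums, spans and coordinates *)

Section FiniteSums.
Variables (I : choiceType).

Definition fin_supp (V : nmodType) (F : I -> V) : Prop :=
  exists s : seq I, forall i, i \notin s -> F i = 0.

Lemma fsum_seq (V : nmodType) (F : I -> V) (s : seq I) : uniq s ->
  (forall i, i \notin s -> F i = 0) ->
  \sum_(i \in [set: I]) F i = \sum_(i <- s) F i.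
Proof.
move=> us h; rewrite -(fsbig_widen [set` s]) //; first by rewrite -fsbig_seq.
by move=> i /= [_ /negP]; exact: h.
Qed.

Lemma fin_supp_seq (V : nmodType) (F : I -> V) : fin_supp F ->
  exists2 s, uniq s & forall i, i \notin s -> F i = 0.
Proof. by case=> s h; exists (undup s) => [|i]; rewrite ?undup_uniq // mem_undup; exact: h. Qed.

Lemma fin_supp2 (V W : nmodType) (F : I -> V) (G : I -> W) :
  fin_supp F -> fin_supp G ->
  exists2 s, uniq s & forall i, i \notin s -> F i = 0 /\ G i = 0.
Proof.
case=> s hs [t ht]; exists (undup (s ++ t)) => [|i]; first exact: undup_uniq.
by rewrite mem_undup mem_cat => /norP[/hs ? /ht].
Qed.

Lemma fsum_lin (K : pzRingType) (V : lmodType K) (x : K) (F G : I -> V) :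
  fin_supp F -> fin_supp G ->
  \sum_(i \in [set: I]) (x *: F i + G i) =
  x *: (\sum_(i \in [set: I]) F i) + \sum_(i \in [set: I]) G i.
Proof.
move=> hF hG; have [s us hs] := fin_supp2 hF hG.
rewrite !(fsum_seq us) => [|i /hs[]|i /hs[]|i /hs[-> ->]] //.
  by rewrite big_split -scaler_sumr.
by rewrite scaler0 addr0.
Qed.

Lemma fsum_single (V : nmodType) (F : I -> V) i0 :
  (forall i, i != i0 -> F i = 0) -> \sum_(i \in [set: I]) F i = F i0.
Proof.
move=> h; rewrite (@fsum_seq _ _ [:: i0]) ?big_seq1 // => i.
by rewrite inE; exact: h.
Qed.

Lemma fin_suppP (V : nmodType) (F : I -> V) :
  finite_set [set i | F i != 0] <-> fin_supp F.
Proof.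
split=> [/finite_seqP[s hs]|[s hs]].
  exists s => i /negP his; apply/eqP/negPn/negP => h; apply: his.
  by have : [set i | F i != 0] i by []; rewrite hs.
apply: (sub_finite_set (B := [set` s])) => // i /=.
by move=> h; apply/negPn/negP => /hs e; rewrite e eqxx in h.
Qed.

Lemma fin_supp_lin (K : pzRingType) (V : lmodType K) (x : K) (F G : I -> V) :
  fin_supp F -> fin_supp G -> fin_supp (fun i => x *: F i + G i).
Proof.
move=> hF hG; have [s _ hs] := fin_supp2 hF hG.
by exists s => i /hs [-> ->]; rewrite scaler0 addr0.
Qed.

Lemma fin_supp_scaler (K : pzRingType) (V : lmodType K) (F : I -> K) (v : I -> V) :
  fin_supp F -> fin_supp (fun i => F i *: v i).
Proof. by case=> s hs; exists s => i /hs ->; rewrite scale0r. Qed.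

Lemma fin_supp1 (V : nmodType) (F : I -> V) i0 :
  (forall i, i != i0 -> F i = 0) -> fin_supp F.
Proof. by move=> h; exists [:: i0] => i; rewrite inE => /h. Qed.

End FiniteSums.

Section LinearMaps.
Variables (K : pzRingType) (V W : lmodType K) (A : V -> W).
Hypothesis lA : linear A.

Lemma lin0 : A 0 = 0.
Proof. by have := lA (-1) 0 0; rewrite !scaleN1r oppr0 addr0 addNr. Qed.

Lemma linZ x v : A (x *: v) = x *: A v.
Proof. by rewrite -[x *: v]addr0 lA lin0 addr0. Qed.

Lemma linN v : A (- v) = - A v.
Proof. by rewrite -!scaleN1r linZ. Qed.

Lemma lin_sum (J : Type) (u : seq J) (v : J -> V) :
  A (\sum_(i <- u) v i) = \sum_(i <- u) A (v i).
Proof.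
elim: u => [|i u IH]; first by rewrite !big_nil lin0.
by rewrite !big_cons -[v i]scale1r lA IH !scale1r.
Qed.

End LinearMaps.

Section Span.
Variables (K : pzRingType) (V : lmodType K) (I : Type).

(** Stated through its induction principle, so that a property that is stable
    under linear combinations and holds on the family may be proved by applying
    the hypothesis. *)
Definition span (e : I -> V) (v : V) : Prop :=
  forall P : V -> Prop, P 0 ->
    (forall (c : K) u w, P u -> P w -> P (c *: u + w)) ->
    (forall i, P (e i)) -> P v.

Lemma span0 (e : I -> V) : span e 0. Proof. by move=> P. Qed.

Lemma span_lin (e : I -> V) c u w : span e u -> span e w -> span e (c *: u + w).
Proof.
move=> hu hw P P0 Pl Pe; by apply: (Pl); [exact: hu | exact: hw].
Qed.

Lemma span_gen (e : I -> V) i : span e (e i). Proof. by move=> P. Qed.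

Lemma spanZ (e : I -> V) c u : span e u -> span e (c *: u).
Proof. by move=> h; rewrite -[_ *: _]addr0; apply: span_lin h (@span0 e). Qed.

Lemma spanD (e : I -> V) u w : span e u -> span e w -> span e (u + w).
Proof. by move=> hu hw; rewrite -[u]scale1r; exact: span_lin. Qed.

End Span.

Lemma span_map (K : pzRingType) (V W : lmodType K) (I J : Type)
    (e : I -> V) (e' : J -> W) (phi : V -> W) v :
  linear phi -> (forall i, span e' (phi (e i))) -> span e v -> span e' (phi v).
Proof.
move=> pl pe he; apply: (he (fun v => span e' (phi v))) => [|c u w hu hw|//].
  by rewrite (lin0 pl); exact: span0.
by rewrite pl; exact: span_lin.
Qed.

Section Bases.
Variables (K : fieldType) (V : lmodType K) (I : choiceType) (e : I -> V).
Hypothesis eb : is_basis e.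

Lemma fin_comb_uniq c d v : fin_comb e c v -> fin_comb e d v -> c = d.
Proof. by move=> hc hd; have [b [_ bu]] := eb v; rewrite -(bu _ hc) -(bu _ hd). Qed.

Lemma coordsP v : fin_comb e (coords e v) v.
Proof.
by rewrite /coords; case: xgetP => [c _ //|h]; have [c [hc _]] := eb v; case: (h c).
Qed.

Lemma coordsE c v : fin_comb e c v -> coords e v = c.
Proof. exact/fin_comb_uniq/coordsP. Qed.

Lemma coords_fin v : fin_supp (coords e v).
Proof. by have [/fin_suppP] := coordsP v. Qed.

Lemma coords_sum v : v = \sum_(i \in [set: I]) coords e v i *: e i.
Proof. by have [] := coordsP v. Qed.

Lemma coords_lin c u v i :
  coords e (c *: u + v) i = c * coords e u i + coords e v i.
Proof.
rewrite (@coordsE (fun i => c * coords e u i + coords e v i)) //; split.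
  by apply/fin_suppP/(@fin_supp_lin _ _ K^o); exact: coords_fin.
rewrite {1}[u]coords_sum {1}[v]coords_sum -fsum_lin.
- by apply: eq_fsbigr => j _; rewrite scalerDl scalerA.
- exact/fin_supp_scaler/coords_fin.
- exact/fin_supp_scaler/coords_fin.
Qed.

Lemma coords_gen i j : coords e (e i) j = (j == i)%:R.
Proof.
rewrite (@coordsE (fun j => (j == i)%:R)) //; split.
  by apply/fin_suppP; apply: (@fin_supp1 _ _ _ i) => k /negbTE ->.
rewrite (@fsum_single _ _ _ i) ?eqxx ?scale1r // => k /negbTE ->.
by rewrite scale0r.
Qed.

Lemma coords0 i : coords e 0 i = 0.
Proof.
have := coords_lin (-1) 0 0 i.
by rewrite scaleN1r oppr0 addr0 mulN1r addNr.
Qed.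

Lemma coordsZ c u i : coords e (c *: u) i = c * coords e u i.
Proof. by rewrite -[_ *: _]addr0 coords_lin coords0 addr0. Qed.

Lemma coords_inj u v : (forall i, coords e u i = coords e v i) -> u = v.
Proof.
move=> h; rewrite [u]coords_sum [v]coords_sum.
by apply: eq_fsbigr => i _; rewrite h.
Qed.

Lemma coords_sum_seq v : exists2 s, uniq s & v = \sum_(i <- s) coords e v i *: e i.
Proof.
have [s us hs] := fin_supp_seq (coords_fin v); exists s => //.
rewrite {1}[v]coords_sum (fsum_seq us) // => i /hs ->; exact: scale0r.
Qed.

Lemma basis_span v : span e v.
Proof.
have [s _ ->] := coords_sum_seq v.
elim: s => [|i s IH]; first by rewrite big_nil; exact: span0.
by rewrite big_cons; apply: span_lin IH; exact: span_gen.
Qed.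

End Bases.

Lemma basis_ext (K : fieldType) (V W : lmodType K) (I : choiceType) (e : I -> V)
    (phi psi : V -> W) : is_basis e -> linear phi -> linear psi ->
  (forall i, phi (e i) = psi (e i)) -> forall v, phi v = psi v.
Proof.
move=> eb lphi lpsi h v; apply: (basis_span eb v (P := fun v => phi v = psi v)) => [|c u w hu hw|//].
  by rewrite (lin0 lphi) (lin0 lpsi).
by rewrite lphi lpsi hu hw.
Qed.

(** * Matrix units of the finite functions *)

Section Qpoch.
Variable R : realType.
Lemma qpochS (a b : R) m : qpoch a b m.+1 = qpoch a b m * (1 - a * b ^+ m).
Proof. by rewrite /qpoch big_ord_recr. Qed.
Lemma qpoch0 (a b : R) : qpoch a b 0 = 1.
Proof. by rewrite /qpoch big_ord0. Qed.
Lemma qpoch_gt0 (a b : R) m : 0 <= a < 1 -> 0 <= b <= 1 -> 0 < qpoch a b m.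
Proof.
move=> /andP[a0 a1] /andP[b0 b1]; apply: prodr_gt0 => j _.
rewrite subr_gt0; apply: le_lt_trans a1.
by rewrite ler_piMr // exprn_ile1.
Qed.

End Qpoch.

Section Spanning.
Variables (R : realType) (n : nat) (q : R).
Hypotheses (hq0 : 0 < q) (hq1 : q < 1).
Notation Fq := (Fq n q).
Notation z := (z q).
Notation zs := (zs q).
Notation f0 := (@f0 R n q).
Notation zmon := (zmon q).
Notation zsmon := (zsmon q).
Notation Q := (toCx q).
Notation finite_fun := (@finite_fun R n q).
Implicit Types (f g h : Fq) (a b c m : midx n) (i j l : 'I_n).

(** The scalar by which z^*a z^a acts on f0, that is the square norm of the
    basis vector z^a e_0 of the Fock space. *)
Definition normN a : R := \prod_(j < n) qpoch (q ^+ 2) (q ^+ 2) (a j).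

(** The exponent of q paid for sorting z^m z^c into z^(m+c). *)
Definition cross m c : nat := (\sum_(j < n) m j * above c j)%N.

(** Up to the scalars normN these are the matrix units of the algebra of
    operators with finitely many matrix entries. *)
Definition munit a b : Fq := zmon a * f0 * zsmon b.

Lemma munitE a b : munit a b = zmon a * f0 * zsmon b. Proof. by []. Qed.

Lemma q2_itv : 0 <= q ^+ 2 < 1.
Proof. by rewrite exprn_ge0 1?ltW //= exprn_ilt1 // ltW. Qed.

Lemma Q_neq0 : Q != 0.
Proof. by rewrite toCx_eq0 gt_eqF. Qed.

Lemma Qexp_neq0 k : Q ^+ k != 0.
Proof. by rewrite expf_neq0 // Q_neq0. Qed.

Lemma normN_gt0 a : 0 < normN a.
Proof.
apply: prodr_gt0 => j _; apply: qpoch_gt0; first exact: q2_itv.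
by have /andP[-> /ltW] := q2_itv.
Qed.

Lemma normNC_neq0 a : toCx (normN a) != 0.
Proof. by rewrite toCx_eq0 gt_eqF // normN_gt0. Qed.

Lemma normN0 : normN midx0 = 1.
Proof. by rewrite /normN big1 // => j _; rewrite ffunE qpoch0. Qed.

Lemma normN_inc a l : normN (inc a l) = normN a * (1 - q ^+ (2 * (a l).+1)).
Proof.
rewrite /normN (bigD1 l) // [in RHS](bigD1 l) //= ffunE eqxx addn1 qpochS.
rewrite -exprS -exprM -!mulrA; congr (_ * _); rewrite mulrC; congr (_ * _).
by apply: eq_bigr => i /negbTE il; rewrite ffunE il addn0.
Qed.

Lemma cross_inc m l c : cross (inc m l) c = (cross m c + above c l)%N.
Proof.
rewrite /cross (bigD1 l) // [in RHS](bigD1 l) //= ffunE eqxx addn1 mulSn.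
rewrite -addnA addnC; congr (_ + _ + _)%N; apply: eq_bigr => i /negbTE il.
by rewrite ffunE il addn0.
Qed.

Lemma cross0 c : cross midx0 c = 0%N.
Proof. by rewrite /cross big1 // => i _; rewrite ffunE. Qed.

Lemma zmon_madd m c : zmon m * zmon c = (Q ^+ cross m c) *: zmon (madd m c).
Proof.
elim/midx_ind: m => [|m l ml IH].
  by rewrite zmon0 mul1r madd0 cross0 expr0 scale1r.
rewrite zmon_inc // -mulrA IH scale_mulr z_zmon scalerA -exprD cross_inc.
rewrite madd_incl; congr ((Q ^+ _) *: _); congr (_ + _)%N.
by apply: eq_bigr => i li; rewrite ffunE ml.
Qed.

Lemma zsmon_zmon_f0 m c : zsmon m * zmon (madd m c) * f0 =
  (Q ^+ cross m c * toCx (normN (madd m c) / normN c)) *: (zmon c * f0).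
Proof.
elim/midx_ind: m => [|m l ml IH].
  by rewrite zsmon0 mul1r madd0 cross0 divff ?gt_eqF ?normN_gt0 // rmorph1 mulr1 scale1r.
rewrite zsmon_inc // -!mulrA [zs l * _]mulrA zs_zmon_f0 scale_mulr madd_incl.
rewrite dec_inc mulrA IH scalerA cross_inc above_inc ltnn addn0 normN_inc; congr (_ *: _).
have -> : above (madd m c) l = above c l.
  by apply: eq_bigr => i li; rewrite ffunE ml.
rewrite !ffunE eqxx addn1 exprD !rmorphM rmorphB rmorph1 rmorphXn /=.
ring.
Qed.

Lemma mle_inc m l a : mle (inc m l) a = (0 < a l)%N && mle m (dec a l).
Proof.
apply/mleP/andP => [h|[al /mleP h] i].
  split; first by have := h l; rewrite ffunE eqxx addn1; apply: leq_ltn_trans.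
  apply/mleP => i; have := h i; rewrite !ffunE.
  by case: (i == l); rewrite ?addn1 ?subn1 ?addn0 ?subn0 //; case: (a i).
have := h i; rewrite !ffunE; case: eqVneq => [->|_]; last by rewrite subn0 addn0.
by rewrite subn1 addn1; move: al; case: (a l).
Qed.

Lemma zsmon_zmon_f0_eq0 m a : ~~ mle m a -> zsmon m * zmon a * f0 = 0.
Proof.
elim/midx_ind: m a => [|m l ml IH] a.
  by move/negP; case; apply/mleP => i; rewrite ffunE.
rewrite mle_inc zsmon_inc // -!mulrA [zs l * _]mulrA zs_zmon_f0 scale_mulr mulrA.
have [-> _|_ /= /IH ->] := posnP (a l); last by rewrite scaler0.
by rewrite muln0 expr0 subrr mulr0 scale0r.
Qed.

Lemma f0_zmon_f0 a : f0 * zmon a * f0 = (a == midx0)%:R *: f0.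
Proof.
elim/midx_ind: a => [|a l al _]; first by rewrite zmon0 mulr1 f0_idem eqxx scale1r.
rewrite zmon_inc // mulrA f0_z !mul0r; case: eqP => [/ffunP/(_ l)|]; rewrite ?scale0r //.
by rewrite !ffunE eqxx addn1.
Qed.

(** f0 is the projection onto the vacuum line, and z^*b z^a f0 has a component
    there for a = b only. *)
Lemma f0_zsz_f0 a b : f0 * (zsmon b * (zmon a * f0)) =
  (if a == b then toCx (normN b) else 0) *: f0.
Proof.
rewrite [zsmon b * _]mulrA; have [ba|nba] := boolP (mle b a); last first.
  rewrite zsmon_zmon_f0_eq0 // mulr0; case: eqP => [e|]; last by rewrite scale0r.
  by move/negP: nba; case; apply/mleP => i; rewrite e.
rewrite -{1}(msubK ba) zsmon_zmon_f0 scale_mulr mulrA f0_zmon_f0 scalerA.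
congr (_ *: _); case: (eqVneq a b) => [->|ab].
  have -> : msub b b = midx0 by apply/ffunP => i; rewrite !ffunE subnn.
  rewrite eqxx mulr1 normN0 divr1 maddC madd0 (_ : cross b midx0 = 0%N) ?expr0 ?mul1r //.
  by rewrite /cross big1 // => j _; rewrite /above big1 ?muln0 // => i _; rewrite ffunE.
case: eqP => [e|]; last by rewrite mulr0.
by case/eqP: ab; rewrite -(msubK ba) e maddC madd0.
Qed.

Lemma munitM a b a' b' :
  munit a b * munit a' b' = (if a' == b then toCx (normN b) else 0) *: munit a b'.
Proof.
have -> : munit a b * munit a' b' =
    zmon a * (f0 * (zsmon b * (zmon a' * f0))) * zsmon b' by rewrite /munit !mulrA.
by rewrite f0_zsz_f0 scale_mulr scale_mull.
Qed.

Lemma finite_fun0 : finite_fun 0.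
Proof. by exists [::]; rewrite big_nil. Qed.

Lemma finite_funD f g : finite_fun f -> finite_fun g -> finite_fun (f + g).
Proof. by move=> [s ->] [t ->]; exists (s ++ t); rewrite big_cat. Qed.

Lemma finite_funMl g f : finite_fun f -> finite_fun (g * f).
Proof.
move=> [s ->]; exists [seq (g * p.1, p.2) | p <- s].
by rewrite big_map mulr_sumr; apply: eq_bigr => p _; rewrite !mulrA.
Qed.

Lemma finite_funMr g f : finite_fun f -> finite_fun (f * g).
Proof.
move=> [s ->]; exists [seq (p.1, p.2 * g) | p <- s].
by rewrite big_map mulr_suml; apply: eq_bigr => p _; rewrite !mulrA.
Qed.

Lemma finite_funZ x f : finite_fun f -> finite_fun (x *: f).
Proof. by move=> hf; rewrite -[f]mul1r -scale_mull; exact: finite_funMl. Qed.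

Lemma finite_fun_lin x f g : finite_fun f -> finite_fun g -> finite_fun (x *: f + g).
Proof. by move=> hf hg; apply: finite_funD => //; exact: finite_funZ. Qed.

Lemma finite_f0 : finite_fun f0.
Proof. by exists [:: (1, 1)]; rewrite big_seq1 mul1r mulr1. Qed.

Lemma finite_munit a b : finite_fun (munit a b).
Proof. by apply: finite_funMr; apply: finite_funMl; exact: finite_f0. Qed.

Definition ket a : Fq := zmon a * f0.
Definition bra a : Fq := f0 * zsmon a.

Lemma mull_linear f : linear (fun g => f * g).
Proof. by move=> x g h; rewrite mulrDr scale_mulr. Qed.

Lemma mulr_linear f : linear (fun g : Fq => g * f).
Proof. by move=> x g h; rewrite mulrDl scale_mull. Qed.

Lemma f0_span : span ket f0.
Proof. by have := @span_gen _ _ _ ket midx0; rewrite {2}/ket zmon0 mul1r. Qed.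

(** The span of the z^a f0 is stable under left multiplication by every
    generator, hence a left ideal. *)
Lemma ket_span f : span ket (f * f0).
Proof.
have := f0_span; move: (f0) => k; elim/Fq_ind: f k => [x|i|i||f g hf hg|f g hf hg] k hk.
- by rewrite scale_mull mul1r; exact: spanZ.
- apply: (span_map (mull_linear (z i))) hk => a; rewrite /ket mulrA z_zmon scale_mull.
  by apply: spanZ; exact: span_gen.
- apply: (span_map (mull_linear (zs i))) hk => a; rewrite /ket mulrA zs_zmon_f0.
  by apply: spanZ; exact: span_gen.
- apply: (span_map (mull_linear f0)) hk => a; rewrite /ket mulrA f0_zmon_f0.
  apply: spanZ; exact: f0_span.
- by rewrite mulrDl; apply: spanD; [exact: hf|exact: hg].
- by rewrite -mulrA; apply: hf; exact: hg.
Qed.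

Lemma bra_span f : span bra (f0 * f).
Proof.
have -> : f0 * f = Fstar (Fstar f * f0) by rewrite FstarM FstarK Fstar_f0.
apply: (ket_span (Fstar f) (P := fun g => span bra (Fstar g))) => [|x g h hg hh|a].
- by rewrite Fstar0; exact: span0.
- by rewrite FstarD FstarZ; exact: span_lin.
- by rewrite FstarM Fstar_f0 Fstar_zmon; exact: span_gen.
Qed.

(** Since f0 = f0 f0, an element g f0 g' is a product of a vector in the span
    of the z^a f0 and of one in the span of the f0 z^*b. *)
Lemma finite_span f : finite_fun f -> span (fun ab => munit ab.1 ab.2) f.
Proof.
move=> [s ->]; elim: s => [|p s IH]; first by rewrite big_nil; exact: span0.
rewrite big_cons; apply: spanD IH.
rewrite -f0_idem mulrA -mulrA.
apply: (span_map (mulr_linear (f0 * p.2))) (ket_span p.1) => a.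
apply: (span_map (mull_linear (ket a))) (bra_span p.2) => b.
rewrite /ket /bra mulrA -[_ * f0 * f0]mulrA f0_idem.
exact: (@span_gen _ _ _ (fun ab => munit ab.1 ab.2) (a, b)).
Qed.

Lemma finite_ind (P : Fq -> Prop) : P 0 ->
  (forall x f g, finite_fun f -> finite_fun g -> P f -> P g -> P (x *: f + g)) ->
  (forall a b, P (munit a b)) -> forall f, finite_fun f -> P f.
Proof.
move=> P0 Pl Pu f /finite_span hf.
suff [] : P f /\ finite_fun f by [].
apply: (hf (fun f => P f /\ finite_fun f)) => [|x g h [? ?] [? ?]|[a b] /=].
- by split=> //; exact: finite_fun0.
- by split; [exact: Pl | exact: finite_fun_lin].
- by split=> //; exact: finite_munit.
Qed.

End Spanning.

(** * Modules over the quantum group *)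

Section UqModule.
Variables (R : realType) (n : nat) (q : R) (V : lmodType (Cx R)).
Variables (a : Uq n q -> V -> V) (am : is_Uq_module a).
Notation Q := (toCx q).
Notation Ucls := (cls (Urel q)).
Notation mE k := (a (Ucls (tE k))).
Notation mF k := (a (Ucls (tF k))).
Notation mK k := (a (Ucls (tK k))).
Notation mKi k := (a (Ucls (tKinv k))).
Implicit Types (s t : Uterm R n) (v w : V) (k : 'I_n).

Lemma Umod_linear xi : linear (a xi).
Proof. by case: am. Qed.

Lemma Umod_mul s t v : a (Ucls (s * t)%T) v = a (Ucls s) (a (Ucls t) v).
Proof. by rewrite clsM; case: am. Qed.

Lemma Umod_add s t v : a (Ucls (s + t)%T) v = a (Ucls s) v + a (Ucls t) v.
Proof.
rewrite clsD; case: am => _ h _ _.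
by rewrite -[Ucls s]scale1r h !scale1r.
Qed.

Lemma Umod_cst x v : a (Ucls (Cst x)) v = x *: v.
Proof.
case: am => _ h h1 _; rewrite cls_Cst.
have e0 : a 0 v = 0 by have := h (-1) 0 0 v; rewrite scaler0 addr0 scaleN1r addNr.
by have := h x 1 0 v; rewrite addr0 e0 addr0 h1.
Qed.

Lemma Umod_scale x t v : a (Ucls (x *: t)%T) v = x *: a (Ucls t) v.
Proof. by rewrite Umod_mul Umod_cst. Qed.

Lemma Umod_rel s t v : Urel q s t -> a (Ucls s) v = a (Ucls t) v.
Proof. by move=> h; congr (a _ v); apply/clsP; constructor. Qed.

Lemma Umod0 xi : a xi 0 = 0.
Proof. by have := Umod_linear xi (-1) 0 0; rewrite scaler0 addr0 scaleN1r addNr. Qed.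

Lemma UmodD xi v w : a xi (v + w) = a xi v + a xi w.
Proof. by rewrite -[v]scale1r Umod_linear !scale1r. Qed.

Lemma UmodZ xi x v : a xi (x *: v) = x *: a xi v.
Proof. by rewrite -[x *: v]addr0 Umod_linear Umod0 addr0. Qed.

Lemma UmodN xi v : a xi (- v) = - a xi v.
Proof. by rewrite -scaleN1r UmodZ scaleN1r. Qed.

Lemma Umod_KKi k v : mK k (mKi k v) = v.
Proof. by rewrite -Umod_mul (Umod_rel v (URelKKinv q k)) Umod_cst scale1r. Qed.

Lemma Umod_KiK k v : mKi k (mK k v) = v.
Proof. by rewrite -Umod_mul (Umod_rel v (URelKinvK q k)) Umod_cst scale1r. Qed.

Lemma Umod_KE k v : mK k (mE k v) = (Q ^+ 2) *: mE k (mK k v).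
Proof.
rewrite -!Umod_mul (Umod_rel v (URelKE q k k)) Umod_scale.
by rewrite /cartan eqxx -exprnP toCxX.
Qed.

Lemma Umod_KF k v : mK k (mF k v) = (Q ^- 2) *: mF k (mK k v).
Proof.
rewrite -!Umod_mul (Umod_rel v (URelKF q k k)) Umod_scale.
by rewrite /cartan eqxx -exprnN toCxV toCxX.
Qed.

End UqModule.

(** * The action on monomials and on finite functions *)

Section Action.
Variables (R : realType) (n : nat) (q : R).
Hypotheses (hq0 : 0 < q) (hq1 : q < 1).
Variable act : module_algebra n q.
Notation C := (Cx R).
Notation Fq := (Fq n q).
Notation z := (z q).
Notation zs := (zs q).
Notation f0 := (@f0 R n q).
Notation zmon := (zmon q).
Notation zsmon := (zsmon q).
Notation Q := (toCx q).
Notation S := (toCx (Num.sqrt q)).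
Notation Ucls := (cls (Urel q)).
Implicit Types (f g h : Fq) (a b c m : midx n) (i j k l : 'I_n) (t : Uterm R n).

Notation aE k := (act (Ucls (tE k))).
Notation aF k := (act (Ucls (tF k))).
Notation aK k := (act (Ucls (tK k))).
Notation aKi k := (act (Ucls (tKinv k))).

Lemma act_linear xi : linear (act xi).
Proof. exact: Umod_linear (act_module act) xi. Qed.

Lemma actM s t f : act (Ucls (s * t)%T) f = act (Ucls s) (act (Ucls t) f).
Proof. exact: Umod_mul (act_module act) s t f. Qed.

Lemma actD s t f : act (Ucls (s + t)%T) f = act (Ucls s) f + act (Ucls t) f.
Proof. exact: Umod_add (act_module act) s t f. Qed.

Lemma act_cst x f : act (Ucls (Cst x)) f = x *: f.
Proof. exact: Umod_cst (act_module act) x f. Qed.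

Lemma act0 xi : act xi 0 = 0.
Proof. exact: Umod0 (act_module act) xi. Qed.

Lemma act_add xi f g : act xi (f + g) = act xi f + act xi g.
Proof. exact: UmodD (act_module act) xi f g. Qed.

Lemma act_scale xi x f : act xi (x *: f) = x *: act xi f.
Proof. exact: UmodZ (act_module act) xi x f. Qed.

Lemma act_opp xi f : act xi (- f) = - act xi f.
Proof. exact: UmodN (act_module act) xi f. Qed.

Lemma act_KKi k f : aK k (aKi k f) = f.
Proof. exact: Umod_KKi (act_module act) k f. Qed.

Lemma act_KiK k f : aKi k (aK k f) = f.
Proof. exact: Umod_KiK (act_module act) k f. Qed.

Lemma act_KE k f : aK k (aE k f) = (Q ^+ 2) *: aE k (aK k f).
Proof. exact: Umod_KE (act_module act) k f. Qed.

Lemma act_KF k f : aK k (aF k f) = (Q ^- 2) *: aF k (aK k f).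
Proof. exact: Umod_KF (act_module act) k f. Qed.

Lemma act_EM k f g : aE k (f * g) = aE k f * g + aK k f * aE k g.
Proof. by rewrite act_mul /= big_cons big_seq1 /= act_cst scale1r. Qed.

Lemma act_FM k f g : aF k (f * g) = aF k f * aKi k g + f * aF k g.
Proof. by rewrite act_mul /= big_cons big_seq1 /= act_cst scale1r. Qed.

Lemma act_KM k f g : aK k (f * g) = aK k f * aK k g.
Proof. by rewrite act_mul /= big_seq1. Qed.

Lemma act_KiM k f g : aKi k (f * g) = aKi k f * aKi k g.
Proof. by rewrite act_mul /= big_seq1. Qed.

Lemma act_E1 k : aE k 1 = 0. Proof. by rewrite act_one /= scale0r. Qed.
Lemma act_F1 k : aF k 1 = 0. Proof. by rewrite act_one /= scale0r. Qed.
Lemma act_K1 k : aK k 1 = 1. Proof. by rewrite act_one /= scale1r. Qed.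
Lemma act_Ki1 k : aKi k 1 = 1. Proof. by rewrite act_one /= scale1r. Qed.

Lemma act_Ki_f0 k : aKi k f0 = f0.
Proof. by rewrite -{1}(act_K_f0 act k) act_KiK. Qed.

(** The eigenvalue of K_k on z_i. *)
Definition zweight k i : C :=
  if is_last k then (if i == k then Q ^+ 2 else Q)
  else (if i == k then Q else if i == k.+1 :> nat then Q^-1 else 1).

(** The eigenvalue of K_k on z^m. *)
Definition weight k m : C := \prod_(i < n) zweight k i ^+ m i.

Lemma weightE k m : weight k m = \prod_(i < n) zweight k i ^+ m i. Proof. by []. Qed.

Lemma zweight_neq0 k i : zweight k i != 0.
Proof.
rewrite /zweight; have Q0 : Q != 0 by exact: Q_neq0.
by do 3?case: ifP => _ //; rewrite ?expf_neq0 ?invr_neq0 ?oner_neq0.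
Qed.

Lemma weight_neq0 k m : weight k m != 0.
Proof. by apply/prodf_neq0 => i _; rewrite expf_neq0 // zweight_neq0. Qed.

Lemma weight_inc k m l : weight k (inc m l) = weight k m * zweight k l.
Proof.
rewrite /weight (bigD1 l) // [in RHS](bigD1 l) //= ffunE eqxx addn1 exprSr.
rewrite -!mulrA; congr (_ * _); rewrite mulrC; congr (_ * _).
by apply: eq_bigr => i /negbTE il; rewrite ffunE il addn0.
Qed.

Lemma weight0 k : weight k midx0 = 1.
Proof. by rewrite /weight big1 // => i _; rewrite ffunE expr0. Qed.

Lemma zweight_conj k i : (zweight k i)^* = zweight k i.
Proof.
by rewrite /zweight; do 3?case: ifP => _; rewrite ?rmorph1 -?toCxV -?toCxX ?toCx_conj.
Qed.

Lemma weight_conj k m : (weight k m)^* = weight k m.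
Proof.
by rewrite /weight rmorph_prod; apply: eq_bigr => i _; rewrite rmorphXn /= zweight_conj.
Qed.

Lemma act_K_z k i : aK k (z i) = zweight k i *: z i.
Proof.
rewrite /zweight; case: ifPn => kl.
  case: eqVneq => [->|ik]; first by rewrite act_Kn_same // toCxX.
  exact: act_Kn_other.
case: eqVneq => [->|ik]; first exact: act_K_same.
case: eqVneq => [e|ik']; first by rewrite -toCxV; exact: act_K_next.
by rewrite scale1r; exact: act_K_other.
Qed.

Lemma act_Ki_z k i : aKi k (z i) = (zweight k i)^-1 *: z i.
Proof.
rewrite -{2}(act_KiK k (z i)) act_K_z act_scale scalerA mulVf ?scale1r //.
exact: zweight_neq0.
Qed.

Lemma act_K_zmon k m : aK k (zmon m) = weight k m *: zmon m.
Proof.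
elim/midx_ind: m => [|m l ml IH]; first by rewrite zmon0 weight0 scale1r act_K1.
rewrite zmon_inc // act_KM IH act_K_z scale_mull scale_mulr scalerA weight_inc.
by rewrite mulrC.
Qed.

Lemma Ki_of_K k (x : C) f : x != 0 -> aK k f = x *: f -> aKi k f = x^-1 *: f.
Proof.
move=> x0 h; rewrite -{2}(act_KiK k f) h act_scale scalerA mulVf ?scale1r //.
Qed.

Lemma act_Ki_zmon k m : aKi k (zmon m) = (weight k m)^-1 *: zmon m.
Proof. apply: Ki_of_K; [exact: weight_neq0 | exact: act_K_zmon]. Qed.

Lemma star_K k f : Fstar (aK k f) = aKi k (Fstar f).
Proof. exact: act_star. Qed.

Lemma star_Ki k f : Fstar (aKi k f) = aK k (Fstar f).
Proof. exact: act_star. Qed.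

Lemma act_Ki_zsmon k m : aKi k (zsmon m) = weight k m *: zsmon m.
Proof. by rewrite -Fstar_zmon -star_K act_K_zmon FstarZ weight_conj. Qed.

Lemma act_K_zsmon k m : aK k (zsmon m) = (weight k m)^-1 *: zsmon m.
Proof.
by rewrite -{2}(act_KKi k (zsmon m)) act_Ki_zsmon act_scale scalerA mulVf ?scale1r ?weight_neq0.
Qed.

Lemma act_Ki_zs k i : aKi k (zs i) = zweight k i *: zs i.
Proof. by rewrite -Fstar_z -star_K act_K_z FstarZ zweight_conj. Qed.

Lemma act_K_zs k i : aK k (zs i) = (zweight k i)^-1 *: zs i.
Proof.
by rewrite -{2}(act_KKi k (zs i)) act_Ki_zs act_scale scalerA mulVf ?scale1r ?zweight_neq0.
Qed.

Definition star_sign k : C := if is_last k then -1 else 1.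

Lemma star_F k f : Fstar (aF k f) = - star_sign k *: aK k (aE k (aKi k (Fstar f))).
Proof.
rewrite act_star /Ustar /antipode /= !(actM, act_cst) rmorphN rmorph1.
by rewrite !act_scale scalerA mulrN1.
Qed.

Lemma star_E k f : Fstar (aE k f) = - star_sign k *: aK k (aF k (aKi k (Fstar f))).
Proof.
rewrite act_star /Ustar /antipode /= !(actM, act_cst) rmorphN rmorph1.
by rewrite !act_scale scalerA mulrN1.
Qed.

Lemma star_signK k : star_sign k * star_sign k = 1.
Proof. by rewrite /star_sign; case: ifP; rewrite ?mulrNN mulr1. Qed.

Lemma conj_Q2 : (Q ^+ 2)^* = Q ^+ 2.
Proof. by rewrite -toCxX toCx_conj. Qed.

(** The compatibility of the action with the involution, solved for the
    generator E_k itself: it transports every formula for F_k on the z^m to one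
    for E_k on the z^*m. *)
Lemma act_E_Fstar k f :
  aE k (Fstar f) = - (star_sign k * Q ^- 2) *: Fstar (aF k f).
Proof.
have := star_F k (aKi k f); rewrite star_Ki act_KiK => h.
have {h} : Fstar (aK k (aF k (aKi k f))) = - star_sign k *: aE k (Fstar f).
  by rewrite star_K h act_scale act_KiK.
rewrite act_KF act_KKi FstarZ fmorphV /= conj_Q2 => /(congr1 (fun g => - star_sign k *: g)).
by rewrite !scalerA mulrNN star_signK scale1r mulNr => <-.
Qed.

Lemma act_F_Fstar k f :
  aF k (Fstar f) = - (star_sign k * Q ^+ 2) *: Fstar (aE k f).
Proof.
have := star_E k (aKi k f); rewrite star_Ki act_KiK => h.
have {h} : Fstar (aK k (aE k (aKi k f))) = - star_sign k *: aF k (Fstar f).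
  by rewrite star_K h act_scale act_KiK.
rewrite act_KE act_KKi FstarZ conj_Q2 => /(congr1 (fun g => - star_sign k *: g)).
by rewrite !scalerA mulrNN star_signK scale1r mulNr => <-.
Qed.

Definition cE : C := toCx (- (Num.sqrt q / (1 - q ^+ 2))).
Definition cF : C := toCx (Num.sqrt q / (q ^- 2 - 1)).

Lemma sqrtq2 : S ^+ 2 = Q.
Proof. by rewrite -toCxX sqr_sqrtr // ltW. Qed.

Lemma S_neq0 : S != 0.
Proof. by rewrite toCx_eq0 sqrtr_eq0 -ltNge. Qed.

Lemma oneBQ2_neq0 : 1 - Q ^+ 2 != 0.
Proof.
rewrite -toCxX -toCx1 -toCxB toCx_eq0 subr_eq0 eq_sym; apply/negP => /eqP h.
by have /andP[_] := q2_itv hq0 hq1; rewrite h ltxx.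
Qed.

Lemma cFE : cF = S * Q ^+ 2 / (1 - Q ^+ 2).
Proof.
rewrite /cF !toCxE; have Q0 : Q != 0 by exact: Q_neq0.
have h := oneBQ2_neq0.
have e : Q ^- 2 - 1 = (1 - Q ^+ 2) / Q ^+ 2 by field.
by rewrite e; field; rewrite h Q0.
Qed.

Lemma cEE : cE = - S / (1 - Q ^+ 2).
Proof. by rewrite /cE !toCxE mulNr. Qed.

Lemma last_lt k i : is_last k -> i != k -> (i < k)%N.
Proof.
move=> /eqP kn ik; have := ltn_ord i; rewrite -[X in (_ < X)%N]kn ltnS leq_eqVlt.
by rewrite val_eqE (negbTE ik).
Qed.

Lemma last_sum0 k (F : 'I_n -> Fq) : is_last k -> \sum_(i < n | (k < i)%N) F i = 0.
Proof.
move=> /eqP kn; rewrite big1 // => i ki; have := ltn_ord i.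
by rewrite -[X in (_ < X)%N]kn ltnS leqNgt ki.
Qed.

Lemma zs_z_last k : is_last k ->
  zs k * z k = Q ^+ 2 *: (z k * zs k) + (1 - Q ^+ 2) *: (1 : Fq).
Proof. by move=> kl; rewrite zs_z_same last_sum0 // subr0. Qed.

Lemma scalar_eq (x y : C) f : x = y -> x *: f = y *: f. Proof. by move=> ->. Qed.

(** E_n acts as a twisted commutator with z_n. Both sides are twisted
    derivations, so it suffices to compare them on the generators. This is what
    makes the last index accessible: the invariance of an integral under E_n
    becomes a rule for exchanging z_n with a finite function under the integral
    sign. *)
Lemma act_En_inner k f : is_last k ->
  aE k f = cE *: (z k * f - aK k f * z k).
Proof.
move=> kl; have zk i : aK k (z i) = (if i == k then Q ^+ 2 else Q) *: z i.
  by rewrite act_K_z /zweight kl.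
elim/Fq_ind: f => [x|i|i||f g hf hg|f g hf hg].
- by rewrite !act_scale act_E1 act_K1 scaler0 scale_mulr scale_mull mulr1 mul1r subrr scaler0.
- rewrite act_En // zk; case: eqVneq => [->|ik].
    rewrite scale_mull -{2}[z k * z k]scale1r -scalerBl scalerA; apply: scalar_eq.
    by rewrite cEE toCxN; field; exact: oneBQ2_neq0.
  rewrite scale_mull (z_comm q (last_lt kl ik)) scalerA.
  rewrite -{2}[z k * z i]scale1r -scalerBl scalerA; apply: scalar_eq.
  by rewrite cEE toCxN; field; exact: oneBQ2_neq0.
- rewrite -{1}Fstar_z act_E_Fstar act_K_zs /zweight /star_sign kl.
  case: eqVneq => [->|ik].
    rewrite act_Fn_same // FstarZ Fstar1 toCx_conj scalerA scale_mull zs_z_last //.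
    rewrite [(Q ^- 2) *: _]scalerDr !scalerA mulVf ?expf_neq0 ?Q_neq0 // scale1r.
    rewrite opprD addrA subrr add0r -scaleNr scalerA; apply: scalar_eq.
    by rewrite cEE; field; rewrite oneBQ2_neq0 Q_neq0.
  rewrite act_Fn_other // Fstar0 scaler0 scale_mull zs_z // scalerA mulVf ?Q_neq0 //.
  by rewrite scale1r subrr scaler0.
- by rewrite act_K_f0 act_En_f0 // f0_z subr0.
- by rewrite !act_add hf hg -scalerDr mulrDl mulrDr opprD addrACA.
- rewrite act_EM act_KM hf hg scale_mull scale_mulr -scalerDr mulrBl mulrBr !mulrA.
  by rewrite addrA subrK.
Qed.

(** The counterpart for F_n, a twisted commutator with z_n^*. *)
Lemma act_Fn_inner k f : is_last k ->
  aF k f = cF *: (zs k * aKi k f - f * zs k).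
Proof.
move=> kl; have Q0 : Q != 0 by exact: Q_neq0.
elim/Fq_ind: f => [x|i|i||f g hf hg|f g hf hg].
- by rewrite !act_scale act_F1 act_Ki1 scaler0 scale_mulr scale_mull mulr1 mul1r subrr scaler0.
- rewrite act_Ki_z /zweight kl; case: eqVneq => [->|ik].
    rewrite act_Fn_same // scale_mulr zs_z_last // [(Q ^- 2) *: _]scalerDr !scalerA.
    rewrite mulVf ?expf_neq0 // scale1r addrAC subrr add0r scalerA; apply: scalar_eq.
    by rewrite cFE; field; rewrite oneBQ2_neq0 Q0.
  rewrite act_Fn_other // scale_mulr zs_z 1?eq_sym // scalerA mulVf //.
  by rewrite scale1r subrr scaler0.
- rewrite -{1}Fstar_z act_F_Fstar act_Ki_zs /zweight /star_sign kl act_En //.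
  rewrite FstarZ FstarM !Fstar_z toCx_conj scalerA scale_mulr; case: eqVneq => [->|ik].
    rewrite -{3}[zs k * zs k]scale1r -scalerBl scalerA; apply: scalar_eq.
    by rewrite cFE toCxN; field; exact: oneBQ2_neq0.
  rewrite (zs_comm q (last_lt kl ik)) scalerA.
  rewrite -{3}[zs i * zs k]scale1r -scalerBl scalerA; apply: scalar_eq.
  by rewrite cFE toCxN; field; exact: oneBQ2_neq0.
- rewrite act_Ki_f0 act_Fn_f0 // zs_f0 sub0r scalerN -scaleNr; apply: scalar_eq.
  by rewrite toCxN.
- by rewrite !act_add hf hg -scalerDr mulrDl mulrDr opprD addrACA.
- rewrite act_FM act_KiM hf hg scale_mull scale_mulr -scalerDr mulrBl mulrBr !mulrA.
  by rewrite addrA subrK.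
Qed.

Definition next k (l : 'I_n) : Prop := l = k.+1 :> nat.

(** The q-integer (q^p - q^(-p)) / (q - q^(-1)), written without negative
    exponents inside the numerator so that its zeros are visible. *)
Definition qnum (p : nat) : C := (Q ^- p) * Q * (1 - Q ^+ (2 * p)) / (1 - Q ^+ 2).

Lemma qnum0 : qnum 0 = 0.
Proof. by rewrite /qnum muln0 expr0 subrr mulr0 mul0r. Qed.

(** The two recursions of the q-integers correspond to the two sides of the
    twisted Leibniz rule from which a new letter can be added. *)
Lemma qnumSl p : qnum p.+1 = Q ^+ p + Q^-1 * qnum p.
Proof.
have Qp := expf_neq0 p (Q_neq0 hq0); have h := oneBQ2_neq0; have Q0 := Q_neq0 hq0.
rewrite /qnum mulnS exprD (exprS Q p) [(2 * p)%N]mulnC exprM.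
by move: (Q ^+ p) Qp => P Qp; field; rewrite h Q0 Qp.
Qed.

Lemma qnumSr p : qnum p.+1 = Q ^- p + Q * qnum p.
Proof.
have Qp := expf_neq0 p (Q_neq0 hq0); have h := oneBQ2_neq0; have Q0 := Q_neq0 hq0.
rewrite /qnum mulnS exprD (exprS Q p) [(2 * p)%N]mulnC exprM.
by move: (Q ^+ p) Qp => P Qp; field; rewrite h Q0 Qp.
Qed.

Lemma qnum_conj p : (qnum p)^* = qnum p.
Proof.
rewrite /qnum !rmorphM !fmorphV !rmorphB !rmorphXn rmorph1 /=.
by rewrite (toCx_conj q).
Qed.

Lemma next_nlast k l : next k l -> ~~ is_last k.
Proof. by rewrite /next => e; rewrite /is_last -e (ltn_eqF (ltn_ord l)). Qed.

Lemma next_neq k l : next k l -> l != k.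
Proof. by rewrite /next => e; rewrite -val_eqE /= e gtn_eqF. Qed.

Lemma nlast_next k : ~~ is_last k -> exists l, next k l.
Proof.
move=> h; have hk : (k.+1 < n)%N by have := ltn_ord k; rewrite leq_eqVlt [_ == n](negbTE h).
by exists (Ordinal hk).
Qed.

Lemma zweight_next k l : next k l -> zweight k l = Q^-1.
Proof.
by move=> e; rewrite /zweight (negbTE (next_nlast e)) (negbTE (next_neq e)) -e eqxx.
Qed.

Lemma zweight_self k l : next k l -> zweight k k = Q.
Proof. by move=> e; rewrite /zweight (negbTE (next_nlast e)) eqxx. Qed.

Lemma zweight_other k l i : next k l -> i != k -> i != l -> zweight k i = 1.
Proof.
move=> e ik il; rewrite /zweight (negbTE (next_nlast e)) (negbTE ik) -e.
by rewrite val_eqE (negbTE il).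
Qed.

Lemma weight_below k l m : next k l -> top_le m k -> weight k m = Q ^+ m k.
Proof.
move=> e h; rewrite /weight (bigD1 k) //= (zweight_self e) big1 ?mulr1 // => i ik.
have [il|il] := eqVneq i l; first by rewrite h ?expr0 // il e.
by rewrite (zweight_other e) // expr1n.
Qed.

(** For k < n the generators act on the span of z_k and z_(k+1) only, as in the
    vector representation; q-integers count the letters that can be replaced.
    *)
Lemma act_E_zmon k l m : next k l ->
  aE k (zmon m) = (S^-1 * qnum (m l)) *: zmon (inc (dec m l) k).
Proof.
move=> e; elim/midx_ind: m => [|m i mi IH].
  by rewrite zmon0 act_E1 ffunE qnum0 mulr0 scale0r.
have kl : (k < l)%N by rewrite e.
rewrite zmon_inc // act_EM IH scale_mulr.
have [il|il|/val_inj il] := ltngtP i l.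
- have nil : i != l by rewrite -val_eqE ltn_eqF.
  rewrite (act_E_other act (next_nlast e)) -?e ?val_eqE // mul0r add0r.
  by rewrite ffunE eq_sym (negbTE nil) addn0 mi // qnum0 mulr0 !scale0r.
- have nil : i != l by rewrite -val_eqE gtn_eqF.
  have nik : i != k by rewrite -val_eqE gtn_eqF // (ltn_trans kl).
  rewrite (act_E_other act (next_nlast e)) -?e ?val_eqE // mul0r add0r.
  rewrite act_K_z (zweight_other e) // scale1r z_zmon scalerA.
  rewrite ffunE eq_sym (negbTE nil) addn0; congr (_ *: _).
    rewrite above_top ?mulr1 // => j ij; rewrite !ffunE mi // sub0n add0n.
    by rewrite -val_eqE gtn_eqF // (ltn_trans _ ij) // (ltn_trans kl).
  by rewrite incC inc_dec_comm // eq_sym.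
rewrite {i}il in mi IH *.
rewrite (act_E_next act e) act_K_z (zweight_next e) dec_inc !scale_mull scalerA.
rewrite !z_zmon !scalerA ffunE eqxx addn1 qnumSl above_inc [(l < k)%N]ltnNge (ltnW kl) addn0.
rewrite toCxV.
have -> : above m k = m l.
  rewrite /above (bigD1 l) /= ?e // big1 ?addn0 // => j /andP[kj jl].
  by apply: mi; rewrite ltn_neqAle eq_sym val_eqE jl e.
rewrite (_ : above (dec m l) l = 0%N); last first.
  by apply: above_top => j lj; rewrite ffunE mi.
have [ml0|ml0] := posnP (m l).
  by rewrite ml0 qnum0 !(mulr0, mul0r) scale0r addr0 expr0 addr0.
rewrite -[inc (inc (dec m l) k) l]incC inc_dec // -scalerDl expr0.
by congr (_ *: _); ring.
Qed.

Lemma act_F_zmon k l m : next k l ->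
  aF k (zmon m) = (S * qnum (m k)) *: zmon (inc (dec m k) l).
Proof.
move=> e; elim/midx_ind: m => [|m i mi IH].
  by rewrite zmon0 act_F1 ffunE qnum0 mulr0 scale0r.
have kl : (k < l)%N by rewrite e.
rewrite zmon_inc // act_FM IH scale_mulr.
have [ik|ik|/val_inj ik] := ltngtP i k.
- have nik : i != k by rewrite -val_eqE ltn_eqF.
  rewrite (act_F_other act (next_nlast e)) // mul0r add0r.
  by rewrite ffunE eq_sym (negbTE nik) addn0 mi // qnum0 mulr0 !scale0r.
- have nik : i != k by rewrite -val_eqE gtn_eqF.
  have li : (l <= i)%N by rewrite e.
  rewrite (act_F_other act (next_nlast e)) // mul0r add0r z_zmon scalerA.
  rewrite ffunE eq_sym (negbTE nik) addn0; congr (_ *: _).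
    rewrite above_top ?mulr1 // => j ij; rewrite !ffunE mi // sub0n add0n.
    by rewrite -val_eqE gtn_eqF // (leq_ltn_trans li ij).
  by rewrite incC inc_dec_comm // eq_sym.
rewrite {i}ik in mi IH *.
rewrite (act_F_same act e) act_Ki_zmon (weight_below e) // dec_inc !scale_mull scale_mulr.
rewrite !z_zmon !scalerA ffunE eqxx addn1 qnumSr above_inc kl.
rewrite above_top => [|j lj]; last by rewrite mi // (ltn_trans kl).
rewrite (_ : above (dec m k) k = 0%N); last first.
  by apply: above_top => j kj; rewrite ffunE mi.
have [mk0|mk0] := posnP (m k).
  by rewrite mk0 qnum0 !(mulr0, mul0r) scale0r addr0 expr0 invr1 addr0 mulr1.
rewrite -[inc (inc (dec m k) l) k]incC inc_dec // -scalerDl expr0 add0n expr1.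
by congr (_ *: _); ring.
Qed.

Lemma act_Fn_zmon k m : is_last k ->
  aF k (zmon m) = (cF * (weight k m)^-1 * (1 - Q ^+ (2 * m k))) *: zmon (dec m k).
Proof.
move=> kl; elim/midx_ind: m => [|m i mi IH].
  by rewrite zmon0 act_F1 ffunE muln0 expr0 subrr mulr0 scale0r.
rewrite zmon_inc // act_FM IH scale_mulr weight_inc ffunE /zweight kl.
have w0 := weight_neq0 k m; have Q0 := Q_neq0 hq0; have h := oneBQ2_neq0.
case: (eqVneq i k) => [ik|nik].
  rewrite {i}ik in mi IH *.
  rewrite act_Fn_same // scale_mull mul1r act_Ki_zmon scalerA dec_inc.
  rewrite z_zmon scalerA (_ : above (dec m k) k = 0%N); last first.
    by apply: above_top => j kj; rewrite ffunE mi.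
  rewrite addn1 mulnS exprD.
  have [mk0|mk0] := posnP (m k).
    rewrite mk0 muln0 !expr0 subrr !(mulr0, mul0r) scale0r addr0 mulr1.
    by congr (_ *: _); rewrite cFE; field; rewrite h Q0 w0.
  rewrite inc_dec // -scalerDl expr0 mulr1; congr (_ *: _).
  by rewrite cFE; field; rewrite h Q0 w0.
have ik := last_lt kl nik.
rewrite (act_Fn_other act kl nik) mul0r add0r addn0.
by rewrite mi // muln0 expr0 subrr !mulr0 !scale0r.
Qed.

Lemma act_E_zsmon k l m : next k l ->
  aE k (zsmon m) = - (Q ^- 2 * S * qnum (m k)) *: zsmon (inc (dec m k) l).
Proof.
move=> e; rewrite -!Fstar_zmon act_E_Fstar (act_F_zmon _ e) FstarZ scalerA.
rewrite /star_sign (negbTE (next_nlast e)) mul1r rmorphM /= qnum_conj toCx_conj.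
by rewrite mulNr mulrA.
Qed.

Lemma act_F_zsmon k l m : next k l ->
  aF k (zsmon m) = - (Q ^+ 2 * S^-1 * qnum (m l)) *: zsmon (inc (dec m l) k).
Proof.
move=> e; rewrite -!Fstar_zmon act_F_Fstar (act_E_zmon _ e) FstarZ scalerA.
rewrite /star_sign (negbTE (next_nlast e)) mul1r rmorphM /= qnum_conj fmorphV /= toCx_conj.
by rewrite mulNr mulrA.
Qed.

Lemma finite_act_f0 x : finite_fun (act (Ucls (Gen x)) f0).
Proof.
have hf0 := finite_f0 n q.
case: x => k; rewrite -?/(tE k) -?/(tF k) -?/(tK k) -?/(tKinv k).
- case: (boolP (is_last k)) => kl; last by rewrite act_E_f0 //; exact: finite_fun0.
  by rewrite act_En_f0 //; apply: finite_funZ; exact: finite_funMl.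
- case: (boolP (is_last k)) => kl; last by rewrite act_F_f0 //; exact: finite_fun0.
  by rewrite act_Fn_f0 //; apply: finite_funZ; exact: finite_funMr.
- by rewrite act_K_f0.
- by rewrite act_Ki_f0.
Qed.

Lemma finite_act_gen x f : finite_fun f -> finite_fun (act (Ucls (Gen x)) f).
Proof.
move=> [s ->]; elim: s => [|p s IH]; first by rewrite big_nil act0; exact: finite_fun0.
rewrite big_cons act_add; apply: finite_funD IH.
have h0 := finite_act_f0 x; have hf0 := finite_f0 n q; case: x h0 => k.
- rewrite -/(tE k) => h0; rewrite !act_EM act_KM act_K_f0 mulrDl.
  by apply: finite_funD; [apply: finite_funD|];
     apply: finite_funMr; apply: finite_funMl.
- rewrite -/(tF k) => h0; rewrite !act_FM act_Ki_f0 mulrDl.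
  by apply: finite_funD; [apply: finite_funD|];
     apply: finite_funMr; apply: finite_funMl.
- rewrite -/(tK k) => h0; rewrite !act_KM act_K_f0.
  by apply: finite_funMr; apply: finite_funMl.
- rewrite -/(tKinv k) => h0; rewrite !act_KiM act_Ki_f0.
  by apply: finite_funMr; apply: finite_funMl.
Qed.

(** Finite functions form the ideal generated by f0, and the generators of the
    quantum group send f0 into that ideal. *)
Lemma finite_act t f : finite_fun f -> finite_fun (act (Ucls t) f).
Proof.
elim: t f => [x|x|s IHs u IHu|s IHs u IHu] f hf.
- exact: finite_act_gen.
- by rewrite act_cst; exact: finite_funZ.
- by rewrite actD; apply: finite_funD; [exact: IHs | exact: IHu].
- by rewrite actM; apply: IHs; exact: IHu.
Qed.

End Action.

(** * Partitions and pairs of multi-indices *)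

Section Partitions.
Variable n : nat.
Implicit Types (m k a b c : midx n) (ij : Dix n).

(** The entries of a multi-index as a function on all natural numbers, zero
    from n on, so that the entry after the last one needs no separate
    treatment. *)
Definition ext m (p : nat) : nat := (\sum_(l < n | l == p :> nat) m l)%N.
Definition tailsum m (p : nat) : nat := (\sum_(l < n | (p <= l)%N) m l)%N.

Lemma ext_ord m (i : 'I_n) : ext m i = m i.
Proof. by rewrite /ext (big_pred1 i). Qed.

Lemma ext_out m p : (n <= p)%N -> ext m p = 0%N.
Proof.
move=> np; rewrite /ext big_pred0 // => l; apply/negbTE.
by rewrite neq_ltn (leq_trans (ltn_ord l) np).
Qed.

Lemma tailsumS m p : tailsum m p = (ext m p + tailsum m p.+1)%N.
Proof.
rewrite /tailsum (bigID (fun l : 'I_n => l == p :> nat)) /=; congr (_ + _)%N.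
  by apply: eq_bigl => l; case: eqP => [->|]; rewrite ?leqnn ?andbF.
by apply: eq_bigl => l; rewrite [RHS]ltn_neqAle andbC eq_sym.
Qed.

Lemma tailsum_out m p : (n <= p)%N -> tailsum m p = 0%N.
Proof.
move=> np; rewrite /tailsum big_pred0 // => l; apply/negbTE.
by rewrite -ltnNge (leq_trans (ltn_ord l) np).
Qed.

Lemma ext_tail m p : ext (tail m) p = tailsum m p.
Proof.
have [pn|np] := ltnP p n; last by rewrite ext_out // tailsum_out.
by rewrite (ext_ord (tail m) (Ordinal pn)) ffunE.
Qed.

(** Successive differences recover a multi-index from its tails. *)
Definition untail k : midx n := [ffun j : 'I_n => (k j - ext k j.+1)%N].

Lemma tailK m : untail (tail m) = m.
Proof.
apply/ffunP => j; rewrite ffunE ext_tail ffunE.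
by rewrite -/(tailsum m j) tailsumS addnK ext_ord.
Qed.

Lemma untailK k : is_part k -> tail (untail k) = k.
Proof.
move=> kp; suff h d p : (n <= p + d)%N -> tailsum (untail k) p = ext k p.
  by apply/ffunP => j; rewrite ffunE -/(tailsum (untail k) j) (h n) ?ext_ord ?leq_addl.
elim: d p => [|d IH] p; first by rewrite addn0 => np; rewrite tailsum_out // ext_out.
(* Descending induction on p, encoded by d: nothing is left to sum beyond n. *)
rewrite addnS -addSn => /IH e; rewrite tailsumS e.
have [np|pn] := leqP n p; first by rewrite !ext_out // (leq_trans np).
rewrite -[p]/(nat_of_ord (Ordinal pn)) !ext_ord ffunE /= subnK //.
have [np|pn'] := leqP n p.+1; first by rewrite ext_out.
rewrite -[p.+1]/(nat_of_ord (Ordinal pn')) ext_ord.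
by have /forallP/(_ (Ordinal pn))/forallP/(_ (Ordinal pn'))/implyP := kp; apply => /=.
Qed.

Lemma ptail_inj : injective (@ptail n).
Proof. by move=> m m' /(congr1 val) /= e; rewrite -(tailK m) e tailK. Qed.

Lemma ptail_surj (k : Pn n) : exists m, k = ptail m.
Proof.
by exists (untail (val k)); apply/val_inj; rewrite /= untailK //; exact: valP.
Qed.

(** A pair (a, b) determines the disjoint pair (a - c, b - c): necessarily c is
    the entrywise minimum of a and b. *)
Lemma disj_sub_uniq (ij ij' : Dix n) b c :
  madd (val ij).2 c = madd (val ij').2 b -> madd (val ij).1 c = madd (val ij').1 b ->
  ij' = ij.
Proof.
case: ij ij' => [[i j] dij] [[i' j'] dij'] /= /ffunP h2 /ffunP h1.
have /forallP d := dij; have /forallP d' := dij'; apply/val_inj => /=.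
by congr (_, _); apply/ffunP => l; have := h1 l; have := h2 l;
   rewrite !ffunE; have := d l; have := d' l => /=; nia.
Qed.

Definition meet a b : midx n := [ffun i => minn (a i) (b i)].

Lemma disj_msub a b : disj_pair (msub a (meet a b), msub b (meet a b)).
Proof.
apply/forallP => l /=; rewrite !ffunE muln_eq0.
by case: (leqP (a l) (b l)) => h; rewrite subnn eqxx ?orbT.
Qed.

(** The normal form of z^a f0 z^*b is z^i phi z^*j, where z^i and z^*j have no
    common index. Counting letters gives i = a - min(a, b) and j = b - min(a,
    b), and phi is supported at the point of the spectrum of (y_1, ..., y_n)
    that belongs to min(a, b). *)
Definition mpt a b : Dix n * Pn n :=
  (exist (fun p : midx n * midx n => disj_pair p) _ (disj_msub a b), ptail (meet a b)).

Lemma meet_mlel a b : mle (meet a b) a.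
Proof. by apply/mleP => i; rewrite ffunE geq_minl. Qed.

Lemma meet_mler a b : mle (meet a b) b.
Proof. by apply/mleP => i; rewrite ffunE geq_minr. Qed.

Lemma mpt_madd ij c : mpt (madd (val ij).1 c) (madd (val ij).2 c) = (ij, ptail c).
Proof.
case: ij => -[i j] dij /=; have /forallP d := dij.
have mc : meet (madd i c) (madd j c) = c.
  by apply/ffunP => l; rewrite !ffunE; have /= := d l; nia.
rewrite /mpt; congr (_, _); last by rewrite mc.
by apply/val_inj => /=; rewrite mc; congr (_, _); apply/ffunP => l; rewrite !ffunE addnK.
Qed.

Lemma mpt_surj x : exists a b, x = mpt a b.
Proof.
case: x => ij k; have [c ->] := ptail_surj k.
by exists (madd (val ij).1 c), (madd (val ij).2 c); rewrite mpt_madd.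
Qed.

Lemma mpt_inj a b a' b' : mpt a b = mpt a' b' -> a = a' /\ b = b'.
Proof.
move=> eq; have e2 := ptail_inj (congr1 snd eq).
have [e1a e1b] : msub a (meet a b) = msub a' (meet a' b') /\
    msub b (meet a b) = msub b' (meet a' b').
  by have := congr1 (fun x => val x.1) eq => /= -[-> ->].
split.
  by rewrite -(msubK (meet_mlel a b)) -(msubK (meet_mlel a' b')) e1a e2.
by rewrite -(msubK (meet_mler a b)) -(msubK (meet_mler a' b')) e1b e2.
Qed.

End Partitions.

(** * Normal forms read off from the Fock representation *)

Section Fock.
Variables (R : realType) (n : nat) (q : R).
Hypotheses (hq0 : 0 < q) (hq1 : q < 1).
Variable H : fock_rep n q.
Notation C := (Cx R).
Notation Fq := (Fq n q).
Notation f0 := (@f0 R n q).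
Notation zmon := (zmon q).
Notation zsmon := (zsmon q).
Notation Q := (toCx q).
Notation e := (fbasis H).
Notation munit := (munit q).
Notation coeff := (@coeff R n q H).
Implicit Types (f g : Fq) (a b c m : midx n) (psi : distr R n) (ij : Dix n).

Lemma fock_lin f x (h h' : H) : fock f (x *: h + h') = x *: fock f h + fock f h'.
Proof. exact: fock_linear. Qed.

Lemma fock0 f : fock f (0 : H) = 0.
Proof. by have := fock_lin f (-1) 0 0; rewrite scaler0 addr0 scaleN1r addNr. Qed.

Lemma fockZ f x (h : H) : fock f (x *: h) = x *: fock f h.
Proof. by rewrite -[x *: h]addr0 fock_lin fock0 addr0. Qed.

Lemma fock0l (h : H) : fock (0 : Fq) h = 0.
Proof. by have := fock_linearl (-1) 0 0 h; rewrite scaler0 addr0 scaleN1r addNr. Qed.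

Lemma fockZl x f (h : H) : fock (x *: f) h = x *: fock f h.
Proof. by rewrite -[x *: f]addr0 fock_linearl fock0l addr0. Qed.

Lemma fock_f0_vac : fock f0 (vac H) = vac H.
Proof. by have := fock_f0 H midx0; rewrite eqxx zmon0 fock_one. Qed.

Lemma fbasis_ket b : e b = fock (zmon b * f0) (vac H).
Proof. by rewrite fock_mul fock_f0_vac. Qed.

Lemma fock_ket f b : fock f (e b) = fock (f * zmon b * f0) (vac H).
Proof. by rewrite fbasis_ket -fock_mul mulrA. Qed.

Lemma fock_zmon m c : fock (zmon m) (e c) = Q ^+ cross m c *: e (madd m c).
Proof. by rewrite fock_ket zmon_madd scale_mull fockZl -fbasis_ket. Qed.

Lemma fock_zsmon m c : fock (zsmon m) (e (madd m c)) =
  (Q ^+ cross m c * toCx (normN q (madd m c) / normN q c)) *: e c.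
Proof. by rewrite fock_ket zsmon_zmon_f0 // fockZl -fbasis_ket. Qed.

Lemma fock_zsmon_eq0 m a : ~~ mle m a -> fock (zsmon m) (e a) = 0.
Proof. by move=> h; rewrite fock_ket zsmon_zmon_f0_eq0 // fock0l. Qed.

Lemma fock_munit a b c : fock (munit a b) (e c) =
  (if c == b then toCx (normN q b) else 0) *: e a.
Proof.
rewrite fock_ket.
have -> : munit a b * zmon c * f0 = zmon a * (f0 * (zsmon b * (zmon c * f0))).
  by rewrite /munit !mulrA.
by rewrite f0_zsz_f0 // scale_mulr fockZl -fbasis_ket.
Qed.

Lemma fbasis_basis : is_basis e.
Proof. exact: fock_basis. Qed.

Lemma fin_supp_funy (phi : Pn n -> C) (h : H) :
  fin_supp (fun m => (phi (ptail m) * coords e h m) *: e m).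
Proof.
have [s hs] := coords_fin fbasis_basis h.
by exists s => i /hs ->; rewrite mulr0 scale0r.
Qed.

Lemma fun_y_lin phi x (h h' : H) :
  fun_y phi (x *: h + h') = x *: fun_y phi h + fun_y phi h'.
Proof.
rewrite /fun_y -fsum_lin; [|exact: fin_supp_funy..].
apply: eq_fsbigr => m _; rewrite (coords_lin fbasis_basis) scalerA -scalerDl.
by congr (_ *: _); ring.
Qed.

Lemma fun_y_basis phi m : fun_y phi (e m) = phi (ptail m) *: e m.
Proof.
rewrite /fun_y (fsum_single (i0 := m)) ?(coords_gen fbasis_basis) ?eqxx ?mulr1 //.
by move=> k /negbTE km; rewrite (coords_gen fbasis_basis) km mulr0 scale0r.
Qed.

Lemma fun_y_linl phi phi' phi'' x (h : H) :
  (forall k, phi'' k = x * phi k + phi' k) ->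
  fun_y phi'' h = x *: fun_y phi h + fun_y phi' h.
Proof.
move=> e'; rewrite /fun_y -fsum_lin; [|exact: fin_supp_funy..].
apply: eq_fsbigr => m _; rewrite e' scalerA -scalerDl.
by congr (_ *: _); ring.
Qed.

Lemma fun_y0 (h : H) : fun_y (fun=> 0) h = 0.
Proof. by rewrite /fun_y fsbig1 // => m _; rewrite mul0r scale0r. Qed.

Lemma series_term_lin psi ij : linear (@series_term R n q H psi ij).
Proof. by move=> x h h'; rewrite /series_term fock_lin fun_y_lin fock_lin. Qed.

(** The matrix entry of z^i z^*j between the basis vectors of indices j + c and
    i + c. *)
Definition term_scale (ij : Dix n) c : C :=
  Q ^+ cross (val ij).2 c * toCx (normN q (madd (val ij).2 c) / normN q c)
  * Q ^+ cross (val ij).1 c.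

Lemma term_scale_neq0 ij c : term_scale ij c != 0.
Proof.
rewrite /term_scale !mulf_neq0 ?Qexp_neq0 // toCx_eq0 mulf_neq0 ?invr_eq0 //.
  by rewrite gt_eqF // normN_gt0.
by rewrite gt_eqF // normN_gt0.
Qed.

Lemma series_term_basis psi ij c :
  series_term psi ij (e (madd (val ij).2 c)) =
  (term_scale ij c * psi (ij, ptail c)) *: e (madd (val ij).1 c).
Proof.
rewrite /series_term fock_zsmon -[_ *: e c]addr0 fun_y_lin fun_y_basis.
have -> : fun_y (fun k => psi (ij, k)) (0 : H) = 0.
  by rewrite /fun_y fsbig1 // => m _; rewrite (coords0 fbasis_basis) mulr0 scale0r.
rewrite addr0 !fockZ fock_zmon !scalerA; congr (_ *: _).
by rewrite /term_scale; ring.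
Qed.

Lemma series_term_basis0 psi ij b : ~~ mle (val ij).2 b ->
  series_term psi ij (e b) = 0.
Proof.
move=> h; rewrite /series_term fock_zsmon_eq0 //.
rewrite (_ : fun_y _ _ = 0) ?fock0 //.
by rewrite /fun_y fsbig1 // => m _; rewrite (coords0 fbasis_basis) mulr0 scale0r.
Qed.

Definition is_coeff f psi : Prop :=
  finite_set [set ij | exists k, psi (ij, k) != 0] /\
  forall h : H, fock f h = \sum_(ij \in [set: Dix n]) series_term psi ij h.

Lemma fin_supp_series psi (h : H) :
  finite_set [set ij | exists k, psi (ij, k) != 0] ->
  fin_supp (fun ij => series_term psi ij h).
Proof.
move=> fs; apply/fin_suppP; apply: sub_finite_set fs => ij /=.
apply: contra_neqP => hn; rewrite /series_term.
have -> : (fun k => psi (ij, k)) = (fun=> 0).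
  by apply/funext => k; apply/eqP/negPn/negP => h'; apply: hn; exists k.
by rewrite fun_y0 fock0.
Qed.

(** A coefficient is read off from one matrix entry: among all disjoint pairs
    only (i, j) contributes to the entry between j + c and i + c, by
    [disj_sub_uniq]. This gives uniqueness of the normal form. *)
Lemma is_coeff_coords f psi ij c : is_coeff f psi ->
  coords e (fock f (e (madd (val ij).2 c))) (madd (val ij).1 c) =
  term_scale ij c * psi (ij, ptail c).
Proof.
move=> [fs ->]; have fsb := fin_supp_series (e (madd (val ij).2 c)) fs.
have [s us hs] := fin_supp_seq fsb.
have [t [ut tij ht]] : exists t : seq (Dix n), [/\ uniq t, ij \in t &
    forall x, x \notin t -> series_term psi x (e (madd (val ij).2 c)) = 0].
  (* The pair under study is put in the enumeration even if its term vanishes. *)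
  exists (undup (ij :: s)); rewrite undup_uniq mem_undup mem_head; split => // x.
  by rewrite mem_undup inE => /norP[_ /hs].
rewrite (fsum_seq ut ht) (bigD1_seq ij) //=.
rewrite -[X in X + _]scale1r (coords_lin fbasis_basis) mul1r series_term_basis.
rewrite (coordsZ fbasis_basis) (coords_gen fbasis_basis) eqxx mulr1.
rewrite -[RHS]addr0; congr (_ + _).
elim: t {ut tij ht} => [|x t IH]; first by rewrite big_nil (coords0 fbasis_basis).
rewrite big_cons; case: ifP => xij //.
rewrite -[X in X + _]scale1r (coords_lin fbasis_basis) mul1r IH addr0.
have [le|nle] := boolP (mle (val x).2 (madd (val ij).2 c)); last first.
  by rewrite series_term_basis0 // (coords0 fbasis_basis).
rewrite -{1}(msubK le) series_term_basis (coordsZ fbasis_basis) (coords_gen fbasis_basis).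
case: eqP => [eq1|]; last by rewrite mulr0.
by move/negP: xij; case; apply/eqP; apply: disj_sub_uniq eq1; rewrite msubK.
Qed.

Lemma is_coeff_uniq f psi psi' : is_coeff f psi -> is_coeff f psi' -> psi = psi'.
Proof.
move=> h h'; apply/funext => -[ij k]; have [c ->] := ptail_surj k.
apply: (mulfI (term_scale_neq0 ij c)).
by rewrite -(is_coeff_coords ij c h) -(is_coeff_coords ij c h').
Qed.

Lemma coeffE f psi : is_coeff f psi -> coeff f = psi.
Proof.
move=> h; rewrite /Defs.coeff; case: xgetP => [psi' _ h'|/(_ psi)/(_ h) //].
exact: is_coeff_uniq h' h.
Qed.

Lemma is_coeff_lin x f g psi psi' : is_coeff f psi -> is_coeff g psi' ->
  is_coeff (x *: f + g) (x *: psi + psi').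
Proof.
move=> [ff hf] [fg hg]; split.
  apply: (@sub_finite_set _ _ ([set ij | exists k, psi (ij, k) != 0] `|`
          [set ij | exists k, psi' (ij, k) != 0])); last by rewrite finite_setU.
  move=> ij /= [k hk]; apply: contrapT => /not_orP[h1 h2]; case/eqP: hk.
  change (x * psi (ij, k) + psi' (ij, k) = 0).
  have -> : psi (ij, k) = 0 by apply/eqP/negPn/negP => h; apply: h1; exists k.
  have -> : psi' (ij, k) = 0 by apply/eqP/negPn/negP => h; apply: h2; exists k.
  by rewrite mulr0 addr0.
move=> h; rewrite fock_linearl hf hg -fsum_lin; [|exact: fin_supp_series..].
apply: eq_fsbigr => ij _; rewrite /series_term -fock_lin; congr (fock _ _).
by apply: esym; apply: (@fun_y_linl (fun k => psi (ij, k)) (fun k => psi' (ij, k))).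
Qed.

Lemma is_coeff0 : is_coeff 0 (fun=> 0).
Proof.
split=> [|h].
  by apply: (@sub_finite_set _ _ set0) => // ij /= [k]; rewrite eqxx.
rewrite fock0l fsbig1 // => ij _; rewrite /series_term fun_y0 fock0 //.
Qed.

(** Existence of the normal form for an operator that shifts the basis in one
    direction (i, j): the shift amplitudes divided by those of z^i z^*j give
    the coefficient function. *)
Lemma is_coeff_homog f ij (g : midx n -> C) psi :
  (forall c, fock f (e (madd (val ij).2 c)) =
     g c *: e (madd (val ij).1 c)) ->
  (forall b, ~~ mle (val ij).2 b -> fock f (e b) = 0) ->
  (forall c, g c = term_scale ij c * psi (ij, ptail c)) ->
  (forall ij' k, ij' != ij -> psi (ij', k) = 0) -> is_coeff f psi.
Proof.
move=> h1 h2 hg hpsi; split.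
  apply: (@sub_finite_set _ _ [set ij]) => // x /= [k]; apply: contraPP.
  by move=> /eqP xij; rewrite hpsi // eqxx.
have hs (h : H) x : x != ij -> series_term psi x h = 0.
  move=> xij; rewrite /series_term.
  have -> : (fun k => psi (x, k)) = (fun=> 0) by apply/funext => k; exact: hpsi.
  by rewrite fun_y0 fock0.
move=> h; rewrite (fsum_single (i0 := ij)); last by move=> x; exact: hs.
apply: (basis_ext fbasis_basis (fock_linear f) (@series_term_lin psi ij)) => b.
have [le|nle] := boolP (mle (val ij).2 b).
  by rewrite -(msubK le) h1 series_term_basis hg.
by rewrite h2 // series_term_basis0.
Qed.

Definition pmass (x : Dix n * Pn n) : distr R n := fun y => (y == x)%:R.

Definition mscale a b : C := toCx (normN q b) / term_scale (mpt a b).1 (meet a b).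

Lemma mscale_neq0 a b : mscale a b != 0.
Proof. by rewrite mulf_neq0 ?invr_eq0 ?term_scale_neq0 // normNC_neq0. Qed.

Lemma is_coeff_munit a b : is_coeff (munit a b) (mscale a b *: pmass (mpt a b)).
Proof.
pose ij := (mpt a b).1; pose c0 := meet a b.
have ea : madd (val ij).1 c0 = a by rewrite maddC msubK ?meet_mlel.
have eb : madd (val ij).2 c0 = b by rewrite maddC msubK ?meet_mler.
have pmE y : (mscale a b *: pmass (mpt a b)) y = mscale a b * (y == mpt a b)%:R by [].
apply: (@is_coeff_homog _ ij (fun c => if c == c0 then toCx (normN q b) else 0)).
- move=> c; rewrite fock_munit -{1}eb; have [->|cc] := eqVneq c c0.
    by rewrite eqxx ea.
  by rewrite (inj_eq (@madd_inj _ _)) (negbTE cc) !scale0r.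
- move=> b' nle; rewrite fock_munit; case: eqP => [be|]; last by rewrite scale0r.
  by move: nle; rewrite be -eb mle_madd.
- move=> c; rewrite pmE [mpt a b]surjective_pairing xpair_eqE eqxx andTb.
  rewrite (inj_eq (@ptail_inj _)) -/c0; case: eqVneq => [->|_].
    by rewrite mulr1 mulrCA mulfV ?mulr1 ?term_scale_neq0.
  by rewrite !mulr0.
- move=> ij' k ne; rewrite pmE [mpt a b]surjective_pairing xpair_eqE (negbTE ne).
  by rewrite mulr0.
Qed.

Lemma finite_is_coeff f : finite_fun f -> is_coeff f (coeff f).
Proof.
suff h : finite_fun f -> exists psi, is_coeff f psi.
  by move=> /h [psi hpsi]; rewrite (coeffE hpsi).
elim/finite_ind => //; first by exists (fun=> 0); exact: is_coeff0.
  move=> x g g' _ _ [psi h] [psi' h']; exists (x *: psi + psi'); exact: is_coeff_lin.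
by move=> a b; exists (mscale a b *: pmass (mpt a b)); exact: is_coeff_munit.
Qed.

Lemma coeff_lin x f g : finite_fun f -> finite_fun g ->
  coeff (x *: f + g) = x *: coeff f + coeff g.
Proof. by move=> hf hg; apply: coeffE; apply: is_coeff_lin; exact: finite_is_coeff. Qed.

(** Matrix units correspond to point masses. Hence the finite functions have
    finitely supported coefficients, and every computation with them reduces to
    one with pairs of multi-indices. *)
Lemma coeff_munit a b : coeff (munit a b) = mscale a b *: pmass (mpt a b).
Proof. exact/coeffE/is_coeff_munit. Qed.

Lemma coeff0 : coeff 0 = (fun=> 0).
Proof. exact/coeffE/is_coeff0. Qed.

End Fock.

(** * Weighted traces of finite functions *)

Section Weights.
Variables (R : realType) (n : nat).
Implicit Types (m : midx n) (x y : R).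

(** The weights of both integrals have this shape. *)
Definition wprod x y m : R :=
  \prod_(j < n) (if j == 0%N :> nat then x ^+ m j else y ^+ m j).

Lemma tail_inc m (l j : 'I_n) : tail (inc m l) j = (tail m j + (j <= l))%N.
Proof. by rewrite !ffunE sum_inc. Qed.

(** Raising m_l by one raises the tails of index at most l by one: the first of
    them contributes x and the l others contribute y. *)
Lemma wprod_inc x y m (l : 'I_n) :
  wprod x y (tail (inc m l)) = wprod x y (tail m) * (x * y ^+ l).
Proof.
rewrite /wprod (eq_bigr (fun j : 'I_n => (if j == 0%N :> nat then x ^+ tail m j
    else y ^+ tail m j) * ((if j == 0%N :> nat then x else 1) *
    (if (0 < j <= l)%N then y else 1)))); last first.
  move=> j _; rewrite tail_inc; case: (posnP j) => [->|j0].
    by rewrite /= addn1 exprSr mulr1.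
  by rewrite mul1r /=; case: leqP => _; rewrite ?addn1 ?exprSr // addn0 mulr1.
rewrite big_split big_split /=; congr (_ * (_ * _)).
  have n0 : (0 < n)%N by apply: leq_ltn_trans (ltn_ord l).
  by rewrite -big_mkcond (big_pred1 (Ordinal n0)).
rewrite -(big_mkord xpredT (fun j => if (0 < j <= l)%N then y else 1)).
rewrite (@big_cat_nat _ _ _ l.+1) //= [X in _ * X]big_nat [X in _ * X]big1 ?mulr1; last first.
  by move=> i /andP[li _]; rewrite [(i <= l)%N]leqNgt li andbF.
rewrite big_nat_recl // mul1r (@eq_big_nat _ _ _ 0 l _ (fun=> y)).
  by rewrite prodr_const_nat subn0.
by move=> i /andP[_ il]; rewrite /= il.
Qed.

End Weights.

Section WeightedTraces.
Variables (R : realType) (n : nat) (q : R).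
Hypotheses (hq0 : 0 < q) (hq1 : q < 1).
Variable act : module_algebra n q.
Variable H : fock_rep n q.
Notation C := (Cx R).
Notation Fq := (Fq n q).
Notation Q := (toCx q).
Notation S := (toCx (Num.sqrt q)).
Notation Ucls := (cls (Urel q)).
Notation munit := (munit q).
Notation coeff := (@coeff R n q H).
Notation aK k := (act (Ucls (tK k))).
Notation aKi k := (act (Ucls (tKinv k))).
Notation weight := (@weight R n q).
Implicit Types (f g : Fq) (a b c m : midx n) (k l : 'I_n).

Section OneWeight.
Variable W : midx n -> R.

(** The integrals over finite functions are, up to a constant, of this form; on
    matrix units such a functional is a trace with weights. *)
Definition tau f : C :=
  \sum_(k \in [set: Pn n]) coeff f (Dix0, k) * toCx (W (val k)).

Lemma tauE f : tau f = \sum_(k \in [set: Pn n]) coeff f (Dix0, k) * toCx (W (val k)).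
Proof. by []. Qed.

Lemma mpt_diag c : mpt c c = (Dix0, ptail c).
Proof. by rewrite -(mpt_madd Dix0 c) /= madd0. Qed.

Lemma coeff_munit_diag a b c : coeff (munit a b) (Dix0, ptail c) =
  if (a == c) && (b == c) then toCx (normN q c) else 0.
Proof.
rewrite (coeff_munit hq0 hq1) -mpt_diag.
change (mscale q a b * (mpt c c == mpt a b)%:R = if (a == c) && (b == c) then toCx (normN q c) else 0).
case: (altP andP) => [[/eqP -> /eqP ->]|h].
  rewrite eqxx mulr1 /mscale mpt_diag /term_scale /= madd0.
  by rewrite cross0 divff ?gt_eqF ?normN_gt0 // toCx1 expr0 !mulr1 divr1.
case: eqP => [/mpt_inj[e1 e2]|]; last by rewrite mulr0.
by case: h; rewrite -e1 -e2 !eqxx.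
Qed.

Lemma tau_fin f : finite_fun f ->
  fin_supp (fun p => coeff f (Dix0, p) * toCx (W (val p)) : C^o).
Proof.
elim/finite_ind => [|x g h hg hh [s hs] [t ht]|a b].
- by exists [::] => k _; rewrite (coeff0 hq0 hq1) mul0r.
- exists (s ++ t) => k; rewrite mem_cat => /norP[/hs e1 /ht e2].
  rewrite (coeff_lin hq0 hq1) //.
  change ((x * coeff g (Dix0, k) + coeff h (Dix0, k)) * toCx (W (val k)) = 0).
  by rewrite mulrDl -mulrA e1 e2 mulr0 addr0.
- exists [:: ptail a] => k; have [c ->] := ptail_surj k.
  rewrite inE (inj_eq (@ptail_inj _)) => /negbTE ca.
  by rewrite coeff_munit_diag eq_sym ca /= mul0r.
Qed.

Lemma tau_lin x f g : finite_fun f -> finite_fun g ->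
  tau (x *: f + g) = x * tau f + tau g.
Proof.
move=> hf hg; rewrite /tau -(@fsum_lin _ _ C^o); [|exact: tau_fin..].
apply: eq_fsbigr => k _; rewrite (coeff_lin hq0 hq1) //.
change ((x * coeff f (Dix0, k) + coeff g (Dix0, k)) * toCx (W (val k)) =
  x * (coeff f (Dix0, k) * toCx (W (val k))) + coeff g (Dix0, k) * toCx (W (val k))).
by rewrite mulrDl mulrA.
Qed.

Lemma tau0 : tau 0 = 0.
Proof. by rewrite /tau fsbig1 // => k _; rewrite (coeff0 hq0 hq1) mul0r. Qed.

Lemma tauZ x f : finite_fun f -> tau (x *: f) = x * tau f.
Proof.
by move=> hf; rewrite -[x *: f]addr0 tau_lin // ?tau0 ?addr0 //; exact: finite_fun0.
Qed.

Lemma tauB f g : finite_fun f -> finite_fun g -> tau (f - g) = tau f - tau g.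
Proof.
move=> hf hg; have -> : f - g = (-1) *: g + f by rewrite scaleN1r addrC.
by rewrite tau_lin // mulN1r addrC.
Qed.

Lemma tau_munit a b :
  tau (munit a b) = if a == b then toCx (normN q a * W (tail a)) else 0.
Proof.
rewrite /tau (fsum_single (i0 := ptail a)).
  by rewrite coeff_munit_diag eqxx eq_sym /=; case: ifP; rewrite ?mul0r // -toCxM.
move=> k; have [c ->] := ptail_surj k; rewrite (inj_eq (@ptail_inj _)) eq_sym => /negbTE ca.
by rewrite coeff_munit_diag ca mul0r.
Qed.

(** Linear identities between traces may be checked on matrix units. *)
Lemma tau_ext (phi psi : Fq -> Fq) (x : C) :
  linear phi -> linear psi ->
  (forall f, finite_fun f -> finite_fun (phi f)) ->
  (forall f, finite_fun f -> finite_fun (psi f)) ->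
  (forall a b, tau (phi (munit a b)) = x * tau (psi (munit a b))) ->
  forall f, finite_fun f -> tau (phi f) = x * tau (psi f).
Proof.
move=> lphi lpsi fphi fpsi h f; elim/finite_ind => [|y g g' hg hg' e e'|//].
  by rewrite (lin0 lphi) (lin0 lpsi) tau0 mulr0.
rewrite lphi lpsi (tau_lin y (fphi _ hg) (fphi _ hg')).
by rewrite (tau_lin y (fpsi _ hg) (fpsi _ hg')) e e'; ring.
Qed.

Lemma tau_K k f : finite_fun f -> tau (aK k f) = tau f.
Proof.
move=> hf; rewrite -[RHS]mul1r; apply: (tau_ext (psi := id)) hf => //.
- exact: act_linear.
- by move=> g; exact: finite_act.
move=> a b; rewrite mul1r munitE !act_KM act_K_f0 act_K_zmon // act_K_zsmon //.
rewrite !(scale_mull, scale_mulr) scalerA tauZ ?tau_munit; last exact: finite_munit.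
case: eqP => [->|_]; last by rewrite mulr0.
by rewrite mulfV ?mul1r // weight_neq0.
Qed.

Lemma tau_Ki k f : finite_fun f -> tau (aKi k f) = tau f.
Proof. by move=> hf; rewrite -(tau_K k) ?act_KKi //; exact: finite_act. Qed.

Section NotLast.
Variables (k l : 'I_n) (kl : next k l).
Hypothesis hW : forall m, W (tail (inc m l)) = q ^+ 2 * W (tail (inc m k)).

(** For k < n the image of z^a f0 z^*b under a generator is a combination of
    two matrix units. Either both are diagonal, in the situation of the first
    case, or each of them is off the diagonal or has coefficient zero. *)
Lemma swap_cases a b :
  (exists c, a = inc c l /\ b = inc c k) \/
  ((a l = 0%N \/ inc (dec a l) k != b) /\ (b k = 0%N \/ a != inc (dec b k) l)).
Proof.
have [al|al] := posnP (a l).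
  right; split; first by left.
  have [bk|bk] := posnP (b k); [by left | right].
  apply/eqP => e; move: al; rewrite e !ffunE eqxx addn1 //.
have [e|ne] := eqVneq (inc (dec a l) k) b.
  by left; exists (dec a l); rewrite inc_dec.
right; split; first by right.
have [bk|bk] := posnP (b k); [by left | right].
by apply: contra ne => /eqP ->; rewrite dec_inc inc_dec.
Qed.

Lemma weight_next m : weight k m = Q ^+ m k / Q ^+ m l.
Proof.
have lk := next_neq kl.
rewrite !weightE (bigD1 k) //= (bigD1 l) //= (zweight_self _ kl) (zweight_next _ kl).
rewrite big1 ?mulr1 ?exprVn // => i /andP[ik il].
by rewrite (zweight_other _ kl) // expr1n.
Qed.

Lemma qnumSE p : qnum q p.+1 = (1 - Q ^+ (2 * p.+1)) / (Q ^+ p * (1 - Q ^+ 2)).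
Proof.
rewrite /qnum (exprS Q p); have Qp := expf_neq0 p (Q_neq0 hq0).
move: (Q ^+ (2 * p.+1)) => Y; field.
by rewrite Qp Q_neq0 // oneBQ2_neq0.
Qed.

(** The cancellation of the two diagonal contributions: the ratio of the norms
    of the states c + k and c + l is compensated by the ratio q^2 of the
    weights. *)
Lemma swap_scalar c :
  S^-1 * qnum q (c l).+1 * toCx (normN q (inc c k) * W (tail (inc c k))) =
  weight k (inc c l) * (Q ^- 2 * S * qnum q (c k).+1) *
  toCx (normN q (inc c l) * W (tail (inc c l))).
Proof.
rewrite hW !normN_inc !toCxE weight_next !qnumSE !ffunE eqxx.
rewrite eq_sym (negbTE (next_neq kl)) addn0 addn1 (exprS Q (c l)).
have Qk := expf_neq0 (c k) (Q_neq0 hq0); have Ql := expf_neq0 (c l) (Q_neq0 hq0).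
have S0 := S_neq0 hq0; have h := oneBQ2_neq0 hq0 hq1.
move: (Q ^+ (2 * _)) (Q ^+ (2 * _)) (toCx (normN q c)) (toCx (W _)) => u v N w.
move: (Q ^+ c k) (Q ^+ c l) Qk Ql => A B A0 B0.
rewrite -(sqrtq2 hq0) in h *; move: S S0 h => s s0 h.
by field; rewrite h s0 A0 B0.
Qed.

End NotLast.

End OneWeight.

Notation z := (z q).
Notation zs := (zs q).
Notation f0 := (@f0 R n q).
Notation zmon := (zmon q).
Notation zsmon := (zsmon q).
Notation aE k := (act (Ucls (tE k))).
Notation aF k := (act (Ucls (tF k))).

(** * Invariance of weighted traces *)

Section NotLast.
Variable W : midx n -> R.
Variables (k l : 'I_n) (kl : next k l).
Hypothesis hW : forall m, W (tail (inc m l)) = q ^+ 2 * W (tail (inc m k)).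

Lemma act_E_munit a b : aE k (munit a b) =
  (S^-1 * qnum q (a l)) *: munit (inc (dec a l) k) b
  - (weight k a * (Q ^- 2 * S * qnum q (b k))) *: munit a (inc (dec b k) l).
Proof.
rewrite !munitE !act_EM act_KM act_K_f0 (act_E_f0 act (next_nlast kl)) mulr0 addr0.
rewrite (act_E_zmon hq0 hq1 act _ kl) (act_E_zsmon hq0 hq1 act _ kl) (act_K_zmon act).
by rewrite !scale_mull !scale_mulr !scaleNr scalerN scalerA.
Qed.

Lemma act_F_munit a b : aF k (munit a b) =
  (S * qnum q (a k) * weight k b) *: munit (inc (dec a k) l) b
  - (Q ^+ 2 * S^-1 * qnum q (b l)) *: munit a (inc (dec b l) k).
Proof.
rewrite !munitE !act_FM (act_Ki_f0 act) (act_F_f0 act (next_nlast kl)) mulr0 addr0.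
rewrite (act_F_zmon hq0 hq1 act _ kl) (act_F_zsmon hq0 hq1 act _ kl) (act_Ki_zsmon act).
by rewrite !scale_mull !scale_mulr !scaleNr scalerA.
Qed.

Lemma tau_act_ext (xi : Uq n q) f :
  (forall g, finite_fun g -> finite_fun (act xi g)) ->
  (forall a b, tau W (act xi (munit a b)) = 0) -> finite_fun f ->
  tau W (act xi f) = 0.
Proof.
move=> fin h hf; rewrite (tau_ext (psi := id) (x := 0) _ _ fin _ _ hf) ?mul0r //.
- exact: act_linear.
- by move=> a b; rewrite h mul0r.
Qed.

Lemma tau_E f : finite_fun f -> tau W (aE k f) = 0.
Proof.
apply: tau_act_ext => [g|a b]; first exact: finite_act.
rewrite act_E_munit tauB ?tauZ ?tau_munit; first last;
  try by [do ?apply: finite_funZ; exact: finite_munit].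
have [[c [-> ->]]|[ha hb]] := swap_cases k l a b.
  rewrite !dec_inc !eqxx !ffunE !eqxx !addn1 (swap_scalar kl hW).
  by rewrite subrr.
have h1 : inc (dec a l) k == b -> qnum q (a l) = 0.
  by case: ha => [->|/negP h /eqP e]; [rewrite qnum0 | case: h; rewrite e].
have h2 : a == inc (dec b k) l -> qnum q (b k) = 0.
  by case: hb => [->|/negP h /eqP e]; [rewrite qnum0 | case: h; rewrite e].
case: ifP => [/h1 ->|_]; case: ifP => [/h2 ->|_];
  by rewrite !(mulr0, mul0r) subrr.
Qed.

Lemma tau_F f : finite_fun f -> tau W (aF k f) = 0.
Proof.
apply: tau_act_ext => [g|a b]; first exact: finite_act.
rewrite act_F_munit tauB ?tauZ ?tau_munit; first last;
  try by [do ?apply: finite_funZ; exact: finite_munit].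
have [[c [-> ->]]|[hb ha]] := swap_cases k l b a.
  rewrite !dec_inc !eqxx !ffunE !eqxx !addn1.
  have Q0 := Q_neq0 hq0; have e := swap_scalar kl hW c.
  apply/eqP; rewrite subr_eq0; apply/eqP.
  transitivity (Q ^+ 2 * (S^-1 * qnum q (c l).+1 *
    toCx (normN q (inc c k) * W (tail (inc c k))))); last by rewrite !mulrA.
  rewrite e.
  move: (weight _ _) (toCx (normN _ _ * _)) (qnum _ _) S => w x y s.
  by field.
have h1 : inc (dec a k) l == b -> qnum q (a k) = 0.
  by case: ha => [->|/negP h /eqP e]; [rewrite qnum0 | case: h; rewrite e].
have h2 : a == inc (dec b l) k -> qnum q (b l) = 0.
  by case: hb => [->|/negP h /eqP e]; [rewrite qnum0 | case: h; rewrite e].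
case: ifP => [/h1 ->|_]; case: ifP => [/h2 ->|_];
  by rewrite !(mulr0, mul0r) subrr.
Qed.

End NotLast.

Section Last.
Variables (W : midx n -> R) (k : 'I_n) (kl : is_last k) (lam : R).
Hypothesis hW : forall m, W (tail (inc m k)) = lam * W (tail m).

Lemma above_last m : above m k = 0%N.
Proof.
apply: above_top => i ki; have := ltn_ord i.
by rewrite -[X in (_ < X)%N](eqP kl) ltnS leqNgt ki.
Qed.

Lemma z_munit_last a b : z k * munit a b = munit (inc a k) b.
Proof. by rewrite !munitE !mulrA z_zmon above_last scale1r. Qed.

Lemma munit_zs_last a b : munit a b * zs k = munit a (inc b k).
Proof. by rewrite !munitE -!mulrA zsmon_zs above_last scale1r. Qed.

Lemma zs_munit_last a b :
  zs k * munit a b = (1 - Q ^+ (2 * a k)) *: munit (dec a k) b.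
Proof.
rewrite !munitE !mulrA zs_zmon_f0 above_last mul1r.
by rewrite scale_mull.
Qed.

Lemma munit_z_last a b :
  munit a b * z k = (1 - Q ^+ (2 * b k)) *: munit a (dec b k).
Proof.
rewrite !munitE -!mulrA; have -> : f0 * (zsmon b * z k) = Fstar (zs k * zmon b * f0).
  by rewrite !FstarM Fstar_f0 Fstar_zmon Fstar_zs.
rewrite zs_zmon_f0 above_last mul1r FstarZ FstarM Fstar_f0 Fstar_zmon scale_mulr.
by rewrite rmorphB rmorph1 rmorphXn /= toCx_conj.
Qed.

(** A weighted trace is not cyclic: multiplication by z_n changes the weight by
    a constant factor, which is the price of exchanging z_n with a finite
    function. *)
Lemma tau_z_last f : finite_fun f -> tau W (z k * f) = toCx lam * tau W (f * z k).
Proof.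
apply: (tau_ext (phi := fun f => z k * f) (psi := fun f => f * z k));
  [exact: mull_linear | exact: mulr_linear
  | by move=> g; exact: finite_funMl | by move=> g; exact: finite_funMr |].
move=> a b; rewrite z_munit_last munit_z_last tauZ; last exact: finite_munit.
rewrite !tau_munit.
have [bk|bk] := posnP (b k).
  rewrite bk muln0 subrr mul0r mulr0; case: eqP => // e.
  by move: bk; rewrite -e ffunE eqxx addn1.
have -> : (inc a k == b) = (a == dec b k).
  by apply/eqP/eqP => [<-|->]; rewrite ?dec_inc ?inc_dec.
case: eqP => [->|_]; last by rewrite !mulr0.
rewrite normN_inc hW ffunE eqxx subn1 prednK // !toCxE; ring.
Qed.

Lemma tau_zs_last f : finite_fun f -> tau W (f * zs k) = toCx lam * tau W (zs k * f).
Proof.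
apply: (tau_ext (phi := fun f => f * zs k) (psi := fun f => zs k * f));
  [exact: mulr_linear | exact: mull_linear
  | by move=> g; exact: finite_funMr | by move=> g; exact: finite_funMl |].
move=> a b; rewrite zs_munit_last munit_zs_last tauZ; last exact: finite_munit.
rewrite !tau_munit.
have [ak|ak] := posnP (a k).
  rewrite ak muln0 subrr mul0r mulr0; case: eqP => // e.
  by move: ak; rewrite e ffunE eqxx addn1.
have -> : (a == inc b k) = (dec a k == b).
  by apply/eqP/eqP => [->|<-]; rewrite ?dec_inc ?inc_dec.
case: ifP => _; last by rewrite !mulr0.
rewrite -{1 2}(inc_dec ak) normN_inc hW ffunE eqxx subn1 prednK // !toCxE; ring.
Qed.

End Last.

End WeightedTraces.

(** * Distributions as limits of finite functions *)

Section PointwiseTopology.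
Variables (I : Type) (V : topologicalType).

Lemma ptws_cvg (F : set_system {ptws I -> V}) (f : {ptws I -> V}) : Filter F ->
  (forall i, (fun g : {ptws I -> V} => g i) @ F --> f i) -> F --> f.
Proof.
move=> FF h; apply/cvg_sup => i A /=.
move=> [B [[C oC <-] Cf sBA]].
by apply: filterS sBA _; apply: (h i); apply: open_nbhs_nbhs; split.
Qed.

Lemma ptws_continuous (T : topologicalType) (G : T -> {ptws I -> V}) :
  (forall i, continuous (fun t => G t i)) -> continuous G.
Proof. by move=> h t; apply: ptws_cvg => i; exact: h. Qed.

End PointwiseTopology.

Lemma ptws_eval_continuous (I : eqType) (V : topologicalType) (i : I) :
  continuous (fun g : {ptws I -> V} => g i).
Proof. exact: (@proj_continuous I (fun=> V) i). Qed.

Lemma mulc_continuous (R : realType) (T : topologicalType) (x : Cx R) (G : T -> Cx R) :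
  continuous G -> continuous (fun t => x * G t).
Proof. by move=> c t; exact: (@cvgMr _ _ _ _ _ _ _ (c t)). Qed.

Lemma lin_continuous (R : realType) (T : topologicalType) (x : Cx R) (G1 G2 : T -> Cx R) :
  continuous G1 -> continuous G2 -> continuous (fun t => x * G1 t + G2 t).
Proof.
move=> c1 c2 t; have h1 : (fun t => x * G1 t) @ t --> x * G1 t.
  exact: mulc_continuous.
exact: (@cvgD _ _ _ _ _ _ _ _ _ h1 (c2 t)).
Qed.

Section Density.
Variables (R : realType) (n : nat) (q : R).
Hypotheses (hq0 : 0 < q) (hq1 : q < 1).

Variable H : fock_rep n q.
Notation C := (Cx R).
Notation Fq := (Fq n q).
Notation munit := (munit q).
Notation coeff := (@coeff R n q H).
Implicit Types (f g : Fq) (a b c m : midx n) (psi : distr R n).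

Definition mpt_inv (x : Dix n * Pn n) : midx n * midx n :=
  (madd (val x.1).1 (untail (val x.2)), madd (val x.1).2 (untail (val x.2))).

Lemma mpt_invK x : mpt (mpt_inv x).1 (mpt_inv x).2 = x.
Proof.
case: x => ij k; rewrite mpt_madd /=; congr (_, _).
by apply/val_inj; rewrite /= untailK //; exact: valP.
Qed.

Lemma mptK a b : mpt_inv (mpt a b) = (a, b).
Proof.
by have [e1 e2] := mpt_inj (mpt_invK (mpt a b)); rewrite [LHS]surjective_pairing e1 e2.
Qed.

(** The finite function whose coefficients agree with those of the distribution
    at the first N points of an enumeration of the countable index set. *)
Definition truncation psi (N : nat) : Fq :=
  \sum_(i < N) if pickle_inv i is Some x then
    (psi x / mscale q (mpt_inv x).1 (mpt_inv x).2) *: munit (mpt_inv x).1 (mpt_inv x).2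
  else 0.

Lemma truncation_finite psi N : finite_fun (truncation psi N).
Proof.
rewrite /truncation; elim/big_rec: _ => [|i f _ hf]; first exact: finite_fun0.
apply: finite_funD => //; case: pickle_inv => [x|]; last exact: finite_fun0.
by apply: finite_funZ; exact: finite_munit.
Qed.

Lemma coeff_truncation psi N x : (pickle x < N)%N ->
  coeff (truncation psi N) x = psi x.
Proof.
have eqx (i : nat) : pickle_inv i = Some x -> i = pickle x.
  by move=> e; have := @pickle_invK (Dix n * Pn n)%type i; rewrite e.
(* The sum of the contributions at x: only the term of index pickle x is not
   zero. *)
pose t M := \sum_(i < M) if @pickle_inv (Dix n * Pn n)%type i is Some y then
  if y == x then psi x else 0 else 0.
have -> : coeff (truncation psi N) x = t N.
  rewrite /t; elim: N => [|N IH].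
    by rewrite /truncation !big_ord0 (coeff0 hq0 hq1).
  rewrite /truncation !big_ord_recr /= addrC -/(truncation psi N) -IH.
  case: (pickle_inv N) => [y|]; last by rewrite add0r addr0.
  rewrite (coeff_lin hq0 hq1 _ _ (finite_munit q _ _) (truncation_finite _ _)).
  rewrite (coeff_munit hq0 hq1) mpt_invK.
  set s := mscale _ _ _; set d := coeff _.
  change (psi y / s * (s * (x == y)%:R) + d x = d x + (if y == x then psi x else 0)).
  rewrite addrC; congr (_ + _); rewrite eq_sym; case: eqP => [->|_].
    by rewrite mulr1 divfK // mscale_neq0.
  by rewrite !mulr0.
move=> xN; rewrite /t (bigD1 (Ordinal xN)) //= pickleK_inv eqxx big1 ?addr0 // => i.
case e : (pickle_inv i) => [y|] //; case: (eqVneq y x) => // yx ix.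
by case/eqP: ix; apply/val_inj; rewrite /= (eqx i) // e yx.
Qed.

Lemma truncation_cvg psi :
  (fun N => coeff (truncation psi N) : distr R n) @ \oo --> psi.
Proof.
apply: ptws_cvg => x.
have h : (fun N => coeff (truncation psi N) x) @ \oo --> psi x; last exact: h.
apply: cvg_near_cst; near=> N; apply: coeff_truncation; near: N; exact: nbhs_infty_gt.
Unshelve. all: by end_near. Qed.

(** Every distribution is the limit of its truncations, hence the finite
    functions are dense. *)
Lemma ext_unique (T : topologicalType) (G G' : distr R n -> T) :
  hausdorff_space T -> continuous G -> continuous G' ->
  (forall f, finite_fun f -> G (coeff f) = G' (coeff f)) -> G = G'.
Proof.
move=> hT cG cG' h; apply/funext => psi.
have c1 : (fun N => G (coeff (truncation psi N))) @ \oo --> G psi.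
  exact: (cvg_comp _ _ (@truncation_cvg psi) (cG psi)).
have c2 : (fun N => G (coeff (truncation psi N))) @ \oo --> G' psi.
  rewrite (_ : (fun N => _) = (fun N => G' (coeff (truncation psi N)))).
    by have h1 := cvg_comp _ _ (@truncation_cvg psi) (cG' psi); exact: h1.
  by apply/funext => N; apply: h; exact: truncation_finite.
exact: (cvg_unique hT c1 c2).
Qed.

(** The chosen continuous extension is the one at hand, by density. *)
Lemma cont_extE (T : topologicalType) (t0 : T) (u : Fq -> T) (G : distr R n -> T) :
  hausdorff_space T -> continuous G ->
  (forall f, finite_fun f -> G (coeff f) = u f) -> cont_ext H t0 u = G.
Proof.
move=> hT cG h; rewrite /cont_ext; case: xgetP => [G' _ [cG' h']|/(_ G)]; last by case.
by apply: ext_unique => // f hf; rewrite h // h'.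
Qed.

Lemma C_hausdorff : hausdorff_space C.
Proof. exact: norm_hausdorff. Qed.

Lemma distr_hausdorff : hausdorff_space (distr R n).
Proof.
by apply: (@hausdorff_product (Dix n * Pn n)%type (fun=> C)) => x; exact: C_hausdorff.
Qed.

End Density.

(** * The invariant integral and its pairing with distributions *)

Section Pairing.
Variables (R : realType) (n : nat) (q : R).
Hypotheses (hq0 : 0 < q) (hq1 : q < 1).
Variable act : module_algebra n q.
Variable H : fock_rep n q.
Notation C := (Cx R).
Notation Fq := (Fq n q).
Notation z := (z q).
Notation zs := (zs q).
Notation Q := (toCx q).
Notation Ucls := (cls (Urel q)).
Notation munit := (munit q).
Notation coeff := (@coeff R n q H).
Notation aE k := (act (Ucls (tE k))).
Notation aF k := (act (Ucls (tF k))).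
Notation aK k := (act (Ucls (tK k))).
Notation aKi k := (act (Ucls (tKinv k))).
Notation tau := (tau H).
Notation int_nu := (int_nu H).
Notation pairing := (pairing H).
Implicit Types (f g : Fq) (a b c m : midx n) (k l : 'I_n) (psi : distr R n).

Lemma nu_weightE m : nu_weight q m = wprod (q ^- (2 * n)) (q ^+ 2) m.
Proof.
by rewrite /nu_weight /wprod; apply: eq_bigr => j _; case: ifP => _; rewrite ?exprVn -exprM.
Qed.

Lemma nu_weight_gt0 m : 0 < nu_weight q m.
Proof.
apply: prodr_gt0 => j _; case: ifP => _; last exact: exprn_gt0.
by rewrite invr_gt0 exprn_gt0.
Qed.

Lemma wprod_next (x : R) k l m : next k l ->
  wprod x (q ^+ 2) (tail (inc m l)) = q ^+ 2 * wprod x (q ^+ 2) (tail (inc m k)).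
Proof. by move=> e; rewrite !wprod_inc e (exprS (q ^+ 2) k); ring. Qed.

Lemma last_exp k : is_last k -> n = k.+1. Proof. by move/eqP. Qed.

(** The weight q^(-2n) of k_1 is the one for which raising m_n changes the
    weight by q^(-2n) q^(2(n-1)) = q^(-2); this is the factor required for
    invariance under E_n and F_n. *)
Lemma nu_weight_last k m : is_last k ->
  nu_weight q (tail (inc m k)) = q ^- 2 * nu_weight q (tail m).
Proof.
move=> kl; rewrite !nu_weightE wprod_inc mulrC; congr (_ * _).
have -> : (2 * n = 2 + 2 * k)%N by move: (last_exp kl); lia.
rewrite -exprM exprD invfM -mulrA mulVf ?mulr1 //.
by rewrite expf_neq0 // gt_eqF.
Qed.

Definition nu_const : C := toCx (qpoch (q ^+ 2) (q ^+ 2) n).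

Lemma nu_const_neq0 : nu_const != 0.
Proof.
rewrite toCx_eq0 gt_eqF // qpoch_gt0 ?q2_itv //.
by have /andP[-> /ltW] := q2_itv hq0 hq1.
Qed.

Lemma int_nuE f : int_nu f = nu_const * tau (nu_weight q) f.
Proof. by []. Qed.

Lemma nu_lin x f g : finite_fun f -> finite_fun g ->
  int_nu (x *: f + g) = x * int_nu f + int_nu g.
Proof. by move=> hf hg; rewrite !int_nuE (tau_lin hq0 hq1) //; ring. Qed.

Lemma nu_K k f : finite_fun f -> int_nu (aK k f) = int_nu f.
Proof. by move=> hf; rewrite !int_nuE (tau_K hq0 hq1). Qed.

Lemma nu_Ki k f : finite_fun f -> int_nu (aKi k f) = int_nu f.
Proof. by move=> hf; rewrite !int_nuE (tau_Ki hq0 hq1). Qed.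

Lemma act_K_cancel k f g : aK k f * g = aK k (f * aKi k g).
Proof. by rewrite act_KM act_KKi. Qed.

Lemma act_Ki_cancel k f g : aKi k f * g = aKi k (f * aK k g).
Proof. by rewrite act_KiM act_KiK. Qed.

(** For k < n this is the invariance of weighted traces. For the last index E_n
    is an inner twisted derivation, so its integral is a difference of two
    terms, equal because exchanging z_n costs q^(-2) and K_n preserves the
    integral. *)
Lemma nu_E k f : finite_fun f -> int_nu (aE k f) = 0.
Proof.
move=> hf; rewrite int_nuE; case: (boolP (is_last k)) => kl; last first.
  have [l e] := nlast_next kl; rewrite (tau_E hq0 hq1 act H e) ?mulr0 // => m.
  by rewrite !nu_weightE; exact: wprod_next.
have hK : aK k f * z k = Q ^- 2 *: aK k (f * z k).
  by rewrite act_K_cancel act_Ki_z // /zweight kl eqxx scale_mulr act_scale.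
have fz : finite_fun (f * z k) by exact: finite_funMr.
have fK : finite_fun (aK k (f * z k)) by exact: finite_act.
rewrite (act_En_inner hq0 hq1) // hK (tauZ hq0 hq1); last first.
  rewrite -scaleNr addrC; apply: finite_fun_lin => //; exact: finite_funMl.
rewrite (tauB hq0 hq1) ?(tauZ hq0 hq1) //; [|exact: finite_funMl|exact: finite_funZ].
rewrite (tau_K hq0 hq1) // (tau_z_last hq0 hq1 H kl (fun m => nu_weight_last m kl)) //.
by rewrite toCxV toCxX subrr !mulr0.
Qed.

Lemma nu_F k f : finite_fun f -> int_nu (aF k f) = 0.
Proof.
move=> hf; rewrite int_nuE; case: (boolP (is_last k)) => kl; last first.
  have [l e] := nlast_next kl; rewrite (tau_F hq0 hq1 act H e) ?mulr0 // => m.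
  by rewrite !nu_weightE; exact: wprod_next.
have hK : zs k * aKi k f = Q ^- 2 *: aKi k (zs k * f).
  rewrite act_KiM act_Ki_zs /zweight kl eqxx scale_mull scalerA mulVf ?scale1r //.
  by rewrite expf_neq0 // Q_neq0.
have fz : finite_fun (zs k * f) by exact: finite_funMl.
have fK : finite_fun (aKi k (zs k * f)) by exact: finite_act.
rewrite (act_Fn_inner hq0 hq1) // hK (tauZ hq0 hq1); last first.
  by rewrite -scaleN1r addrC; apply: finite_fun_lin; [exact: finite_funMr | exact: finite_funZ].
rewrite (tauB hq0 hq1) ?(tauZ hq0 hq1) //; [|exact: finite_funZ|exact: finite_funMr].
rewrite (tau_Ki hq0 hq1) // (tau_zs_last hq0 hq1 H kl (fun m => nu_weight_last m kl)) //.
by rewrite toCxV toCxX subrr !mulr0.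
Qed.

(** For E and F the twisted Leibniz rule turns the left side into the integral
    of E (f g) or F (f g), which vanishes, minus a term that becomes the right
    side by invariance under K. Products follow since the antipode reverses
    them. *)
Lemma nu_adjoint t f g : finite_fun f -> finite_fun g ->
  int_nu (act (Ucls t) f * g) = int_nu (f * act (Ucls (antipode t)) g).
Proof.
have sub f' g' : finite_fun f' -> finite_fun g' -> int_nu (f' - g') = int_nu f' - int_nu g'.
  by move=> hf hg; rewrite !int_nuE (tauB hq0 hq1) // mulrBr.
elim: t f g => [[k|k|k|k]|x|s IHs u IHu|s IHs u IHu] f g hf hg.
- have -> : act (Ucls (Gen (UE k))) f * g = aE k (f * g) - aK k (f * aKi k (aE k g)).
    by rewrite act_EM act_KM act_KKi addrK.
  have fin : finite_fun (f * aKi k (aE k g)) by exact: finite_funMr.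
  rewrite sub ?nu_E ?nu_K ?sub0r //; try (apply: finite_act); try exact: finite_funMr.
  rewrite /antipode /= !actM act_cst scaleN1r mulrN.
  by rewrite -[in RHS]scaleN1r !int_nuE (tauZ hq0 hq1) // mulN1r mulrN.
- have -> : act (Ucls (Gen (UF k))) f * g = aF k (f * aK k g) - f * aF k (aK k g).
    by rewrite act_FM act_KiK addrK.
  have fin : finite_fun (f * aF k (aK k g)) by exact: finite_funMr.
  rewrite sub ?nu_F ?sub0r //; try (apply: finite_act); try exact: finite_funMr.
  rewrite /antipode /= !actM act_cst scaleN1r mulrN.
  by rewrite -[in RHS]scaleN1r !int_nuE (tauZ hq0 hq1) // mulN1r mulrN.
- by rewrite act_K_cancel nu_K //; exact: finite_funMr.
- by rewrite act_Ki_cancel nu_Ki //; exact: finite_funMr.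
- by rewrite /antipode /= !act_cst scale_mull scale_mulr.
- have fsg : finite_fun (act (Ucls s) f * g) by exact: finite_funMl.
  have fug : finite_fun (act (Ucls u) f * g) by exact: finite_funMl.
  rewrite /antipode /= !actD mulrDl mulrDr -[X in int_nu (X + _)]scale1r nu_lin //.
  rewrite -[X in _ = int_nu (X + _)]scale1r nu_lin; try exact: finite_funMr.
  by rewrite IHs // IHu.
- rewrite /antipode /= !actM IHs ?IHu //; exact: finite_act.
Qed.

(** The matrix units z^a f0 z^*b are, up to these factors, the basis dual to
    the point masses at the points of z^b f0 z^*a. *)
Definition pair_scale a b : C :=
  nu_const * toCx (normN q a * normN q b * nu_weight q (tail b)) / mscale q b a.

Lemma pair_scale_neq0 a b : pair_scale a b != 0.
Proof.
rewrite !mulf_neq0 ?invr_neq0 ?mscale_neq0 ?nu_const_neq0 // toCx_eq0 gt_eqF //.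
by rewrite !mulr_gt0 ?normN_gt0 ?nu_weight_gt0.
Qed.

Lemma nu_munit f a b : finite_fun f ->
  int_nu (f * munit a b) = pair_scale a b * coeff f (mpt b a).
Proof.
elim/finite_ind => [|x g h hg hh eg eh|a' b'].
- rewrite mul0r (coeff0 hq0 hq1) mulr0 int_nuE (tau0 hq0 hq1) mulr0 //.
- rewrite mulrDl scale_mull nu_lin; try exact: finite_funMr.
  rewrite eg eh (coeff_lin hq0 hq1) //.
  change (x * (pair_scale a b * coeff g (mpt b a)) + pair_scale a b * coeff h (mpt b a) =
    pair_scale a b * (x * coeff g (mpt b a) + coeff h (mpt b a))).
  by ring.
rewrite munitM // int_nuE (tauZ hq0 hq1) ?(tau_munit hq0 hq1); last exact: finite_munit.
rewrite (coeff_munit hq0 hq1).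
change (nu_const * ((if a == b' then toCx (normN q b') else 0) *
  (if a' == b then toCx (normN q a' * nu_weight q (tail a')) else 0)) =
  pair_scale a b * (mscale q a' b' * (mpt b a == mpt a' b')%:R)).
case: (eqVneq a b') => [<-|ab]; last first.
  by case: (mpt b a =P mpt a' b') => [/mpt_inj[_ e]|_]; [case/eqP: ab | rewrite mul0r !mulr0].
case: (eqVneq a' b) => [->|ab]; last first.
  by case: (mpt b a =P mpt a' a) => [/mpt_inj[e _]|_]; [case/eqP: ab | rewrite !mulr0].
rewrite eqxx mulr1 /pair_scale divfK ?mscale_neq0 // -toCxM; congr (_ * toCx _).
by rewrite mulrA.
Qed.

(** On a matrix unit the pairing is a multiple of the evaluation of the
    distribution at a point; hence it is continuous for pointwise convergence.
    *)
Lemma pairing_ext g : finite_fun g ->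
  exists G : distr R n -> C, continuous G /\
    forall f, finite_fun f -> G (coeff f) = int_nu (f * g).
Proof.
elim/finite_ind => [|x g1 g2 h1 h2 [G1 [c1 e1]] [G2 [c2 e2]]|a b].
- exists (fun=> 0); split; first exact: cst_continuous.
  by move=> f hf; rewrite mulr0 int_nuE (tau0 hq0 hq1) mulr0.
- exists (fun psi => x * G1 psi + G2 psi); split.
    exact: (@lin_continuous _ _ x _ _ c1 c2).
  move=> f hf; rewrite e1 // e2 // mulrDr scale_mulr nu_lin //; exact: finite_funMl.
- exists (fun psi => pair_scale a b * psi (mpt b a)); split.
    exact: (@mulc_continuous _ _ (pair_scale a b) _ (@ptws_eval_continuous (Dix n * Pn n)%type C (mpt b a))).
  by move=> f hf; rewrite nu_munit.
Qed.

Lemma pairing_continuous g : finite_fun g -> continuous (fun psi => pairing psi g).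
Proof.
move=> hg; have [G [cG eG]] := pairing_ext hg.
by rewrite /Defs.pairing (cont_extE hq0 hq1 0 (@C_hausdorff R) cG eG).
Qed.

Lemma pairing_coeff f g : finite_fun f -> finite_fun g ->
  pairing (coeff f) g = int_nu (f * g).
Proof.
move=> hf hg; have [G [cG eG]] := pairing_ext hg.
by rewrite /Defs.pairing (cont_extE hq0 hq1 0 (@C_hausdorff R) cG eG) eG.
Qed.

Lemma pairing_eq (G G' : distr R n -> C) : continuous G -> continuous G' ->
  (forall f, finite_fun f -> G (coeff f) = G' (coeff f)) -> forall psi, G psi = G' psi.
Proof.
by move=> cG cG' h psi; rewrite (ext_unique hq0 hq1 (@C_hausdorff R) cG cG' h).
Qed.

Lemma pairing_munit psi a b : pairing psi (munit a b) = pair_scale a b * psi (mpt b a).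
Proof.
apply: (pairing_eq (G := fun psi => pairing psi (munit a b))
  (G' := fun psi => pair_scale a b * psi (mpt b a))).
- by apply: pairing_continuous; exact: finite_munit.
- exact: (@mulc_continuous _ _ (pair_scale a b) _ (@ptws_eval_continuous (Dix n * Pn n)%type C (mpt b a))).
- move=> f hf; rewrite pairing_coeff //; [exact: nu_munit | exact: finite_munit].
Qed.

Lemma pairing_lin psi x f g : finite_fun f -> finite_fun g ->
  pairing psi (x *: f + g) = x * pairing psi f + pairing psi g.
Proof.
move=> hf hg; apply: (pairing_eq (G := fun psi => pairing psi (x *: f + g))
  (G' := fun psi => x * pairing psi f + pairing psi g)).
- by apply: pairing_continuous; exact: finite_fun_lin.
- exact: (@lin_continuous _ _ x _ _ (pairing_continuous hf) (pairing_continuous hg)).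
- move=> h hh; rewrite !pairing_coeff //; last exact: finite_fun_lin.
  by rewrite mulrDr scale_mulr nu_lin //; exact: finite_funMl.
Qed.

(** The action on distributions is the transpose of the antipode. This also
    shows that the continuous extension of the action exists: evaluating the
    transposed action at the matrix units defines a continuous map that agrees
    with the action on finite functions, by invariance of the integral. *)
Lemma pairing_act t psi f : finite_fun f ->
  pairing (act_distr H act (Ucls t) psi) f = pairing psi (act (Ucls (antipode t)) f).
Proof.
move=> hf.
pose G psi : distr R n := fun x =>
  (pair_scale (mpt_inv x).2 (mpt_inv x).1)^-1 *
  pairing psi (act (Ucls (antipode t)) (munit (mpt_inv x).2 (mpt_inv x).1)).
have cG : continuous G.
  apply: ptws_continuous => x; apply: mulc_continuous.
  by apply: pairing_continuous; apply: finite_act; exact: finite_munit.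
have eG g : finite_fun g -> G (coeff g) = coeff (act (Ucls t) g).
  move=> hg; apply/funext => x; rewrite /G pairing_coeff //; last first.
    by apply: finite_act; exact: finite_munit.
  rewrite -nu_adjoint // ?nu_munit //; [|exact: finite_act|exact: finite_munit].
  by rewrite mpt_invK mulKf // pair_scale_neq0.
rewrite /act_distr (cont_extE hq0 hq1 _ (@distr_hausdorff R n) cG eG).
apply: (pairing_eq (G := fun psi => pairing (G psi) f)
  (G' := fun psi => pairing psi (act (Ucls (antipode t)) f))).
- by move=> phi; apply: (cvg_comp _ _ (@cG phi)); exact: pairing_continuous.
- by apply: pairing_continuous; exact: finite_act.
- move=> g hg; rewrite eG // !pairing_coeff //; [|exact: finite_act|exact: finite_act].
  exact: nu_adjoint.
Qed.

End Pairing.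

(** * Limits and the q-binomial series *)

Section Limits.
Variable R : realType.

Lemma toCx_lt (x y : R) : (toCx x < toCx y) = (x < y).
Proof. by rewrite /toCx ltcR. Qed.

Lemma toCx_cvg (u : nat -> R) (l : R) :
  u @ \oo --> l -> (fun N => toCx (u N)) @ \oo --> toCx l.
Proof.
move=> /cvgrPdist_lt h; apply/cvgrPdist_lt => e e0.
(* A positive complex number is real. *)
have ee : e = toCx (complex.Re e).
  by move: e0; case: e => a b; rewrite ltcE /= => /andP[/eqP -> _].
have e0' : 0 < complex.Re e by move: e0; rewrite ee -toCx0 toCx_lt.
near=> N; rewrite -toCxB toCx_norm ee toCx_lt.
by near: N; exact: h.
Unshelve. all: by end_near. Qed.

Lemma sum_subset (T : eqType) (s t : seq T) (F : T -> R) : uniq s -> uniq t ->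
  {subset s <= t} -> (forall x, 0 <= F x) -> \sum_(x <- s) F x <= \sum_(x <- t) F x.
Proof.
move=> us ut st F0; rewrite [leRHS](bigID (mem s)) /=.
have -> : \sum_(x <- t | x \in s) F x = \sum_(x <- s) F x.
  rewrite -big_filter; apply: perm_big; apply: uniq_perm; rewrite ?filter_uniq // => x.
  by rewrite mem_filter andb_idr //; exact: st.
by rewrite lerDl sumr_ge0.
Qed.

Lemma prod_cvg (I : Type) (s : seq I) (u : I -> nat -> R) (l : I -> R) :
  (forall i, u i @ \oo --> l i) ->
  (fun N => \prod_(i <- s) u i N) @ \oo --> \prod_(i <- s) l i.
Proof.
move=> h; elim: s => [|i s IH].
  under eq_fun do rewrite big_nil.
  by rewrite big_nil; exact: cvg_cst.
under eq_fun do rewrite big_cons.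
by rewrite big_cons; apply: cvgM => //; exact: h.
Qed.

Lemma divn_cvg n : (0 < n)%N -> (fun N : nat => (N %/ n)%N) @ \oo --> \oo.
Proof.
move=> n0 A [M _ hM]; exists (M * n)%N => // N /= MN; apply: hM => /=.
by rewrite leq_divRL.
Qed.

End Limits.

Section QBinomialSeries.
Variables (R : realType) (r : R).
Hypotheses (r0 : 0 < r) (r1 : r < 1).

Definition qratio (m p : nat) : R := qpoch r r (m + p) / qpoch r r p.

Lemma qpoch_rr_gt0 m : 0 < qpoch r r m.
Proof. by apply: qpoch_gt0; rewrite ?(ltW r0) ?r1 // ltW. Qed.

Lemma qratio_ge0 m p : 0 <= qratio m p.
Proof. by rewrite divr_ge0 // ltW // qpoch_rr_gt0. Qed.

Lemma qpochD (a : R) p s : qpoch a r (p + s) = qpoch a r p * qpoch (a * r ^+ p) r s.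
Proof.
elim: s => [|s IH]; first by rewrite addn0 qpoch0 mulr1.
by rewrite addnS !qpochS IH exprD !mulrA.
Qed.

(** The sum of (r;r)_(m+p) / (r;r)_p x^p over p is (r;r)_m / (x;r)_(m+1). The
    induction on m rests on (r;r)_(m+1+p) = (r;r)_(m+p) (1 - r^(m+1) r^p),
    which expresses the series for m + 1 through those for m at x and at r x.
    *)
Lemma qbinomial_series m (x : R) : 0 <= x < 1 ->
  (fun N => \sum_(p < N) qratio m p * x ^+ p) @ \oo --> qpoch r r m / qpoch x r m.+1.
Proof.
elim: m x => [|m IH] x /andP[x0 x1].
  rewrite qpochS !qpoch0 expr0 mulr1 !mul1r.
  have h : series (geometric 1 x) @ \oo --> 1 * (1 - x)^-1.
    by apply: cvg_geometric_series; rewrite ger0_norm.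
  rewrite mul1r in h; apply: cvg_trans h; apply: near_eq_cvg; near=> N.
  rewrite /series /= big_mkord; apply: eq_bigr => p _.
  by rewrite /qratio add0n divff // gt_eqF // qpoch_rr_gt0.
have rx : 0 <= r * x < 1.
  apply/andP; split; first by rewrite mulr_ge0 // ltW.
  by apply: le_lt_trans r1; rewrite ler_piMr // ltW.
have x01 : 0 <= x < 1 by rewrite x0.
have hq (y : R) k : 0 <= y < 1 -> qpoch y r k != 0.
  by move=> hy; rewrite gt_eqF // qpoch_gt0 // !ltW.
have -> : qpoch r r m.+1 / qpoch x r m.+2 =
    qpoch r r m / qpoch x r m.+1 + - (r ^+ m.+1) * (qpoch r r m / qpoch (r * x) r m.+1).
  have e1 : qpoch x r m.+2 = qpoch x r m.+1 * (1 - x * r ^+ m.+1) by rewrite qpochS.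
  have e2 : qpoch x r m.+2 = (1 - x) * qpoch (r * x) r m.+1.
    by rewrite -[m.+2]add1n qpochD qpochS qpoch0 expr0 mulr1 mul1r expr1 mulrC [r * x]mulrC mulrC.
  have h2 := hq x m.+2 x01; have h1 := hq x m.+1 x01; have h3 := hq _ m.+1 rx.
  have hx : 1 - x != 0 by rewrite subr_eq0 gt_eqF.
  have hr : 1 - x * r ^+ m.+1 != 0 by move: h2; rewrite e1 mulf_eq0 negb_or => /andP[].
  have -> : qpoch (r * x) r m.+1 = qpoch x r m.+1 * (1 - x * r ^+ m.+1) / (1 - x).
    by rewrite -e1 e2 [RHS]mulrC mulKf.
  rewrite e1 qpochS -exprS; move: (qpoch x r _) (qpoch r r m) (r ^+ _) h1 hr => A B D h1 hr.
  by field; rewrite hx h1 hr.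
apply: (@cvg_trans _ ((fun N => \sum_(p < N) qratio m p * x ^+ p +
   - (r ^+ m.+1) * (\sum_(p < N) qratio m p * (r * x) ^+ p)) @ \oo)).
  apply: near_eq_cvg; near=> N; rewrite mulr_sumr -big_split; apply: eq_bigr => p _ /=.
  rewrite /qratio addSn qpochS -exprS exprMn -[(m + p).+1]addSn exprD; ring.
apply: cvgD; first exact: IH.
by apply: cvgMr; exact: IH.
Unshelve. all: by end_near. Qed.

End QBinomialSeries.

(** * Norms of the monomials in the weighted Bergman space *)

Section BergmanNorm.
Variables (R : realType) (n : nat) (q : R).
Hypotheses (hq0 : 0 < q) (hq1 : q < 1).
Variable H : fock_rep n q.
Notation C := (Cx R).
Notation Fq := (Fq n q).
Notation zmon := (zmon q).
Notation zsmon := (zsmon q).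
Notation Q := (toCx q).
Notation tau := (tau H).
Variable alpha : R.
Notation r := (q ^+ 2).
Notation X := (q `^ (2 * alpha + 2)).
Notation int_m := (int_m H alpha).
Implicit Types (f g : Fq) (a b c m : midx n) (k l : 'I_n).

Lemma r_itv : 0 <= r < 1. Proof. exact: q2_itv. Qed.
Lemma r_gt0 : 0 < r. Proof. exact: exprn_gt0. Qed.
Lemma r_lt1 : r < 1. Proof. by have /andP[] := r_itv. Qed.

Lemma X_gt0 : 0 < X. Proof. exact: powR_gt0. Qed.

(** This bound makes the series that define the integral converge. *)
Lemma X_lt1 : 0 < alpha -> X < 1.
Proof.
move=> halpha.
rewrite /powR gt_eqF // expR_lt1 pmulr_rlt0; last by have := halpha; lra.
by rewrite ln_lt0 // hq0.
Qed.

Lemma m_weightE m : m_weight q alpha m = wprod X r m.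
Proof.
rewrite /m_weight /wprod; apply: eq_bigr => j _; case: ifP => _; last by rewrite exprM.
have -> : 2 * (m j)%:R * (alpha + 1) = (2 * alpha + 2) * (m j)%:R by ring.
by rewrite powRrM powR_mulrn // ltW // X_gt0.
Qed.

Lemma m_weight_last k m : is_last k ->
  m_weight q alpha (tail (inc m k)) = X * r ^+ k * m_weight q alpha (tail m).
Proof. by move=> kl; rewrite !m_weightE wprod_inc mulrC. Qed.

Definition m_const : C := toCx (qpoch X r n).

(** For a finite function the exhausting sums are eventually constant. *)
Lemma int_m_finite f : finite_fun f -> int_m f = m_const * tau (m_weight q alpha) f.
Proof.
move=> hf; rewrite /Defs.int_m; congr (_ * _).
have [s us hs] := fin_supp_seq (tau_fin hq0 hq1 H (m_weight q alpha) hf).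
apply: cvg_lim; first exact: norm_hausdorff.
(* A crude bound for all the entries of the partitions in the support. *)
pose M := (\sum_(k <- s) \sum_(j < n) val k j)%N.
apply: cvg_near_cst; near=> N.
have MN : (M < N)%N by near: N; exact: nbhs_infty_gt.
rewrite !tauE; apply: fsbig_widen => // k [_ /= hk]; apply: contrapT => h0; apply: hk => j.
have ks : k \in s by apply/negPn/negP => /hs; exact: h0.
apply: leq_ltn_trans MN; rewrite /M (big_rem k) //= (bigD1 j) //= -addnA.
exact: leq_addr.
Unshelve. all: by end_near. Qed.

Definition gram_point (m k : midx n) : Dix n :=
  exist (fun p : midx n * midx n => disj_pair p) _ (disj_msub k m).

(** z^*m z^k shifts the basis in one direction only. Its coefficient of
    bidegree zero vanishes unless m = k, and then it is the diagonal matrix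
    entry. *)
Lemma coeff_zszm m (k : midx n) : exists2 psi : distr R n, is_coeff H (zsmon m * zmon k) psi &
  forall c, psi (Dix0, ptail c) = if m == k then
    toCx (r ^+ cross m c * normN q (madd m c) / normN q c) else 0.
Proof.
pose d := meet k m; pose i := msub k d; pose j := msub m d.
have ki : k = madd i d by rewrite maddC msubK ?meet_mlel.
have mj : m = madd j d by rewrite maddC msubK ?meet_mler.
pose ij := gram_point m k.
have e1 : (val ij).1 = i by [].
have e2 : (val ij).2 = j by [].
pose g c := Q ^+ cross k (madd j c) * (Q ^+ cross m (madd i c) *
  toCx (normN q (madd m (madd i c)) / normN q (madd i c))).
exists (fun x => if x.1 == ij then
    g (untail (val x.2)) / term_scale q ij (untail (val x.2)) else 0).
  apply: (@is_coeff_homog _ _ _ hq0 hq1 _ _ ij g).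
  - move=> c; rewrite e1 e2 fock_mul fock_zmon fockZ.
    have -> : madd k (madd j c) = madd m (madd i c).
      by rewrite ki mj; apply/ffunP => l; rewrite !ffunE; lia.
    by rewrite fock_zsmon // scalerA.
  - move=> b; rewrite e2 => nle; rewrite fock_mul fock_zmon fockZ fock_zsmon_eq0 ?scaler0 //.
    apply: contra nle => /mleP h; apply/mleP => l; have := h l.
    by rewrite /j /d !ffunE; lia.
  - move=> c /=; rewrite eqxx tailK mulrC divfK //; exact: term_scale_neq0.
  - by move=> ij' p /= /negbTE ->.
move=> c /=; rewrite tailK; case: (eqVneq m k) => [mk|mk]; last first.
  case: eqP => // e0; case/eqP: mk.
  have i0 : i = midx0 by rewrite -e1 -e0.
  have j0 : j = midx0 by rewrite -e2 -e0.
  by rewrite ki mj i0 j0.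
have i0 : i = midx0.
  by apply/ffunP => l; rewrite /i /d -mk !ffunE minnn subnn.
have j0 : j = midx0.
  by apply/ffunP => l; rewrite /j /d -mk !ffunE minnn subnn.
have ij0 : Dix0 = ij by apply/val_inj; rewrite /= -/d -/i -/j i0 j0.
rewrite {1}ij0 eqxx -ij0 /term_scale /= /g i0 j0 !madd0 -mk !cross0 !expr0.
rewrite divff ?gt_eqF ?normN_gt0 // toCx1 !mulr1 divr1 !toCxM !toCxX.
by rewrite mulrA -exprD addnn -mul2n exprM !mulrA.
Qed.

Hypotheses (hn : (0 < n)%N) (halpha : 0 < alpha).

Definition below m (p : nat) : nat := (\sum_(j < n | (j < p)%N) m j)%N.

(** The ratio of the geometric factor of the series in the l-th direction. The
    shift by the entries of m below l comes from sorting z^*m z^m, the shift by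
    l from the weights. *)
Definition sbase m l : R := X * r ^+ (l + below m l).

Definition sterm m l (p : nat) : R := qratio r (m l) p * sbase m l ^+ p.

Lemma cross_incr m c l : cross m (inc c l) = (cross m c + below m l)%N.
Proof.
rewrite /cross /below; under eq_bigr do rewrite above_inc mulnDr.
rewrite big_split /=; congr (_ + _)%N; rewrite [RHS]big_mkcond /=.
by apply: eq_bigr => j _; case: ltnP => _; rewrite ?muln1 ?muln0.
Qed.

Lemma qpoch_r_neq0 p : qpoch r r p != 0.
Proof. by rewrite gt_eqF // qpoch_rr_gt0 // ?r_gt0 // r_lt1. Qed.

Lemma tail0 : tail (midx0 : midx n) = midx0.
Proof. by apply/ffunP => j; rewrite !ffunE big1 // => i _; rewrite ffunE. Qed.

Lemma r_exp p : q ^+ (2 * p) = r ^+ p. Proof. exact: exprM. Qed.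

Lemma oneBr_neq0 p : 1 - r ^+ p.+1 != 0.
Proof.
rewrite subr_eq0 eq_sym lt_eqF // exprn_ilt1 //; last exact: r_lt1.
exact/ltW/r_gt0.
Qed.

Lemma sterm_succ m l p : sterm m l p.+1 =
  sterm m l p * (sbase m l * (1 - r ^+ (m l + p).+1) / (1 - r ^+ p.+1)).
Proof.
rewrite /sterm /qratio addnS !qpochS -!(exprS r) (exprS (sbase m l) p).
have h1 := qpoch_r_neq0 p; have h2 := oneBr_neq0 p.
move: (qpoch _ _ _) (qpoch _ _ _) (r ^+ _) (r ^+ _) (sbase m l ^+ p) (sbase m l) h1 h2 => A B D E F G h1 h2.
by field; rewrite h1 h2.
Qed.

(** The terms of the multiple series for the square norm of z^m factor over the
    n directions, each factor being a term of a q-binomial series. *)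
Lemma gram_product m c :
  r ^+ cross m c * normN q (madd m c) / normN q c * wprod X r (tail c) =
  \prod_(l < n) sterm m l (c l).
Proof.
elim/midx_ind: c => [|c k _ IH].
  have -> : cross m midx0 = 0%N.
    by rewrite /cross big1 // => j _; rewrite /above big1 ?muln0 // => i _; rewrite ffunE.
  have -> : wprod X r (tail (midx0 : midx n)) = 1.
    by rewrite tail0 /wprod big1 // => j _; rewrite ffunE !expr0 if_same.
  rewrite expr0 mul1r mulr1 /normN -prodfV -big_split /=; apply: eq_bigr => l _.
  by rewrite /sterm /qratio !ffunE addn0 expr0 mulr1.
have -> : \prod_(l < n) sterm m l (inc c k l) = (\prod_(l < n) sterm m l (c l)) *
    (sbase m k * (1 - r ^+ (m k + c k).+1) / (1 - r ^+ (c k).+1)).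
  rewrite (bigD1 k) // [in RHS](bigD1 k) //= ffunE eqxx addn1 sterm_succ.
  rewrite [RHS]mulrAC; congr (_ * _); apply: eq_bigr => i /negbTE ik.
  by rewrite ffunE ik addn0.
rewrite -IH maddC madd_incl maddC !normN_inc wprod_inc cross_incr !r_exp ffunE.
rewrite /sbase exprD [r ^+ (k + _)]exprD.
have h := oneBr_neq0 (c k); have hN : normN q c != 0 by rewrite gt_eqF // normN_gt0.
move: (normN q c) (normN q _) (wprod _ _ _) h hN => A B D h hN.
move: (r ^+ (c k).+1) (r ^+ (m k + c k).+1) (r ^+ below _ _) (r ^+ cross _ _) (r ^+ k) h => a b d e f h.
by move: X => x; field; rewrite h hN.
Qed.

Definition box (N : nat) : seq (midx n) :=
  [seq [ffun j => nat_of_ord (f j)] | f : {ffun 'I_n -> 'I_N}].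

Lemma mem_box N c : (c \in box N) = [forall j, (c j < N)%N].
Proof.
apply/mapP/forallP => [[f _ ->] j|h]; first by rewrite ffunE.
exists [ffun j => Ordinal (h j)]; first by rewrite mem_enum.
by apply/ffunP => j; rewrite !ffunE.
Qed.

Lemma box_uniq N : uniq (box N).
Proof.
rewrite map_inj_uniq ?enum_uniq // => f g /ffunP h; apply/ffunP => j.
by apply/val_inj; have := h j; rewrite !ffunE.
Qed.

Lemma box_sum N (F : 'I_n -> nat -> R) :
  \sum_(c <- box N) \prod_(j < n) F j (c j) = \prod_(j < n) \sum_(p < N) F j p.
Proof.
rewrite bigA_distr_bigA /= /box big_map big_enum /=; apply: eq_bigr => f _.
by apply: eq_bigr => j _; rewrite ffunE.
Qed.

Lemma leq_mdeg c j : (c j <= mdeg c)%N.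
Proof. by rewrite /mdeg (bigD1 j) //= leq_addr. Qed.

(** The exhaustion k_1 < N of the set of partitions is the simplex |c| < N in
    the multi-indices c; it lies between the box of side N / n and the box of
    side N. *)
Lemma mdeg_lt N c : (forall j, (c j < N %/ n)%N) -> (mdeg c < N)%N.
Proof.
move=> h; have [|N0] := posnP (N %/ n)%N.
  by move=> e; have := h (Ordinal hn); rewrite e.
apply: (@leq_trans (mdeg c + n)%N); first by rewrite -addn1 leq_add2l.
apply: leq_trans (leq_divM N n); rewrite /mdeg.
have -> : (\sum_(i < n) c i + n = \sum_(i < n) (c i).+1)%N.
  under [in RHS]eq_bigr do rewrite -addn1.
  by rewrite big_split /= sum1_card card_ord.
apply: (@leq_trans (\sum_(i < n) N %/ n)%N); first exact: leq_sum.
by rewrite sum_nat_const card_ord mulnC.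
Qed.

(** On boxes the multiple series is a product of simple ones; as its terms are
    nonnegative, the sums over simplices are squeezed between sums over boxes.
    *)
Lemma simplex_sum_cvg m :
  (fun N => \sum_(c <- [seq c <- box N | (mdeg c < N)%N]) \prod_(l < n) sterm m l (c l))
   @ \oo --> \prod_(l < n) (qpoch r r (m l) / qpoch (sbase m l) r (m l).+1).
Proof.
have sb0 l : 0 <= sbase m l by rewrite mulr_ge0 ?exprn_ge0 // ltW ?r_gt0 // X_gt0.
have sb1 l : sbase m l < 1.
  apply: le_lt_trans (X_lt1 halpha); apply: ler_piMr; first exact/ltW/X_gt0.
  by apply: exprn_ile1; [exact/ltW/r_gt0 | exact/ltW/r_lt1].
have st0 c : 0 <= \prod_(l < n) sterm m l (c l).
  apply: prodr_ge0 => l _; rewrite mulr_ge0 ?exprn_ge0 //.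
  by apply: qratio_ge0; [exact: r_gt0 | exact: r_lt1].
pose B N := \prod_(l < n) \sum_(p < N) sterm m l p.
have cB : B @ \oo --> \prod_(l < n) (qpoch r r (m l) / qpoch (sbase m l) r (m l).+1).
  apply: prod_cvg => l; apply: qbinomial_series; [exact: r_gt0|exact: r_lt1|].
  by rewrite sb0 sb1.
apply: (@squeeze_cvgr _ _ _ _ (fun N => B (N %/ n)%N) B) => //; last first.
  exact: (cvg_comp _ _ (divn_cvg hn) cB).
near=> N; rewrite /B -!box_sum; apply/andP; split.
  apply: sum_subset; rewrite ?filter_uniq ?box_uniq // => c.
  rewrite mem_filter !mem_box => /forallP h; rewrite mdeg_lt //=.
  by apply/forallP => j; apply: leq_trans (h j) _; exact: leq_div.
apply: sum_subset; rewrite ?filter_uniq ?box_uniq // => c.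
by rewrite mem_filter => /andP[].
Unshelve. all: by end_near. Qed.

Lemma qpoch_X_gt0 p : 0 < qpoch X r p.
Proof.
apply: qpoch_gt0; apply/andP; split; [exact/ltW/X_gt0 | exact: X_lt1 |
  exact/ltW/r_gt0 | exact/ltW/r_lt1].
Qed.

(** The square norm of z^m in the weighted Bergman space. *)
Definition nrm m : R := qpoch X r n * normN q m / qpoch X r (mdeg m + n).

Lemma nrmE m : nrm m = qpoch X r n * normN q m / qpoch X r (mdeg m + n).
Proof. by []. Qed.

(** The ranges of exponents in the successive q-shifted factorials are
    adjacent, so that their product is a single one. *)
Lemma sbase_prod m (p : nat) : (p <= n)%N ->
  \prod_(l < n | (l < p)%N) qpoch (sbase m l) r (m l).+1 = qpoch X r (below m p + p).
Proof.
elim: p => [|p IH] pn.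
  by rewrite big_pred0 // /below big_pred0 // qpoch0.
have e (P : 'I_n -> bool) : (fun l : 'I_n => (l < p.+1)%N && (l != Ordinal pn)) =1
    (fun l : 'I_n => (l < p)%N).
  by move=> l; rewrite ltnS -val_eqE /= andbC -ltn_neqAle.
rewrite (bigD1 (Ordinal pn)) /= ?ltnSn // (eq_bigl _ _ (e xpredT)) IH 1?ltnW //.
rewrite {2}/below (bigD1 (Ordinal pn)) /= ?ltnSn // (eq_bigl _ _ (e xpredT)) -/(below m p).
rewrite mulrC /sbase /= [(p + _)%N]addnC -qpochD; congr (qpoch _ _ _).
by lia.
Qed.

Lemma nrm_limit m : qpoch X r n *
  \prod_(l < n) (qpoch r r (m l) / qpoch (sbase m l) r (m l).+1) = nrm m.
Proof.
rewrite /nrm big_split /= prodfV -mulrA; congr (_ * (_ * _^-1)).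
have -> : mdeg m = below m n by apply: eq_bigl => l; rewrite ltn_ord.
by rewrite -sbase_prod //; apply: eq_bigl => l; rewrite ltn_ord.
Qed.

(** Only for m = k does z^*m z^k have a coefficient of bidegree zero, and then
    the defining limit is that of the multiple series over simplices. *)
Lemma int_m_zszm m (k : midx n) :
  int_m (zsmon m * zmon k) = if m == k then toCx (nrm m) else 0.
Proof.
have [psi hpsi e] := coeff_zszm m k.
rewrite /Defs.int_m (coeffE hq0 hq1 hpsi); case: eqVneq => [mk|mk]; last first.
  rewrite (_ : (fun N => _) = (fun=> 0)).
    by rewrite lim_cst ?mulr0 //; exact: norm_hausdorff.
  apply/funext => N; rewrite fsbig1 // => x _; have [c ->] := ptail_surj x.
  by rewrite e (negbTE mk) mul0r.
rewrite -nrm_limit toCxM; congr (_ * _).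
apply: cvg_lim; first exact: norm_hausdorff.
rewrite (_ : (fun N => _) = (fun N => toCx
  (\sum_(c <- [seq c <- box N | (mdeg c < N)%N]) \prod_(l < n) sterm m l (c l)))).
  by apply: toCx_cvg; exact: simplex_sum_cvg.
apply/funext => N.
rewrite (fsbig_fwiden [seq ptail c | c <- [seq c <- box N | (mdeg c < N)%N]]).
- rewrite big_map rmorph_sum; apply: eq_bigr => c _ /=.
  by rewrite e mk eqxx -mk -toCxM m_weightE // gram_product.
- move=> x /=; have [c ->] := ptail_surj x => h; apply: map_f.
  have cN : (mdeg c < N)%N.
    have := h (Ordinal hn); rewrite /= ffunE /mdeg; congr (_ < _)%N.
  rewrite mem_filter cN mem_box; apply/forallP => j.
  by apply: leq_ltn_trans cN; exact: leq_mdeg.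
- by rewrite map_inj_uniq ?filter_uniq ?box_uniq //; exact: ptail_inj.
- move=> x [/= /mapP[c]]; rewrite mem_filter => /andP[cN _] ->; case => j /=.
  apply: leq_ltn_trans cN; rewrite ffunE /mdeg [leqRHS](bigID (fun l : 'I_n => (j <= l)%N)) /=.
  exact: leq_addr.
Qed.

Lemma nrm_gt0 m : 0 < nrm m.
Proof.
by rewrite divr_gt0 ?mulr_gt0 ?normN_gt0 ?qpoch_X_gt0.
Qed.

(** This ratio of norms makes the matrix entries of E_n and of F_n adjoint to
    each other; it is stated without division. *)
Lemma nrm_inc m k : nrm (inc m k) * (1 - X * r ^+ (mdeg m + n)) =
  nrm m * (1 - q ^+ (2 * (m k).+1)).
Proof.
have h p : qpoch X r p != 0.
  by rewrite gt_eqF // qpoch_X_gt0.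
rewrite /nrm mdeg_inc addSn normN_inc.
have := h (mdeg m + n).+1; have := h (mdeg m + n)%N; rewrite qpochS => h1.
rewrite mulf_eq0 negb_or => /andP[_ h2].
move: (qpoch X r _) (qpoch X r _) (1 - _) (1 - _) (normN q m) h1 h2 => A B D E F h1 h2.
by field; rewrite h1 h2.
Qed.

End BergmanNorm.

(** * The basis of monomials and the Bergman projection *)

(** A linear map carries coordinates to coordinates; it transfers linear
    independence of the z^m e_0 back to the monomials themselves. *)
Lemma fin_comb_map (K : fieldType) (V V' : lmodType K) (I : choiceType)
    (e : I -> V) (e' : I -> V') (phi : V -> V') (c : I -> K) v :
  linear phi -> (forall i, phi (e i) = e' i) -> fin_comb e c v -> fin_comb e' c (phi v).
Proof.
move=> lphi he [fc ->]; split => //.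
have /fin_suppP fs := fc; have [s us hs] := fin_supp_seq fs.
rewrite !(fsum_seq us); try by move=> i /hs ->; rewrite scale0r.
elim: s {us hs} => [|i s IH]; last by rewrite !big_cons lphi IH he.
by rewrite !big_nil (lin0 lphi).
Qed.

Lemma span_fin_comb (K : fieldType) (V : lmodType K) (I : choiceType) (e : I -> V) v :
  span e v -> exists c, fin_comb e c v.
Proof.
move=> hv; apply: (hv (fun v => exists c, fin_comb e c v)) => [|x u w [c [fc ->]] [d [fd ->]]|i].
- exists (fun=> 0); split; last by rewrite fsbig1 // => i _; rewrite scale0r.
  by apply/fin_suppP; exists [::].
- exists (fun i => x * c i + d i); split.
    by apply/fin_suppP/(@fin_supp_lin _ _ K^o); apply/fin_suppP.
  move/fin_suppP: fc => fc; move/fin_suppP: fd => fd.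
  rewrite -fsum_lin; [|exact: fin_supp_scaler..].
  by apply: eq_fsbigr => i _; rewrite scalerDl scalerA.
exists (fun j => (j == i)%:R); split.
  by apply/fin_suppP; apply: (@fin_supp1 _ _ _ i) => j /negbTE ->.
rewrite (fsum_single (i0 := i)) ?eqxx ?scale1r // => j /negbTE ->; exact: scale0r.
Qed.

Section HoloBasis.
Variables (R : realType) (n : nat) (q : R).
Hypotheses (hq0 : 0 < q) (hq1 : q < 1).

Variable H : fock_rep n q.
Notation Fq := (Fq n q).
Notation z := (z q).
Notation zmon := (zmon q).
Notation holo := (holo n q).
Notation hb := (@holo_basis R n q).
Implicit Types (f g : Fq) (a b c m : midx n) (k l : 'I_n) (h : holo).

Lemma z_zmon1 (i : 'I_n) : z i = zmon (inc midx0 i).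
Proof. by rewrite zmon_inc ?zmon0 ?mulr1 // => j _; rewrite ffunE. Qed.

Lemma holomorphic_span f : holomorphic f -> span (@Defs.zmon R n q) f.
Proof.
elim=> {f} [i|x|f g _ hf _ hg|f g _ hf _ hg].
- by rewrite z_zmon1; exact: span_gen.
- by rewrite -zmon0; apply: spanZ; exact: span_gen.
- exact: spanD.
apply: (span_map (mulr_linear g)) hf => m.
apply: (span_map (mull_linear (zmon m))) hg => k.
by rewrite zmon_madd; apply: spanZ; exact: span_gen.
Qed.

Lemma holo_holomorphic h : holomorphic (hval h).
Proof. by have /asboolP := hvalP h. Qed.

Lemma holo_span h : span hb h.
Proof.
have : exists2 h' : holo, span hb h' & hval h' = hval h.
  apply: (holomorphic_span (holo_holomorphic h)
    (P := fun f => exists2 h' : holo, span hb h' & hval h' = f)) => [|x f g [u su <-] [w sw <-]|m].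
  - by exists 0; first exact: span0.
  - by exists (x *: u + w); first exact: span_lin.
  - by exists (hb m); first exact: span_gen.
by move=> [h' sh' /val_inj <-].
Qed.

(** Evaluation at the vacuum sends monomials to the basis of the Fock space, so
    that they are independent. *)
Lemma holo_basis_basis : is_basis hb.
Proof.
move=> h; have [c hc] := span_fin_comb (holo_span h); exists c; split => // d hd.
have lphi : linear (fun h : holo => fock (hval h) (vac H)).
  by move=> x u w; rewrite /= fock_linearl.
have he i : fock (hval (hb i)) (vac H) = fbasis H i by [].
have hc' := fin_comb_map lphi he hc.
have hd' := fin_comb_map lphi he hd.
exact: (fin_comb_uniq (@fbasis_basis _ _ _ H) hc' hd').
Qed.

End HoloBasis.

Section Hilbert.
Variables (R : realType) (n : nat) (q alpha : R) (H : fock_rep n q).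
Variable L : L2_completion H alpha.
Implicit Types u v w : L.

Lemma L2dotZ x u w : L2dot (x *: u) w = x * L2dot u w.
Proof.
have d0 : L2dot (0 : L) w = 0.
  by have := L2dot_linear (-1) (0 : L) 0 w; rewrite scaler0 addr0 mulN1r addNr.
by rewrite -[x *: u]addr0 L2dot_linear d0 addr0.
Qed.

Lemma L2dotD u v w : L2dot (u + v) w = L2dot u w + L2dot v w.
Proof. by rewrite -[u]scale1r L2dot_linear mul1r scale1r. Qed.

Lemma L2dotB u v w : L2dot (u - v) w = L2dot u w - L2dot v w.
Proof. by rewrite L2dotD -scaleN1r L2dotZ mulN1r. Qed.

Lemma L2dot_linr x u v w : L2dot u (x *: v + w) = x^* * L2dot u v + L2dot u w.
Proof. by rewrite L2dot_conj L2dot_linear rmorphD rmorphM /= -!L2dot_conj. Qed.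

Lemma L2dot0r u : L2dot u 0 = 0.
Proof.
by rewrite L2dot_conj -(scale0r (0 : L)) L2dotZ mul0r rmorph0.
Qed.

(** Positivity of the square norm of (v,v) u - (u,v) v. *)
Lemma cauchy_schwarz u v : `|L2dot u v| <= `|u| * `|v|.
Proof.
rewrite -(ler_pXn2r (n := 2)) ?nnegrE ?mulr_ge0 // exprMn !L2dot_norm.
have [->|v0] := eqVneq v 0.
  by rewrite !L2dot0r normr0 expr0n mulr0.
have b0 : 0 < L2dot v v by rewrite -L2dot_norm exprn_gt0 // normr_gt0.
have bR : (L2dot v v)^* = L2dot v v by rewrite -L2dot_conj.
have : 0 <= L2dot (L2dot v v *: u - L2dot u v *: v) (L2dot v v *: u - L2dot u v *: v).
  by rewrite -L2dot_norm exprn_ge0.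
have -> : L2dot (L2dot v v *: u - L2dot u v *: v) (L2dot v v *: u - L2dot u v *: v) =
    L2dot v v * (L2dot u u * L2dot v v - `|L2dot u v| ^+ 2).
  rewrite L2dotB !L2dotZ -[_ - L2dot u v *: v]addrC -scaleNr !L2dot_linr.
  rewrite -[L2dot v v *: u]addr0 !L2dot_linr !L2dot0r !addr0 rmorphN bR normCK.
  by rewrite [L2dot v u]L2dot_conj; ring.
by rewrite pmulr_rge0 // subr_ge0.
Qed.

(** By the Cauchy-Schwarz inequality, vectors orthogonal to a set are
    orthogonal to its closure: projections onto the Bergman space may be tested
    against monomials. *)
Lemma orth_closure (A : set L) u : (forall w, A w -> L2dot u w = 0) ->
  forall w, closure A w -> L2dot u w = 0.
Proof.
move=> hA w cw; apply/eqP; rewrite -normr_eq0; apply/eqP/le_anti.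
rewrite normr_ge0 andbT; apply/ler_addgt0Pr => e e0; rewrite add0r.
have e1 : 0 < e / (`|u| + 1) by rewrite divr_gt0 // ltr_wpDl.
have [v [Av /= vw]] := cw _ (nbhsx_ballx w _ e1).
have -> : L2dot u w = L2dot u (w - v).
  by rewrite addrC -scaleN1r L2dot_linr (hA _ Av) mulr0 add0r.
apply: le_trans (cauchy_schwarz _ _) _.
move: vw; rewrite -ball_normE /= => /ltW vw.
apply: le_trans (ler_wpM2l (normr_ge0 u) vw) _.
rewrite mulrCA; apply: ler_piMr; first exact: ltW.
by rewrite ler_pdivrMr ?mul1r ?lerDl // ltr_wpDl.
Qed.

End Hilbert.

(** * Toeplitz operators *)

Section Toeplitz.
Variables (R : realType) (n : nat) (q : R).
Hypotheses (hq0 : 0 < q) (hq1 : q < 1).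
Variable H : fock_rep n q.
Notation C := (Cx R).
Notation Fq := (Fq n q).
Notation f0 := (@f0 R n q).
Notation zmon := (zmon q).
Notation zsmon := (zsmon q).
Notation munit := (munit q).
Variables (alpha : R) (L : L2_completion H alpha).
Hypotheses (hn : (0 < n)%N) (halpha : 0 < alpha).
Notation holo := (holo n q).
Notation hb := (@holo_basis R n q).
Notation int_m := (int_m H alpha).
Notation nrm := (nrm q alpha).
Notation T := (toeplitz L).
Implicit Types (f g : Fq) (a b c m k : midx n) (h : holo).

Lemma hb_basis : is_basis hb. Proof. exact: (holo_basis_basis H). Qed.

Lemma nrmC_neq0 m : toCx (nrm m) != 0.
Proof. by rewrite toCx_eq0 gt_eqF // nrm_gt0. Qed.

(** The scalar product of h with z^m. *)
Definition hdot h m : C := coords hb h m * toCx (nrm m).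

Lemma hdotE h m : hdot h m = coords hb h m * toCx (nrm m). Proof. by []. Qed.

Lemma hdot_lin x h h' m : hdot (x *: h + h') m = x * hdot h m + hdot h' m.
Proof. by rewrite /hdot (coords_lin hb_basis); ring. Qed.

Lemma hdot_hb k m : hdot (hb k) m = if m == k then toCx (nrm m) else 0 :> C.
Proof. by rewrite /hdot (coords_gen hb_basis); case: eqP; rewrite ?mul1r ?mul0r. Qed.

Lemma hdot_inj h h' : (forall m, hdot h m = hdot h' m) -> h = h'.
Proof.
move=> e; apply: (coords_inj hb_basis) => m.
exact: (mulIf (nrmC_neq0 m) (e m)).
Qed.

Lemma L2emb_lin x f g : L2emb L (x *: f + g) = x *: L2emb L f + L2emb L g.
Proof. exact: L2emb_linear. Qed.

Lemma L2dot_zmon f m : L2dot (L2emb L f) (L2emb L (zmon m)) = int_m (zsmon m * f).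
Proof. by rewrite L2emb_dot /dot_m Fstar_zmon. Qed.

Lemma L2dot_holo h m : L2dot (L2emb L (hval h)) (L2emb L (zmon m)) = hdot h m.
Proof.
have l1 : linear (fun h => L2dot (L2emb L (hval h)) (L2emb L (zmon m)) : C^o).
  by move=> x u w; rewrite /= L2emb_lin L2dot_linear.
have l2 : linear (fun h => hdot h m : C^o).
  by move=> x u w; rewrite hdot_lin.
apply: (basis_ext hb_basis l1 l2) => k.
rewrite L2dot_zmon hdot_hb (int_m_zszm hq0 hq1) //.
Qed.

Lemma int_m_lin x f g : finite_fun f -> finite_fun g ->
  int_m (x *: f + g) = x * int_m f + int_m g.
Proof.
move=> hf hg; rewrite !(int_m_finite hq0 hq1) //; last exact: finite_fun_lin.
by rewrite (tau_lin hq0 hq1) //; ring.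
Qed.

Lemma int_m0 : int_m 0 = 0.
Proof.
by rewrite (int_m_finite hq0 hq1) ?(tau0 hq0 hq1) ?mulr0 //; exact: finite_fun0.
Qed.

Lemma int_mZ x f : finite_fun f -> int_m (x *: f) = x * int_m f.
Proof.
by move=> hf; rewrite -[x *: f]addr0 int_m_lin ?int_m0 ?addr0 //; exact: finite_fun0.
Qed.

Lemma int_m_fin g : finite_fun g -> fin_supp (fun m => int_m (zsmon m * g) : C^o).
Proof.
elim/finite_ind => [|x f f' hf hf' e e'|a b].
- by exists [::] => m _; rewrite mulr0 int_m0.
- have [s us hs] := fin_supp2 e e'; exists s => m /hs [e1 e2].
  rewrite mulrDr scale_mulr int_m_lin; [|exact: finite_funMl..].
  by rewrite e1 e2 mulr0 addr0.
exists (box n (mdeg a).+1) => m; rewrite mem_box => /forallPn[j hj].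
rewrite !munitE !mulrA zsmon_zmon_f0_eq0 ?mul0r ?int_m0 //.
apply: contra hj => /mleP hm; rewrite ltnS; apply: leq_trans (hm j) _.
exact: leq_mdeg.
Qed.

(** For a finite function only finitely many of its scalar products with
    monomials are nonzero, so that its Bergman projection is a polynomial. *)
Definition projection g : holo :=
  \sum_(m \in [set: midx n]) (int_m (zsmon m * g) / toCx (nrm m)) *: hb m.

Lemma hdot_projection g m : finite_fun g -> hdot (projection g) m = int_m (zsmon m * g).
Proof.
move=> hg; rewrite /hdot.
rewrite (@coordsE _ _ _ _ hb_basis (fun m => int_m (zsmon m * g) / toCx (nrm m))).
  by rewrite divfK // nrmC_neq0.
split=> //; apply/fin_suppP; have [s hs] := int_m_fin hg.
by exists s => k /hs ->; rewrite mul0r.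
Qed.

Lemma projectionP g : finite_fun g ->
  is_projection (L2emb L g) (L2emb L (hval (projection g))).
Proof.
move=> hg; split.
  apply: subset_closure; exists (hval (projection g)) => //; exact: holo_holomorphic.
apply: orth_closure => _ [f hf <-].
have sf := holomorphic_span hf.
apply: (sf (fun f => L2dot (L2emb L g - L2emb L (projection g)) (L2emb L f) = 0)).
- by rewrite (lin0 (L2emb_linear L)) L2dot0r.
- by move=> x u w e1 e2; rewrite L2emb_lin L2dot_linr e1 e2 mulr0 addr0.
by move=> m; rewrite L2dotB L2dot_zmon L2dot_holo hdot_projection // subrr.
Qed.

Lemma projection_uniq g (p : holo) : finite_fun g ->
  is_projection (L2emb L g) (L2emb L (hval p)) ->
  forall m, hdot p m = int_m (zsmon m * g).
Proof.
move=> hg [_ hp] m; rewrite -L2dot_holo -L2dot_zmon.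
apply/eqP; rewrite eq_sym -subr_eq0 -L2dotB; apply/eqP/hp.
apply: subset_closure; exists (zmon m) => //.
exact: (holo_holomorphic (hb m)).
Qed.

(** The matrix entries of T_f determine it and involve integrals of finite
    functions only; the completion does not enter any further. *)
Lemma toeplitz_hdot f h m : finite_fun f ->
  hdot (T f h) m = int_m (zsmon m * (f * hval h)).
Proof.
move=> hf; have hg : finite_fun (f * hval h) by exact: finite_funMr.
rewrite /toeplitz; case: xgetP => [p _ /= hp|/(_ (projection (f * hval h)))].
  exact: projection_uniq.
by case; exact: projectionP.
Qed.

Lemma toeplitz_linear f : finite_fun f -> linear (T f).
Proof.
move=> hf x h h'; apply: hdot_inj => m; rewrite hdot_lin !toeplitz_hdot //.
rewrite mulrDr scale_mulr mulrDr scale_mulr int_m_lin //;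
  by apply: finite_funMl; exact: finite_funMr.
Qed.

Lemma toeplitz_linl x f g h : finite_fun f -> finite_fun g ->
  T (x *: f + g) h = x *: T f h + T g h.
Proof.
move=> hf hg; apply: hdot_inj => m; rewrite hdot_lin !toeplitz_hdot //; last first.
  exact: finite_fun_lin.
rewrite mulrDl scale_mull mulrDr scale_mulr int_m_lin //;
  by apply: finite_funMl; exact: finite_funMr.
Qed.

Lemma toeplitz0 h : T 0 h = 0.
Proof.
have := toeplitz_linl (-1) h (finite_fun0 n q) (finite_fun0 n q).
by rewrite scaler0 addr0 scaleN1r addNr.
Qed.

Lemma toeplitz_finrank f : finite_fun f -> fin_supp (fun k => T f (hb k)).
Proof.
elim/finite_ind => [|x f1 f2 h1 h2 e1 e2|a b].
- by exists [::] => k _; exact: toeplitz0.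
- have [s us hs] := fin_supp2 e1 e2; exists s => k /hs [e e'].
  by rewrite toeplitz_linl // e e' scaler0 addr0.
exists (box n (mdeg b).+1) => m; rewrite mem_box => /forallPn[j hj].
apply: hdot_inj => k; rewrite toeplitz_hdot; last exact: finite_munit.
have -> : munit a b * hval (hb m) = 0.
  rewrite !munitE -!mulrA.
  have -> : f0 * (zsmon b * hval (hb m)) = Fstar (zsmon m * zmon b * f0).
    by rewrite !FstarM Fstar_f0 Fstar_zmon Fstar_zsmon.
  rewrite zsmon_zmon_f0_eq0 ?Fstar0 ?mulr0 //.
  apply: contra hj => /mleP hm; rewrite ltnS; apply: leq_trans (hm j) _.
  exact: leq_mdeg.
by rewrite mulr0 int_m0 /hdot (coords0 hb_basis) mul0r.
Qed.

End Toeplitz.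

(** * The Bergman integral and the twisted action *)

Section ToeplitzEquivariance.
Variables (R : realType) (n : nat) (q : R).
Hypotheses (hq0 : 0 < q) (hq1 : q < 1).
Variable act : module_algebra n q.
Variable H : fock_rep n q.
Notation C := (Cx R).
Notation Fq := (Fq n q).
Notation z := (z q).
Notation zs := (zs q).
Notation zmon := (zmon q).
Notation zsmon := (zsmon q).
Notation Q := (toCx q).
Notation S := (toCx (Num.sqrt q)).
Notation Ucls := (cls (Urel q)).
Notation aE k := (act (Ucls (tE k))).
Notation aF k := (act (Ucls (tF k))).
Notation aK k := (act (Ucls (tK k))).
Notation aKi k := (act (Ucls (tKinv k))).
Notation weight := (@weight R n q).
Variables (alpha : R) (L : L2_completion H alpha) (p : twisted_action act alpha).
Hypotheses (hn : (0 < n)%N) (halpha : 0 < alpha).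
Notation r := (q ^+ 2).
Notation X := (q `^ (2 * alpha + 2)).
Notation holo := (holo n q).
Notation int_m := (int_m H alpha).
Notation pE k := (tact p (Ucls (tE k))).
Notation pF k := (tact p (Ucls (tF k))).
Notation pK k := (tact p (Ucls (tK k))).
Notation pKi k := (tact p (Ucls (tKinv k))).
Notation cE := (cE q).
Implicit Types (f g : Fq) (a b c m : midx n) (k l : 'I_n) (h : holo).

Lemma int_m_K k f : finite_fun f -> int_m (aK k f) = int_m f.
Proof.
move=> hf; rewrite !(int_m_finite hq0 hq1) //; last exact: finite_act.
by rewrite (tau_K hq0 hq1).
Qed.

Lemma int_m_Ki k f : finite_fun f -> int_m (aKi k f) = int_m f.
Proof.
move=> hf; rewrite !(int_m_finite hq0 hq1) //; last exact: finite_act.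
by rewrite (tau_Ki hq0 hq1).
Qed.

Lemma m_weight_next k l m : next k l ->
  m_weight q alpha (tail (inc m l)) = r * m_weight q alpha (tail (inc m k)).
Proof. by move=> e; rewrite !(m_weightE hq0); exact: wprod_next. Qed.

Lemma int_m_E k l f : next k l -> finite_fun f -> int_m (aE k f) = 0.
Proof.
move=> e hf; rewrite (int_m_finite hq0 hq1); last exact: finite_act.
by rewrite (tau_E hq0 hq1 act H e) ?mulr0 // => m; exact: m_weight_next.
Qed.

Lemma int_m_F k l f : next k l -> finite_fun f -> int_m (aF k f) = 0.
Proof.
move=> e hf; rewrite (int_m_finite hq0 hq1); last exact: finite_act.
by rewrite (tau_F hq0 hq1 act H e) ?mulr0 // => m; exact: m_weight_next.
Qed.

(** The factor for exchanging z_n with a finite function under the integral dm.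
    *)
Definition lam k : R := X * r ^+ k.

Lemma int_m_z_last k f : is_last k -> finite_fun f ->
  int_m (z k * f) = toCx (lam k) * int_m (f * z k).
Proof.
move=> kl hf; rewrite !(int_m_finite hq0 hq1); [|exact: finite_funMr|exact: finite_funMl].
rewrite (tau_z_last hq0 hq1 H kl (fun m => m_weight_last hq0 alpha m kl)) //.
by rewrite mulrCA.
Qed.

Lemma int_m_zs_last k f : is_last k -> finite_fun f ->
  int_m (f * zs k) = toCx (lam k) * int_m (zs k * f).
Proof.
move=> kl hf; rewrite !(int_m_finite hq0 hq1); [|exact: finite_funMl|exact: finite_funMr].
rewrite (tau_zs_last hq0 hq1 H kl (fun m => m_weight_last hq0 alpha m kl)) //.
by rewrite mulrCA.
Qed.

(** The scalar by which the twisted K_k differs from the original one. *)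
Definition theta k : C := if is_last k then toCx (q `^ (alpha + n%:R + 1)) else 1.

Lemma theta_nlast k : ~~ is_last k -> theta k = 1.
Proof. by rewrite /theta => /negbTE ->. Qed.

Lemma theta_neq0 k : theta k != 0.
Proof.
rewrite /theta; case: ifP => _; last exact: oner_neq0.
by rewrite toCx_eq0 gt_eqF // powR_gt0.
Qed.

Lemma hval_K k h : hval (pK k h) = theta k *: aK k (hval h).
Proof.
rewrite /theta; case: (boolP (is_last k)) => kl; first exact: tact_Kn.
by rewrite scale1r; exact: tact_K.
Qed.

Lemma hval_Ki k h : hval (pKi k h) = (theta k)^-1 *: aKi k (hval h).
Proof.
rewrite /theta; case: (boolP (is_last k)) => kl.
  by rewrite (tact_Kninv p _ kl) powRN toCxV.
by rewrite invr1 scale1r; exact: tact_Kinv.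
Qed.

Lemma hval_F k h : hval (pF k h) = (theta k)^-1 *: aF k (hval h).
Proof.
rewrite /theta; case: (boolP (is_last k)) => kl.
  rewrite (tact_Fn p _ kl) -toCxV -powRN; congr (toCx (_ `^ _) *: _).
  by rewrite !opprD.
by rewrite invr1 scale1r; exact: tact_F.
Qed.

(** The twist of E_n only changes the constant in its inner form. *)
Lemma hval_En k h : is_last k ->
  hval (pE k h) = cE *: (z k * hval h - (toCx (lam k * r)) *: (aK k (hval h) * z k)).
Proof.
move=> kl; rewrite (tact_En p _ kl) (act_En_inner hq0 hq1) //.
have -> : q `^ (2 * alpha + 2 * n%:R + 2) = lam k * r.
  have -> : 2 * alpha + 2 * n%:R + 2 = (2 * alpha + 2) + (2 * n)%:R by rewrite natrM; ring.
  rewrite (@powRD _ q (2 * alpha + 2) (2 * n)%:R); last by rewrite (gt_eqF hq0) implybT.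
  rewrite powR_mulrn ?ltW // /lam exprM -mulrA -exprSr.
  by rewrite -(last_exp kl).
rewrite !scalerBr -addrA -opprD; congr (_ - _); rewrite scalerA -scalerDl.
apply: scalar_eq; rewrite (cEE _) !toCxE.
have := oneBQ2_neq0 hq0 hq1; move: (toCx (lam k)) S => x s h1.
by field.
Qed.

(** Sorting z^*m z_n: all the letters of z^*m contribute to the coefficient of
    z_n z^*m, and each of the m_n letters z_n^* may be contracted with z_n. *)
Lemma zsmon_z_last k m : is_last k ->
  zsmon m * z k = weight k m *: (z k * zsmon m) + (1 - Q ^+ (2 * m k)) *: zsmon (dec m k).
Proof.
move=> kl; elim/midx_ind: m => [|m i mi IH].
  by rewrite zsmon0 mul1r mulr1 weight0 ffunE muln0 expr0 subrr scale0r addr0 scale1r.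
rewrite zsmon_inc // -mulrA weight_inc ffunE /zweight kl.
case: (eqVneq i k) => [ik|nik].
  rewrite {i}ik in mi *; rewrite dec_inc addn1.
  rewrite (zs_z_last q kl) mulrDr !scale_mulr mulr1 mulrA IH mulrDl !scale_mull.
  rewrite scalerDr !scalerA -addrA; congr (_ + _); first by rewrite mulrC mulrA.
  have [mk|mk] := posnP (m k).
    by rewrite mk muln0 expr0 subrr mulr0 scale0r add0r.
  rewrite zsmon_zs inc_dec // above_last // expr0 scale1r -scalerDl; apply: scalar_eq.
  by rewrite mulnS exprD; ring.
have ik := last_lt kl nik.
rewrite zs_z // scale_mulr mulrA IH mi // muln0 expr0 subrr scale0r addr0.
by rewrite scale0r addr0 scale_mull scalerA mulrA [Q * _]mulrC.
Qed.

Lemma zmon_z_last k m : is_last k ->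
  weight k m *: (zmon m * z k) = Q ^+ (2 * mdeg m) *: zmon (inc m k).
Proof.
move=> kl; elim/midx_ind: m => [|m i mi IH].
  rewrite zmon0 mul1r weight0 /mdeg big1 => [|i _]; last by rewrite ffunE.
  by rewrite muln0 expr0 !scale1r z_zmon1.
rewrite zmon_inc // -mulrA weight_inc mulrC -scalerA -scale_mulr IH scale_mulr.
rewrite z_zmon !scalerA mdeg_inc above_inc (above_top mi) add0n -incC; apply: scalar_eq.
rewrite mulnS exprD /zweight kl; case: (eqVneq i k) => [->|nik].
  by rewrite ltnn expr0 mulr1.
by rewrite (last_lt kl nik) expr1; ring.
Qed.

Lemma zs_zsmon_last k m : is_last k ->
  weight k m *: (zs k * zsmon m) = Q ^+ (2 * mdeg m) *: zsmon (inc m k).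
Proof.
move=> kl; have := congr1 (@Fstar R n q) (zmon_z_last m kl).
rewrite !FstarZ FstarM !Fstar_zmon Fstar_z weight_conj => ->.
by rewrite -toCxX toCx_conj.
Qed.

Notation hb := (@holo_basis R n q).
Notation nrm := (nrm q alpha).
Notation hdot := (@hdot R n q alpha).
Notation cF := (cF q).

(** * Adjoints of the twisted action *)

(** The norms satisfy the same exchange rule as in [swap_scalar], since they
    differ from normN by a function of the degree, which the exchange of two
    letters preserves. *)
Lemma gram_swap k l c : next k l ->
  S^-1 * qnum q (c l).+1 * toCx (nrm (inc c k)) =
  weight k (inc c l) * (S * qnum q (c k).+1) * toCx (nrm (inc c l)).
Proof.
move=> e; have Q0 := Q_neq0 hq0.
have W0 m : toCx (wprod 1 r (tail m)) != 0.
  rewrite toCx_eq0 gt_eqF //; apply: prodr_gt0 => j _.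
  by case: ifP => _; rewrite ?expr1n // exprn_gt0 // r_gt0.
(* Any weight with the exchange property may be inserted and cancelled; this
   one gives weight 1 to the first tail. *)
have hW m : wprod 1 r (tail (inc m l)) = r * wprod 1 r (tail (inc m k)).
  exact: wprod_next.
have e1 := swap_scalar hq0 hq1 e hW c; rewrite hW !toCxM -expr2 in e1.
have e2 : S^-1 * qnum q (c l).+1 * toCx (normN q (inc c k)) =
    weight k (inc c l) * (S * qnum q (c k).+1) * toCx (normN q (inc c l)).
  apply: (mulIf (W0 (inc c k))); rewrite -[LHS]mulrA e1.
  move: (weight _ _) (qnum _ _) (toCx (normN _ _)) (toCx (wprod _ _ _)) S => w x N W s.
  by field.
rewrite !nrmE !mdeg_inc !toCxM.
(* The degree, hence the remaining factors of the norms, is the same on both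
   sides. *)
have e3 (N A B x : C) : x * (A * N * B) = A * B * (x * N) by ring.
by rewrite [LHS]e3 [RHS]e3 e2.
Qed.

Lemma weight_shift k l c : next k l -> weight k (inc c k) = Q ^+ 2 * weight k (inc c l).
Proof.
move=> e; rewrite !weight_inc (zweight_self _ e) (zweight_next _ e).
by have := Q_neq0 hq0; move: (weight k c) => w Q0; field.
Qed.

Lemma pE_hb k l m : next k l ->
  pE k (hb m) = (S^-1 * qnum q (m l)) *: hb (inc (dec m l) k).
Proof.
move=> e; apply: val_inj; rewrite /= (tact_E p _ (next_nlast e)).
exact: act_E_zmon.
Qed.

Lemma pF_hb k l m : next k l ->
  pF k (hb m) = (S * qnum q (m k)) *: hb (inc (dec m k) l).
Proof.
move=> e; apply: val_inj; rewrite /= (tact_F p _ (next_nlast e)).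
exact: act_F_zmon.
Qed.

Lemma pK_hb k m : pK k (hb m) = (theta k * weight k m) *: hb m.
Proof. by apply: val_inj; rewrite /= hval_K act_K_zmon scalerA. Qed.

Lemma pKi_hb k m : pKi k (hb m) = (theta k * weight k m)^-1 *: hb m.
Proof. by apply: val_inj; rewrite /= hval_Ki (act_Ki_zmon hq0) scalerA invfM. Qed.

Lemma pEn_hb k m : is_last k ->
  pE k (hb m) = (cE * (1 - toCx (X * r ^+ (mdeg m + n)))) *: hb (inc m k).
Proof.
move=> kl; apply: val_inj; rewrite /= hval_En //= act_K_zmon scale_mull zmon_z_last //.
rewrite z_zmon above_last // expr0 scalerA -scalerBl scalerA; congr (_ * (_ - _) *: _).
rewrite -toCxX -toCxM; congr toCx; rewrite /lam r_exp.
have -> : (mdeg m + n = k.+1 + mdeg m)%N by have := last_exp kl; lia.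
by rewrite exprD (exprSr r k) !mulrA.
Qed.

Lemma pFn_hb k m : is_last k ->
  pF k (hb m) = ((theta k)^-1 * (cF * (weight k m)^-1 * (1 - Q ^+ (2 * m k)))) *: hb (dec m k).
Proof.
move=> kl; apply: val_inj; rewrite /= hval_F.
by rewrite act_Fn_zmon // scalerA.
Qed.

Lemma tact_linear xi : linear (p xi).
Proof. by case: (tact_module p). Qed.

Lemma hdot_ext (phi : holo -> holo) (x : C) (m m' : midx n) : linear phi ->
  (forall a, hdot (phi (hb a)) m = x * hdot (hb a) m') ->
  forall h, hdot (phi h) m = x * hdot h m'.
Proof.
move=> lphi e; have l1 : linear (fun h => hdot (phi h) m : C^o).
  by move=> y u v; rewrite lphi (hdot_lin H).
have l2 : linear (fun h => x * hdot h m' : C^o).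
  by move=> y u v; rewrite (hdot_lin H) mulrDr mulrCA.
exact: (basis_ext (hb_basis H) l1 l2).
Qed.

Lemma hdotZ x h m : hdot (x *: h) m = x * hdot h m.
Proof. by rewrite !hdotE (coordsZ (hb_basis H)) mulrA. Qed.

(** The matrix entries of the twisted generators move to the other side of the
    scalar product: the shift of the monomial h is replaced by the opposite
    shift of the monomial against which it is integrated. It suffices to
    compare both sides on monomials. *)
Lemma hdot_E k l h m : next k l -> hdot (pE k h) m =
  weight k m * (Q ^- 2 * S * qnum q (m k)) * hdot h (inc (dec m k) l).
Proof.
move=> e; move: h; apply: hdot_ext; first exact: tact_linear.
move=> a; rewrite (pE_hb _ e) hdotZ !(hdot_hb H).
have [[c [-> ->]]|[ha hb']] := swap_cases k l a m.
  rewrite !dec_inc !eqxx !ffunE !eqxx !addn1 (gram_swap _ e) (weight_shift _ e).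
  have := Q_neq0 hq0.
  move: (weight _ _) (qnum _ _) (toCx (nrm _)) S => w x N s Q0.
  by field.
have h1 : m == inc (dec a l) k -> qnum q (a l) = 0.
  by case: ha => [->|/negP h /eqP e']; [rewrite qnum0 | case: h; rewrite e'].
have h2 : inc (dec m k) l == a -> qnum q (m k) = 0.
  by case: hb' => [->|/negP h /eqP e']; [rewrite qnum0 | case: h; rewrite e'].
by case: ifP => [/h1 ->|_]; case: ifP => [/h2 ->|_]; rewrite !(mulr0, mul0r).
Qed.

Lemma hdot_F k l h m : next k l -> hdot (pF k h) m =
  (Q ^+ 2 * S^-1 * qnum q (m l)) / weight k (inc (dec m l) k) * hdot h (inc (dec m l) k).
Proof.
move=> e; move: h; apply: hdot_ext; first exact: tact_linear.
move=> a; rewrite (pF_hb _ e) hdotZ !(hdot_hb H).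
have [[c [-> ->]]|[ha hb']] := swap_cases k l m a.
  rewrite !dec_inc !eqxx !ffunE !eqxx !addn1.
  have w0 := weight_neq0 hq0 k (inc c l); have Q0 := Q_neq0 hq0.
  transitivity (Q ^+ 2 / weight k (inc c k) * (S^-1 * qnum q (c l).+1 * toCx (nrm (inc c k))));
    last by ring.
  rewrite (gram_swap _ e) (weight_shift _ e).
  move: (weight _ _) (qnum _ _) (toCx (nrm _)) S w0 => w x N s w0.
  by field; rewrite w0 Q0.
have h1 : m == inc (dec a k) l -> qnum q (a k) = 0.
  by case: hb' => [->|/negP h /eqP e']; [rewrite qnum0 | case: h; rewrite e'].
have h2 : inc (dec m l) k == a -> qnum q (m l) = 0.
  by case: ha => [->|/negP h /eqP e']; [rewrite qnum0 | case: h; rewrite e'].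
by case: ifP => [/h1 ->|_]; case: ifP => [/h2 ->|_]; rewrite !(mulr0, mul0r).
Qed.

Lemma hdot_K k h m : hdot (pK k h) m = theta k * weight k m * hdot h m.
Proof.
move: h; apply: hdot_ext; first exact: tact_linear.
move=> a; rewrite pK_hb hdotZ (hdot_hb H).
by case: eqP => [->|_]; rewrite ?mulr0.
Qed.

Lemma hdot_Ki k h m : hdot (pKi k h) m = (theta k * weight k m)^-1 * hdot h m.
Proof.
move: h; apply: hdot_ext; first exact: tact_linear.
move=> a; rewrite pKi_hb hdotZ (hdot_hb H).
by case: eqP => [->|_]; rewrite ?mulr0.
Qed.

Lemma scal_swap (x A B N N' : C) : N * A = N' * B -> x * A * N = x * B * N'.
Proof. by move=> e; rewrite -!mulrA [A * N]mulrC e [N' * B]mulrC. Qed.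

(** Here the ratio of the norms of two monomials whose degrees differ by one
    enters. *)
Lemma hdot_En k h m : is_last k ->
  hdot (pE k h) m = cE * (1 - Q ^+ (2 * m k)) * hdot h (dec m k).
Proof.
move=> kl; move: h; apply: hdot_ext; first exact: tact_linear.
move=> a; rewrite (pEn_hb _ kl) hdotZ !(hdot_hb H).
have [mk|mk] := posnP (m k).
  rewrite mk muln0 expr0 subrr mulr0 mul0r; case: eqP => [e|]; last by rewrite mulr0.
  by move: mk; rewrite e ffunE eqxx addn1.
have -> : (m == inc a k) = (dec m k == a).
  by apply/eqP/eqP => [->|<-]; rewrite ?dec_inc ?inc_dec.
case: eqP => [<-|_]; last by rewrite !mulr0.
have := nrm_inc hq0 hq1 halpha (dec m k) k.
rewrite inc_dec // ffunE eqxx subn1 prednK // => /(congr1 (@toCx R)).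
rewrite toCxM [RHS]toCxM !toCxB !toCx1 => e1.
apply: scal_swap; rewrite e1 -(toCxX q); exact: erefl.
Qed.

Lemma hdot_Fn k h m : is_last k -> hdot (pF k h) m =
  (theta k)^-1 * (cF / weight k (inc m k) * (1 - toCx (X * r ^+ (mdeg m + n))))
   * hdot h (inc m k).
Proof.
move=> kl; move: h; apply: hdot_ext; first exact: tact_linear.
move=> a; rewrite (pFn_hb _ kl) hdotZ !(hdot_hb H).
have [ak|ak] := posnP (a k).
  rewrite ak muln0 expr0 subrr !mulr0 mul0r; case: eqP => [e|]; last by rewrite mulr0.
  by move: ak; rewrite -e ffunE eqxx addn1.
have -> : (inc m k == a) = (m == dec a k).
  by apply/eqP/eqP => [<-|->]; rewrite ?dec_inc ?inc_dec.
case: eqP => [e|_]; last by rewrite !mulr0.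
have am : a = inc m k by rewrite e inc_dec.
rewrite am; have := nrm_inc hq0 hq1 halpha m k => /(congr1 (@toCx R)).
rewrite toCxM [RHS]toCxM !toCxB !toCx1 => e1.
rewrite ffunE eqxx addn1 -(toCxX q) -!mulrA; congr (_ * _); rewrite !mulrA.
by apply: scal_swap; rewrite e1.
Qed.

Notation T := (toeplitz L).

(** * Equivariance of the Toeplitz quantization *)

Let imZ := int_mZ hq0 hq1 H alpha.

Lemma thdot f h m : finite_fun f -> hdot (T f h) m = int_m (zsmon m * (f * hval h)).
Proof. exact: toeplitz_hdot. Qed.

Lemma hdot_eq h h' : (forall m, hdot h m = hdot h' m) -> h = h'.
Proof. exact: (hdot_inj hq0 hq1 H halpha). Qed.

Lemma hdotB h h' m : hdot (h - h') m = hdot h m - hdot h' m.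
Proof. by rewrite addrC -scaleN1r (hdot_lin H) mulN1r addrC. Qed.

Lemma int_mB f g : finite_fun f -> finite_fun g -> int_m (f - g) = int_m f - int_m g.
Proof.
move=> hf hg; have -> : f - g = (-1) *: g + f by rewrite scaleN1r addrC.
by rewrite (int_m_lin hq0 hq1) // mulN1r addrC.
Qed.

Lemma fin3 g f (g' : Fq) : finite_fun f -> finite_fun (g * (f * g')).
Proof. by move=> hf; apply: finite_funMl; exact: finite_funMr. Qed.

(** K_k may be moved from the middle factor of an integral to the two outer
    ones, by invariance. *)
Lemma int_m_K_middle k m f g : finite_fun f ->
  int_m (zsmon m * (aK k f * g)) = weight k m * int_m (zsmon m * (f * aKi k g)).
Proof.
move=> hf.
have -> : zsmon m * (aK k f * g) = aK k (aKi k (zsmon m) * (f * aKi k g)).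
  by rewrite !act_KM !act_KKi.
rewrite int_m_K; last exact: fin3.
by rewrite act_Ki_zsmon scale_mull imZ //; exact: fin3.
Qed.

Lemma int_m_Ki_middle k m f g : finite_fun f ->
  int_m (zsmon m * (aKi k f * g)) = (weight k m)^-1 * int_m (zsmon m * (f * aK k g)).
Proof.
move=> hf.
have -> : zsmon m * (aKi k f * g) = aKi k (aK k (zsmon m) * (f * aK k g)).
  by rewrite !act_KiM !act_KiK.
rewrite int_m_Ki; last exact: fin3.
by rewrite (act_K_zsmon hq0) scale_mull imZ //; exact: fin3.
Qed.

Lemma toeplitz_K k f h : finite_fun f -> T (aK k f) h = pK k (T f (pKi k h)).
Proof.
move=> hf; apply: hdot_eq => m; rewrite thdot ?hdot_K ?thdot //; last exact: finite_act.
rewrite int_m_K_middle // hval_Ki !scale_mulr imZ; last exact: fin3.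
have := theta_neq0 k; move: (theta k) (weight k m) (int_m _) => t w I t0.
by field.
Qed.

Lemma toeplitz_Ki k f h : finite_fun f -> T (aKi k f) h = pKi k (T f (pK k h)).
Proof.
move=> hf; apply: hdot_eq => m; rewrite thdot ?hdot_Ki ?thdot //; last exact: finite_act.
rewrite int_m_Ki_middle // hval_K !scale_mulr imZ; last exact: fin3.
have := theta_neq0 k; have := weight_neq0 hq0 k m.
by move: (theta k) (weight k m) (int_m _) => t w I w0 t0; field; rewrite t0 w0.
Qed.

(** Integration by parts: int z^*m (E f) h is rewritten by the Leibniz rule so
    that E falls on z^*m and on h; the total derivative integrates to zero, and
    the two remaining terms are matrix entries of E T_f, by [hdot_E], and of K
    T_f K^(-1) E. *)
Lemma toeplitz_E_next k l f h : next k l -> finite_fun f ->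
  T (aE k f) h = pE k (T f h) - pK k (T f (pKi k (pE k h))).
Proof.
move=> e hf; apply: hdot_eq => m.
have th1 := theta_nlast (next_nlast e).
rewrite hdotB (hdot_E _ _ e) hdot_K !thdot //; last exact: finite_act.
rewrite hval_Ki th1 invr1 scale1r mul1r (tact_E p _ (next_nlast e)).
set g := hval h; set m' := inc (dec m k) l.
have -> : zsmon m * (aE k f * g) =
    aE k (aKi k (zsmon m) * (f * g)) - aE k (aKi k (zsmon m)) * (f * g)
    - zsmon m * (aK k f * aE k g).
  rewrite act_EM act_KKi [aE k (f * g)]act_EM mulrDr [X in X - _ - _]addrC addrK.
  by rewrite addrK.
have fE : finite_fun (aE k (aKi k (zsmon m)) * (f * g)) by exact: fin3.
have fK : finite_fun (zsmon m * (aK k f * aE k g)) by apply: fin3; exact: finite_act.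
have f1 : finite_fun (aE k (aKi k (zsmon m) * (f * g))) by apply: finite_act; exact: fin3.
rewrite int_mB ?int_mB //; last first.
  by rewrite -scaleN1r addrC; apply: finite_fun_lin.
rewrite (int_m_E e) ?sub0r; last exact: fin3.
rewrite int_m_K_middle //; congr (_ - _).
rewrite act_Ki_zsmon act_scale (act_E_zsmon hq0 hq1 act _ e) -/m' scalerA scale_mull.
rewrite imZ; last exact: fin3.
by rewrite mulrN mulNr opprK.
Qed.

Lemma toeplitz_F_next k l f h : next k l -> finite_fun f ->
  T (aF k f) h = pF k (T f (pK k h)) - T f (pF k (pK k h)).
Proof.
move=> e hf; apply: hdot_eq => m.
have th1 := theta_nlast (next_nlast e).
rewrite hdotB (hdot_F _ _ e) !thdot //; last exact: finite_act.
rewrite (tact_F p _ (next_nlast e)) hval_K th1 scale1r.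
set g := aK k (hval h); set m' := inc (dec m l) k.
have -> : zsmon m * (aF k f * hval h) =
    aF k (zsmon m * (f * g)) - aF k (zsmon m) * aKi k (f * g) - zsmon m * (f * aF k g).
  rewrite act_FM [aF k (f * g)]act_FM {1}/g act_KiK mulrDr [X in X - _ - _]addrC addrK.
  by rewrite addrK.
have fg : finite_fun (f * g) by exact: finite_funMr.
have fE : finite_fun (aF k (zsmon m) * aKi k (f * g)).
  by apply: finite_funMl; exact: finite_act.
have fK : finite_fun (zsmon m * (f * aF k g)) by exact: fin3.
have f1 : finite_fun (aF k (zsmon m * (f * g))) by apply: finite_act; exact: fin3.
rewrite int_mB ?int_mB //; last first.
  by rewrite -scaleN1r addrC; apply: finite_fun_lin.
rewrite (int_m_F e) ?sub0r; last exact: fin3.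
congr (_ - _).
rewrite (act_F_zsmon hq0 hq1 act _ e) -/m' scale_mull imZ; last first.
  by apply: finite_funMl; exact: finite_act.
have -> : zsmon m' * aKi k (f * g) = aKi k (aK k (zsmon m') * (f * g)).
  by rewrite [in RHS]act_KiM act_KiK.
rewrite int_m_Ki; last exact: fin3.
rewrite (act_K_zsmon hq0) scale_mull imZ; last exact: fin3.
by rewrite mulNr opprK mulrA.
Qed.

Lemma lam_tE k : is_last k -> X * r ^+ n = lam k * r.
Proof.
move=> kl; rewrite /lam -mulrA -(exprSr r); congr (_ * _ ^+ _).
by rewrite -last_exp.
Qed.

(** For the last index the integral is not invariant, but E_n is inner: in int
    z^*m (z_n f - K_n(f) z_n) h the letter z_n is moved through z^*m, by
    [zsmon_z_last], and then around the integral at the cost [lam]. The twist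
    in the action on polynomials is the one that absorbs this factor. *)
Lemma toeplitz_E_last k f h : is_last k -> finite_fun f ->
  T (aE k f) h = pE k (T f h) - pK k (T f (pKi k (pE k h))).
Proof.
move=> kl hf; apply: hdot_eq => m.
rewrite hdotB (hdot_En _ _ kl) // hdot_K !thdot //; last exact: finite_act.
have Q20 : Q ^+ 2 != 0 by rewrite expf_neq0 // Q_neq0.
have -> : hval (pKi k (pE k h)) = (theta k)^-1 *:
    (cE *: (aKi k (z k * hval h) - toCx (lam k) *: (hval h * z k))).
  rewrite hval_Ki (hval_En _ kl) act_scale act_add act_opp act_scale.
  rewrite act_KiM [aKi k (aK k _ * z k)]act_KiM act_KiK act_Ki_z // /zweight kl eqxx.
  congr (_ *: (_ *: (_ - _))).
  by rewrite scale_mulr scalerA toCxM toCxX mulfK.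
set g := hval h; set u := aKi k (z k * g).
have -> : zsmon m * (aE k f * g) =
    cE *: (zsmon m * (z k * (f * g)) - zsmon m * (aK k f * (z k * g))).
  by rewrite (act_En_inner hq0 hq1) // scale_mull scale_mulr mulrBl mulrBr !mulrA.
have fg : finite_fun (f * g) by exact: finite_funMr.
have fK : finite_fun (aK k f) by exact: finite_act.
have fA : finite_fun (zsmon m * (z k * (f * g))) by do 2!apply: finite_funMl.
have fB : finite_fun (zsmon m * (aK k f * (z k * g))) by exact: fin3.
rewrite imZ; last by rewrite -scaleN1r addrC; exact: finite_fun_lin.
rewrite int_mB // int_m_K_middle // -/u.
have -> : int_m (zsmon m * (z k * (f * g))) =
    weight k m * (toCx (lam k) * int_m (zsmon m * (f * (g * z k)))) +
    (1 - Q ^+ (2 * m k)) * int_m (zsmon (dec m k) * (f * g)).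
  have f1 : finite_fun (zsmon m * (f * g)) by exact: fin3.
  rewrite mulrA (zsmon_z_last m kl) mulrDl !scale_mull -mulrA.
  rewrite (int_m_lin hq0 hq1); [|exact: finite_funMl|by apply: finite_funZ; exact: fin3].
  rewrite imZ; last exact: fin3.
  by rewrite int_m_z_last // !mulrA.
have -> : int_m (zsmon m * (f * ((theta k)^-1 *: (cE *: (u - toCx (lam k) *: (g * z k)))))) =
    (theta k)^-1 * (cE * (int_m (zsmon m * (f * u)) -
      toCx (lam k) * int_m (zsmon m * (f * (g * z k))))).
  have f1 v : finite_fun (zsmon m * (f * v)) by exact: fin3.
  rewrite !scale_mulr imZ; last by apply: finite_funZ; exact: f1.
  rewrite imZ; last exact: f1.
  rewrite mulrBr mulrBr !scale_mulr int_mB //; last by apply: finite_funZ; exact: f1.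
  by rewrite imZ.
have := theta_neq0 k.
move: (theta k) (weight k m) (toCx (lam _)) cE (1 - _) (int_m _) (int_m _) (int_m _).
by move=> t w la ce x I1 I2 I3 t0; field.
Qed.

(** As for E_n, with z_n^* in place of z_n and the sorting rule
    [zs_zsmon_last]. *)
Lemma toeplitz_F_last k f h : is_last k -> finite_fun f ->
  T (aF k f) h = pF k (T f (pK k h)) - T f (pF k (pK k h)).
Proof.
move=> kl hf; apply: hdot_eq => m.
rewrite hdotB (hdot_Fn _ _ kl) !thdot //; last exact: finite_act.
rewrite [(mdeg m + n)%N]addnC (exprD r n) [X * _]mulrA (lam_tE kl) hval_F hval_K.
rewrite act_scale scalerA mulVf ?theta_neq0 // scale1r.
set g := aK k (hval h).
have hg : hval h = aKi k g by rewrite /g act_KiK.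
have -> : zsmon m * (aF k f * hval h) =
    cF *: (zsmon (inc m k) * (aKi k f * hval h) - zsmon m * (f * (zs k * hval h))).
  have -> : zsmon (inc m k) = zsmon m * zs k by rewrite zsmon_zs above_last // scale1r.
  by rewrite (act_Fn_inner hq0 hq1) // scale_mull scale_mulr mulrBl mulrBr !mulrA.
have -> : aF k g = cF *: (zs k * hval h - g * zs k).
  by rewrite (act_Fn_inner hq0 hq1) // -hg.
have fK : finite_fun (aKi k f) by exact: finite_act.
have f1 a v : finite_fun (zsmon a * (f * v)) by exact: fin3.
have f2 : finite_fun (zsmon (inc m k) * (aKi k f * hval h)) by exact: fin3.
rewrite imZ; last by rewrite -scaleN1r addrC; exact: finite_fun_lin.
rewrite int_mB // int_m_Ki_middle // -/g.
rewrite !scale_mulr !imZ; [|exact: f1..].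
rewrite [f * (_ - _)]mulrBr [zsmon m * (_ - _)]mulrBr int_mB //.
have -> : int_m (zsmon m * (f * (g * zs k))) = toCx (lam k) *
    ((weight k m)^-1 * Q ^+ (2 * mdeg m) * int_m (zsmon (inc m k) * (f * g))).
  have -> : zsmon m * (f * (g * zs k)) = zsmon m * (f * g) * zs k by rewrite !mulrA.
  rewrite int_m_zs_last //; congr (_ * _).
  have w0 := weight_neq0 hq0 k m.
  have -> : zs k * (zsmon m * (f * g)) =
      ((weight k m)^-1 * Q ^+ (2 * mdeg m)) *: (zsmon (inc m k) * (f * g)).
    have -> : zs k * (zsmon m * (f * g)) = (weight k m)^-1 *:
        ((weight k m *: (zs k * zsmon m)) * (f * g)).
      by rewrite scale_mull scalerA mulVf // scale1r mulrA.
    by rewrite (zs_zsmon_last m kl) scale_mull scalerA.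
  by rewrite imZ.
rewrite weight_inc /zweight kl eqxx.
have -> : toCx (lam k * r * r ^+ mdeg m) =
    toCx (lam k) * Q ^+ 2 * Q ^+ (2 * mdeg m).
  by rewrite -r_exp !toCxM !toCxX.
have := theta_neq0 k; have := weight_neq0 hq0 k m; have := Q_neq0 hq0.
move: (theta k) (weight k m) (toCx (lam _)) cF (Q ^+ (2 * _)) (int_m _) (int_m _).
by move=> t w la cf x I1 I2 Q0 w0 t0; field; rewrite t0 w0 Q0.
Qed.

(** With [toeplitz_F], [toeplitz_K] and [toeplitz_Ki] this says that f |-> T_f
    commutes with the generators of the quantum group. *)
Lemma toeplitz_E k f h : finite_fun f ->
  T (aE k f) h = pE k (T f h) - pK k (T f (pKi k (pE k h))).
Proof.
move=> hf; have [kl|/nlast_next[l e]] := boolP (is_last k); first exact: toeplitz_E_last.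
exact: (toeplitz_E_next _ e).
Qed.

Lemma toeplitz_F k f h : finite_fun f ->
  T (aF k f) h = pF k (T f (pK k h)) - T f (pF k (pK k h)).
Proof.
move=> hf; have [kl|/nlast_next[l e]] := boolP (is_last k); first exact: toeplitz_F_last.
exact: (toeplitz_F_next _ e).
Qed.

End ToeplitzEquivariance.

(** * The q-trace *)

Section CovariantSymbols.
Variables (R : realType) (n : nat) (q : R).
Hypotheses (hq0 : 0 < q) (hq1 : q < 1).
Variable act : module_algebra n q.
Variable H : fock_rep n q.
Notation C := (Cx R).
Notation Fq := (Fq n q).
Notation Q := (toCx q).
Notation Ucls := (cls (Urel q)).
Variables (alpha : R) (L : L2_completion H alpha) (p : twisted_action act alpha).
Hypotheses (hn : (0 < n)%N) (halpha : 0 < alpha).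
Notation holo := (holo n q).
Notation hb := (@holo_basis R n q).
Notation pE k := (tact p (Ucls (tE k))).
Notation pF k := (tact p (Ucls (tF k))).
Notation pK k := (tact p (Ucls (tK k))).
Notation pKi k := (tact p (Ucls (tKinv k))).
Implicit Types (f g : Fq) (a b c m : midx n) (h : holo).
Notation tr := (@tr_q R n q alpha).
Notation w m := (toCx (tr_weight q m)).
Implicit Types (A B Y : holo -> holo) (t s : Uterm R n).

(** Equivalent to having finitely many nonzero matrix entries, since each of
    the finitely many nonzero images is itself a polynomial. *)
Definition finrank A : Prop := fin_supp (fun k => A (hb k)).

Definition tr_const : C :=
  toCx (qpoch (q ^+ 2) (q ^+ 2) n / qpoch (q `^ (2 + 2 * alpha)) (q ^+ 2) n).

Lemma tr_seq A (u : seq (midx n)) : uniq u -> (forall k, k \notin u -> A (hb k) = 0) ->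
  tr A = tr_const * \sum_(k <- u) coords hb (A (hb k)) k * w k.
Proof.
move=> uu hu; rewrite /tr_q; congr (_ * _); apply: fsum_seq => // k /hu ->.
by rewrite (coords0 (hb_basis H)) mul0r.
Qed.

Lemma tr_lin x y A B D : finrank A -> finrank B ->
  (forall h, D h = x *: A h + y *: B h) -> tr D = x * tr A + y * tr B.
Proof.
move=> fA fB e; have [u uu hu] := fin_supp2 fA fB.
rewrite !(tr_seq uu); try by move=> k /hu [].
  rewrite [x * _]mulrCA [y * _]mulrCA -mulrDr [x * _]mulr_sumr [y * _]mulr_sumr.
  rewrite -big_split; congr (_ * _); apply: eq_bigr => k _ /=.
  rewrite e (coords_lin (hb_basis H)) (coordsZ (hb_basis H)) mulrDl.
  by rewrite !mulrA.
by move=> k /hu [a b]; rewrite e a b !scaler0 addr0.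
Qed.

Lemma eq_tr A B : (forall h, A h = B h) -> tr A = tr B.
Proof. by move=> e; congr tr; apply/funext. Qed.

Lemma finrank_comp A Y : linear Y -> finrank A -> finrank (Y \o A).
Proof. by move=> lY [u hu]; exists u => k /hu /= ->; exact: lin0 lY. Qed.

(** An operator that kills almost all monomials only sees finitely many
    coordinates. *)
Lemma linear_expand A (u : seq (midx n)) : linear A -> uniq u ->
  (forall k, k \notin u -> A (hb k) = 0) ->
  forall h, A h = \sum_(k <- u) coords hb h k *: A (hb k).
Proof.
move=> lA uu hu; apply: (basis_ext (hb_basis H) lA) => [x h h'|j].
  rewrite scaler_sumr -big_split; apply: eq_bigr => k _ /=.
  by rewrite (coords_lin (hb_basis H)) scalerDl scalerA.
have [ju|ju] := boolP (j \in u).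
  rewrite (bigD1_seq j) //= (coords_gen (hb_basis H)) eqxx scale1r big1 ?addr0 // => k kj.
  by rewrite (coords_gen (hb_basis H)) (negbTE kj) scale0r.
rewrite hu // big1_seq // => k /andP[_ ku].
rewrite (coords_gen (hb_basis H)); case: eqP => [e|_]; last by rewrite scale0r.
by rewrite e (negbTE ju) in ku.
Qed.

Lemma coords_sum_big (I : Type) (u : seq I) (c : I -> C) (v : I -> holo) m :
  coords hb (\sum_(i <- u) c i *: v i) m = \sum_(i <- u) c i * coords hb (v i) m.
Proof.
elim: u => [|i u IH]; first by rewrite !big_nil (coords0 (hb_basis H)).
by rewrite !big_cons (coords_lin (hb_basis H)) IH.
Qed.

(** The q-trace is twisted cyclic: its weights are the eigenvalues of a
    diagonal operator, and an operator that multiplies all weights by one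
    factor picks up this factor when it is moved around. All sums are made
    finite by enclosing the nonzero matrix entries of A in a square. *)
Lemma tr_comm (x : C) A Y : linear A -> linear Y -> finrank A ->
  (forall k l : midx n, coords hb (Y (hb l)) k != 0 -> w k = x * w l) ->
  tr (Y \o A) = x * tr (A \o Y).
Proof.
move=> lA lY fA hx; have [u0 uu0 hu0] := fin_supp_seq fA.
have [u [uu hA hu]] : exists u : seq (midx n), [/\ uniq u,
    forall k, k \notin u -> A (hb k) = 0 &
    forall k l, l \notin u -> coords hb (A (hb k)) l = 0].
  have [v hv] : exists v : seq (midx n),
      forall k l, k \in u0 -> l \notin v -> coords hb (A (hb k)) l = 0.
    elim: u0 {uu0 hu0} => [|k0 u0 [v hv]]; first by exists [::].
    have [v0 hv0] := coords_fin (hb_basis H) (A (hb k0)).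
    exists (v0 ++ v) => k l; rewrite inE mem_cat => /orP[/eqP ->|ku] /norP[l1 l2].
      exact: hv0.
    exact: hv.
  exists (undup (u0 ++ v)); split; first exact: undup_uniq.
    by move=> k; rewrite mem_undup mem_cat => /norP[/hu0].
  move=> k l; rewrite mem_undup mem_cat => /norP[_ lv].
  have [ku|ku] := boolP (k \in u0); first exact: hv.
  by rewrite hu0 // (coords0 (hb_basis H)).
have expA k : A (hb k) = \sum_(l <- u) coords hb (A (hb k)) l *: hb l.
  by rewrite {1}(coords_sum (hb_basis H) (A (hb k))) (fsum_seq uu) // => l /hu ->;
    rewrite scale0r.
have eYA k : coords hb (Y (A (hb k))) k =
    \sum_(l <- u) coords hb (A (hb k)) l * coords hb (Y (hb l)) k.
  rewrite {1}expA -coords_sum_big; congr (coords _ _ _).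
  by rewrite (lin_sum lY); apply: eq_bigr => l _; rewrite (linZ lY).
have eAY m : coords hb (A (Y (hb m))) m =
    \sum_(k <- u) coords hb (Y (hb m)) k * coords hb (A (hb k)) m.
  by rewrite (linear_expand lA uu hA) coords_sum_big.
rewrite (tr_seq uu) => [|k /hA e]; last by rewrite /= e (lin0 lY).
rewrite /tr_q mulrCA (fsum_seq uu); last first.
  move=> m mu /=; rewrite eAY big1 ?mul0r // => k _.
  by rewrite hu // mulr0.
congr (_ * _); rewrite mulr_sumr.
under eq_bigr do rewrite /= eYA mulr_suml.
rewrite exchange_big; apply: eq_bigr => l _ /=.
rewrite eAY mulr_suml mulr_sumr; apply: eq_bigr => k _.
have [->|nz] := eqVneq (coords hb (Y (hb l)) k) 0; first by rewrite !(mulr0, mul0r).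
by rewrite (hx _ _ nz); ring.
Qed.

Lemma tr_weightE m : tr_weight q m = nu_weight q (tail m).
Proof.
rewrite /tr_weight /nu_weight [RHS](bigD1 (Ordinal hn)) //=; congr (_ * _).
  by rewrite ffunE; congr (q ^- (_ * _)); apply: eq_bigl.
apply: eq_big => j; first by rewrite -val_eqE.
by move=> j0; rewrite (negbTE j0) ffunE.
Qed.

Lemma tr_weight_next k l m : next k l ->
  tr_weight q (inc m l) = q ^+ 2 * tr_weight q (inc m k).
Proof. by move=> e; rewrite !tr_weightE !nu_weightE; exact: wprod_next. Qed.

Lemma tr_weight_last k m : is_last k -> tr_weight q (inc m k) = q ^- 2 * tr_weight q m.
Proof. by move=> kl; rewrite !tr_weightE; exact: nu_weight_last. Qed.

Lemma coords_shift (x : C) (a m : midx n) :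
  coords hb (x *: hb a) m != 0 -> x != 0 /\ m = a.
Proof.
rewrite (coordsZ (hb_basis H)) (coords_gen (hb_basis H)) mulf_eq0 negb_or => /andP[-> h].
by split=> //; apply/eqP; move: h; case: (m == a); rewrite ?eqxx.
Qed.

Lemma tr_comm_K k A : linear A -> finrank A -> tr (pK k \o A) = tr (A \o pK k).
Proof.
move=> lA fA; rewrite (@tr_comm 1) ?mul1r //; first exact: tact_linear.
by move=> m a; rewrite (pK_hb p) => /coords_shift[_ ->]; rewrite mul1r.
Qed.

Lemma tr_comm_Ki k A : linear A -> finrank A -> tr (pKi k \o A) = tr (A \o pKi k).
Proof.
move=> lA fA; rewrite (@tr_comm 1) ?mul1r //; first exact: tact_linear.
by move=> m a; rewrite (pKi_hb hq0 p) => /coords_shift[_ ->]; rewrite mul1r.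
Qed.

(** E_k for k < n replaces a letter z_(k+1) by z_k, and E_n adds a letter z_n;
    in both cases the weight is multiplied by q^(-2). *)
Lemma tr_comm_E k A : linear A -> finrank A -> tr (pE k \o A) = Q ^- 2 * tr (A \o pE k).
Proof.
move=> lA fA; apply: tr_comm => //; first exact: tact_linear.
move=> m a; rewrite -toCxX -toCxV -toCxM.
have [kl|/nlast_next[l e]] := boolP (is_last k).
  by rewrite (pEn_hb hq0 hq1 p hn halpha _ kl) => /coords_shift[_ ->]; rewrite tr_weight_last.
rewrite (pE_hb hq0 hq1 p _ e) => /coords_shift[nz ->].
have al : (0 < a l)%N.
  by have [a0|//] := posnP (a l); move: nz; rewrite a0 qnum0 mulr0 eqxx.
rewrite -{2}(inc_dec al) (tr_weight_next _ e) mulKf //.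
by rewrite expf_neq0 // gt_eqF.
Qed.

Lemma tr_comm_F k A : linear A -> finrank A -> tr (pF k \o A) = Q ^+ 2 * tr (A \o pF k).
Proof.
move=> lA fA; apply: tr_comm => //; first exact: tact_linear.
move=> m a; rewrite -toCxX -toCxM.
have q2 : q ^+ 2 != 0 by rewrite expf_neq0 // gt_eqF.
have [kl|/nlast_next[l e]] := boolP (is_last k).
  rewrite (pFn_hb hq0 hq1 p _ kl) => /coords_shift[nz ->].
  have ak : (0 < a k)%N.
    have [a0|//] := posnP (a k); move: nz.
    by rewrite a0 muln0 expr0 subrr !mulr0 eqxx.
  by rewrite -{2}(inc_dec ak) (tr_weight_last _ kl) mulVKf.
rewrite (pF_hb hq0 hq1 p _ e) => /coords_shift[nz ->].
have ak : (0 < a k)%N.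
  by have [a0|//] := posnP (a k); move: nz; rewrite a0 qnum0 mulr0 eqxx.
by rewrite -{2}(inc_dec ak) (tr_weight_next _ e).
Qed.

Notation aE k := (act (Ucls (tE k))).
Notation aF k := (act (Ucls (tF k))).
Notation aK k := (act (Ucls (tK k))).
Notation aKi k := (act (Ucls (tKinv k))).
Notation X := (q `^ (2 * alpha + 2)).
Notation T := (toeplitz L).

(** * The q-trace and the action on operators *)

Let pm := tact_module p.

Lemma linear_comp A Y : linear A -> linear Y -> linear (A \o Y).
Proof. by move=> lA lY x h h' /=; rewrite lY lA. Qed.

Lemma act_End_cst x A h : act_End p (Cst x) A h = x *: A h.
Proof. by rewrite /act_End /= big_seq1 /= !(Umod_cst pm) scale1r. Qed.

Lemma act_End_E k A h : act_End p (tE k) A h =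
  pE k (A h) + pK k (A (- pKi k (pE k h))).
Proof.
rewrite /act_End /= big_cons big_seq1 /= /antipode /= !(Umod_mul pm) !(Umod_cst pm).
by rewrite scale1r scaleN1r.
Qed.

Lemma act_End_F k A h : act_End p (tF k) A h =
  pF k (A (pK k h)) + A (- pF k (pK k h)).
Proof.
rewrite /act_End /= big_cons big_seq1 /= /antipode /= !(Umod_mul pm) !(Umod_cst pm).
by rewrite scale1r scaleN1r.
Qed.

Lemma act_End_K k A h : act_End p (tK k) A h = pK k (A (pKi k h)).
Proof. by rewrite /act_End /= big_seq1. Qed.

Lemma act_End_Ki k A h : act_End p (tKinv k) A h = pKi k (A (pK k h)).
Proof. by rewrite /act_End /= big_seq1. Qed.

Lemma act_End_add s t A h :
  act_End p (s + t)%T A h = act_End p s A h + act_End p t A h.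
Proof. by rewrite /act_End /= big_cat. Qed.

(** The action on operators is multiplicative because the antipode reverses
    products and the coproduct preserves them. *)
Lemma act_End_mul s t A h : linear A ->
  act_End p (s * t)%T A h = act_End p s (act_End p t A) h.
Proof.
move=> lA; rewrite /act_End /= big_allpairs_dep; apply: eq_bigr => a _.
rewrite (lin_sum (Umod_linear pm _)); apply: eq_bigr => b _ /=.
by rewrite /antipode /= !(Umod_mul pm).
Qed.

Lemma act_End_linear t A : linear A -> linear (act_End p t A).
Proof.
move=> lA x h h'; rewrite /act_End scaler_sumr -big_split; apply: eq_bigr => a _ /=.
by rewrite (Umod_linear pm) lA (Umod_linear pm).
Qed.

(** Conjugation by K produces the powers of q that the twisted cyclicity of the
    q-trace compensates. *)
Lemma pKi_pE_pK k h : pKi k (pE k (pK k h)) = Q ^- 2 *: pE k h.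
Proof.
have e := Umod_KE pm k h.
rewrite -[pE k h](Umod_KiK pm k) e (UmodZ pm) scalerA mulVf ?scale1r //.
by rewrite expf_neq0 // Q_neq0.
Qed.

Lemma pKi_pF_pK k h : pKi k (pF k (pK k h)) = Q ^+ 2 *: pF k h.
Proof.
have e := Umod_KF pm k h.
rewrite -[pF k h](Umod_KiK pm k) e (UmodZ pm) scalerA mulfV ?scale1r //.
by rewrite expf_neq0 // Q_neq0.
Qed.

Lemma toeplitz_scale f x h : finite_fun f -> T (x *: f) h = x *: T f h.
Proof.
move=> hf; have := toeplitz_linl hq0 hq1 L hn halpha x h hf (finite_fun0 n q).
by rewrite addr0 (toeplitz0 hq0 hq1 L hn halpha) addr0.
Qed.

Section Fixed.
Variable f : Fq.
Hypothesis hf : finite_fun f.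
Let TK := toeplitz_K hq0 hq1 L p hn halpha.
Let TKi := toeplitz_Ki hq0 hq1 L p hn halpha.
Let TE := toeplitz_E hq0 hq1 L p hn halpha.
Let TF := toeplitz_F hq0 hq1 L p hn halpha.
Let finT := toeplitz_finrank hq0 hq1 L hn halpha.
Let linT := toeplitz_linear hq0 hq1 L hn halpha.
Let finact := finite_act act.

(** Equivariance solved for T_f composed with a generator on the right: this
    expresses such a composite by Toeplitz operators of finite functions, and
    shows that it has finite rank as well. *)
Lemma toeplitz_pK k h : T f (pK k h) = pK k (T (aKi k f) h).
Proof. by rewrite TKi // (Umod_KKi pm). Qed.

Lemma toeplitz_pE k h :
  T f (pE k h) = pE k (T (aKi k f) h) - T (aE k (aKi k f)) h.
Proof.
have fKi := finact (tKinv k) hf.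
by rewrite TE // TKi // [X in _ = _ - (_ - pK k X)]TKi // !(Umod_KKi pm) subKr.
Qed.

Lemma toeplitz_pF k h :
  T f (pF k h) = pF k (T f h) - pKi k (T (aK k (aF k f)) h).
Proof.
have fF := finact (tF k) hf.
by rewrite TK // (Umod_KiK pm) TF // !(Umod_KKi pm) subKr.
Qed.

Lemma toeplitz_SE k h : T (act (Ucls (antipode (tE k))) f) h =
  Q ^- 2 *: T f (pE k h) - pKi k (pE k (T f (pK k h))).
Proof.
have fE := finact (tE k) hf; have fKE := finact (tKinv k) fE.
rewrite /antipode /= !actM act_cst toeplitz_scale // scaleN1r TKi // TE //.
rewrite -(UmodN pm) opprB (UmodD pm) (UmodN pm) (Umod_KiK pm) pKi_pE_pK.
by rewrite (linZ (linT hf)) addrC.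
Qed.

Lemma toeplitz_SF k h : T (act (Ucls (antipode (tF k))) f) h =
  Q ^+ 2 *: pK k (T f (pF k h)) - pF k (pK k (T f h)).
Proof.
have fK := finact (tK k) hf; have fFK := finact (tF k) fK.
rewrite /antipode /= !actM act_cst toeplitz_scale // scaleN1r TF // !TK //.
by rewrite pKi_pF_pK (Umod_KiK pm) (linZ (linT hf)) (UmodZ pm) opprB.
Qed.

Lemma finrank_TpK k : finrank (T f \o pK k).
Proof.
have [u hu] := finT (finact (tKinv k) hf).
by exists u => m /hu e; rewrite /= toeplitz_pK e (Umod0 pm).
Qed.

Lemma finrank_TpE k : finrank (T f \o pE k).
Proof.
have fK := finact (tKinv k) hf.
have [u _ hu] := fin_supp2 (finT fK) (finT (finact (tE k) fK)).
by exists u => m /hu [e e']; rewrite /= toeplitz_pE e e' (Umod0 pm) subr0.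
Qed.

Lemma finrank_TpF k : finrank (T f \o pF k).
Proof.
have fF := finact (tF k) hf.
have [u _ hu] := fin_supp2 (finT hf) (finT (finact (tK k) fF)).
by exists u => m /hu [e e']; rewrite /= toeplitz_pF e e' !(Umod0 pm) subr0.
Qed.

Let lp xi : linear (p xi) := Umod_linear pm xi.
Let lT := linT hf.
Let fT := finT hf.

(** Both sides are sums of two traces. The terms with K agree by the cyclicity
    of the trace for K, the other ones by that for E, whose factor q^(-2) is
    the one of [pKi_pE_pK]. *)
Lemma tr_adjoint_E k A : linear A ->
  tr (act_End p (tE k) A \o T f) = tr (A \o T (act (Ucls (antipode (tE k))) f)).
Proof.
move=> lA; pose B := A \o (pKi k \o pE k).
have lB : linear B by do !apply: linear_comp => //.
have lAT := linear_comp lA lT; have fAT := finrank_comp lA fT.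
have lBT := linear_comp lB lT; have fBT := finrank_comp lB fT.
transitivity (1 * tr (pE k \o (A \o T f)) + -1 * tr (pK k \o (B \o T f))).
  apply: tr_lin => [||h]; try exact: finrank_comp.
  by rewrite /= act_End_E (linN lA) (UmodN pm) scale1r scaleN1r.
rewrite mul1r (tr_comm_E k lAT fAT).
rewrite (tr_comm_K k lBT fBT).
symmetry; apply: tr_lin => [||h].
- exact: finrank_comp lA (finrank_TpE k).
- exact: finrank_comp lB (finrank_TpK k).
by rewrite /= toeplitz_SE -[_ - _]addrC -scaleN1r lA addrC (linZ lA).
Qed.

Lemma tr_adjoint_F k A : linear A ->
  tr (act_End p (tF k) A \o T f) = tr (A \o T (act (Ucls (antipode (tF k))) f)).
Proof.
move=> lA; pose B := A \o pK k; pose D := A \o (pF k \o pK k).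
have lB : linear B by do !apply: linear_comp => //.
have lD : linear D by do !apply: linear_comp => //.
have lBT := linear_comp lB lT; have fBT := finrank_comp lB fT.
transitivity (1 * tr (pF k \o (B \o T f)) + -1 * tr (D \o T f)).
  apply: tr_lin => [||h]; try exact: finrank_comp.
  by rewrite /= act_End_F (linN lA) scale1r scaleN1r.
rewrite mul1r (tr_comm_F k lBT fBT).
symmetry; apply: tr_lin => [||h].
- exact: finrank_comp lB (finrank_TpF k).
- exact: finrank_comp lD fT.
by rewrite /= toeplitz_SF lA (linN lA) scaleN1r.
Qed.

Lemma tr_adjoint_K k A : linear A ->
  tr (act_End p (tK k) A \o T f) = tr (A \o T (act (Ucls (antipode (tK k))) f)).
Proof.
move=> lA; pose B := A \o pKi k.
have lB : linear B by do !apply: linear_comp => //.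
transitivity (tr (pK k \o (B \o T f))); first by apply: eq_tr => h /=; rewrite act_End_K.
rewrite (tr_comm_K k (linear_comp lB lT) (finrank_comp lB fT)).
by apply: eq_tr => h; rewrite /= /antipode /= TKi.
Qed.

Lemma tr_adjoint_Ki k A : linear A ->
  tr (act_End p (tKinv k) A \o T f) =
  tr (A \o T (act (Ucls (antipode (tKinv k))) f)).
Proof.
move=> lA; pose B := A \o pK k.
have lB : linear B by do !apply: linear_comp => //.
transitivity (tr (pKi k \o (B \o T f))); first by apply: eq_tr => h /=; rewrite act_End_Ki.
rewrite (tr_comm_Ki k (linear_comp lB lT) (finrank_comp lB fT)).
by apply: eq_tr => h; rewrite /= /antipode /= TK.
Qed.

End Fixed.

(** The action on operators is the transpose of the antipode for the pairing of
    A with f given by the q-trace of A T_f. *)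
Lemma tr_adjoint t : forall A f, linear A -> finite_fun f ->
  tr (act_End p t A \o T f) = tr (A \o T (act (Ucls (antipode t)) f)).
Proof.
elim: t => [[k|k|k|k]|x|s IHs t IHt|s IHs t IHt] A f lA hf.
- exact: tr_adjoint_E.
- exact: tr_adjoint_F.
- exact: tr_adjoint_K.
- exact: tr_adjoint_Ki.
- apply: eq_tr => h; rewrite /= act_End_cst /antipode /= act_cst.
  by rewrite toeplitz_scale // (linZ lA).
- have fs := finite_act act (antipode s) hf; have ft := finite_act act (antipode t) hf.
  have fT g := @toeplitz_finrank _ _ _ hq0 hq1 _ _ L hn halpha g.
  transitivity (1 * tr (act_End p s A \o T f) + 1 * tr (act_End p t A \o T f)).
    apply: tr_lin => [||h]; try by apply: finrank_comp (fT _ hf); exact: act_End_linear.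
    by rewrite /= act_End_add !scale1r.
  rewrite IHs // IHt //; symmetry; apply: tr_lin => [||h].
  + exact: finrank_comp lA (fT _ fs).
  + exact: finrank_comp lA (fT _ ft).
  rewrite /= /antipode /= actD -[X in T (X + _)]scale1r.
  by rewrite (toeplitz_linl hq0 hq1 L hn halpha) // scale1r -[X in A (X + _)]scale1r lA !scale1r.
- transitivity (tr (act_End p s (act_End p t A) \o T f)).
    by apply: eq_tr => h; rewrite /= act_End_mul.
  rewrite IHs //; last exact: act_End_linear.
  rewrite IHt //; last exact: finite_act.
  by rewrite /antipode /= actM.
Qed.

(** * Covariant symbols *)

Notation munit := (munit q).
Implicit Types psi : distr R n.

Let fT f := @toeplitz_finrank _ _ _ hq0 hq1 _ _ L hn halpha f.

(** Testing the defining identity on matrix units leaves no choice for the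
    values of the symbol, since each matrix unit pairs with a distribution
    through one value. *)
Definition symbol A : distr R n := fun x =>
  (pair_scale q (mpt_inv x).2 (mpt_inv x).1)^-1 *
  tr (A \o T (munit (mpt_inv x).2 (mpt_inv x).1)).

Lemma pairing0 psi : pairing H psi 0 = 0.
Proof.
have := pairing_lin hq0 hq1 H psi (-1) (finite_fun0 n q) (finite_fun0 n q).
by rewrite scaler0 addr0 mulN1r addNr.
Qed.

Lemma symbolP A : linear A -> is_covariant_symbol L A (symbol A).
Proof.
move=> lA; apply: finite_ind => [|x f g hf hg IHf IHg|a b].
- rewrite pairing0; symmetry; rewrite -[RHS](mulr0 tr_const).
  rewrite -[X in tr_const * X](big_nil 0 +%R xpredT (fun m : midx n => 0)).
  rewrite (@tr_seq _ [::]) ?big_nil // => m _ /=.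
  by rewrite (toeplitz0 hq0 hq1 L hn halpha) (lin0 lA).
- rewrite (pairing_lin hq0 hq1 H _ x hf hg) IHf IHg -[X in _ + X]mul1r.
  symmetry; apply: tr_lin => [||h]; try by apply: finrank_comp (fT _).
  by rewrite /= (toeplitz_linl hq0 hq1 L hn halpha) // lA scale1r.
- by rewrite (pairing_munit hq0 hq1) /symbol mptK /= mulVKf // pair_scale_neq0.
Qed.

(** The matrix units detect every value of a distribution. *)
Lemma distr_ext psi psi' :
  (forall a b, pairing H psi (munit a b) = pairing H psi' (munit a b)) -> psi = psi'.
Proof.
move=> e; apply/funext => x; have [a [b ->]] := mpt_surj x.
by have := e b a; rewrite !(pairing_munit hq0 hq1) => /(mulfI (pair_scale_neq0 _ _ _ _)); apply.
Qed.

Lemma symbol_unique A psi : linear A -> is_covariant_symbol L A psi -> psi = symbol A.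
Proof.
move=> lA hpsi; apply: distr_ext => a b.
by rewrite hpsi ?(symbolP lA) //; exact: finite_munit.
Qed.

Lemma covariant_symbolE A : linear A -> covariant_symbol L A = symbol A.
Proof.
move=> lA; rewrite /covariant_symbol; case: xgetP => [psi _ hpsi|none].
  exact: symbol_unique.
by case: (none (symbol A)); exact: symbolP.
Qed.

End CovariantSymbols.

Theorem proposition3p7 (R : realType) (n : nat) (q alpha : R)
    (hn : (0 < n)%N) (hq0 : 0 < q) (hq1 : q < 1) (halpha : 0 < alpha)
    (a : module_algebra n q) (H : fock_rep n q) (L : L2_completion H alpha)
    (p : twisted_action a alpha) :
  [/\ forall (T : {linear holo n q -> holo n q}) (s : distr R n),
        is_covariant_symbol L T s <-> s = covariant_symbol L T,
      forall (c : Cx R) (T1 T2 : {linear holo n q -> holo n q}),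
        covariant_symbol L (c \*: T1 \+ T2) =
        c *: covariant_symbol L T1 + covariant_symbol L T2
    & forall (t : Uterm R n) (T : {linear holo n q -> holo n q}),
        covariant_symbol L (act_End p t T) =
        act_distr H a (cls (Urel q) t) (covariant_symbol L T)].
Proof.
have sE A := @covariant_symbolE _ _ _ hq0 hq1 _ _ L hn halpha A.
have sP A := @symbolP _ _ _ hq0 hq1 _ _ L hn halpha A.
have fT f := @toeplitz_finrank _ _ _ hq0 hq1 _ _ L hn halpha f.
split=> [T s|c T1 T2|t T].
- rewrite sE; last exact: linearP.
  split=> [|->]; last by apply: sP; exact: linearP.
  by apply: symbol_unique => //; exact: linearP.
- have l12 : linear (c \*: T1 \+ T2 : holo n q -> holo n q).
    move=> x h h'; rewrite /= (linearP T1) (linearP T2) [c *: (_ + _)]scalerDr.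
    by rewrite [x *: (_ + _)]scalerDr !scalerA [c * x]mulrC addrACA.
  rewrite !sE //; try exact: linearP.
  refine (distr_ext hq0 hq1 (H := H) (psi := symbol L _) (psi' := c *: symbol L T1 + symbol L T2) _) => u v.
  have fuv := finite_munit q u v.
  rewrite (sP _ l12) // (pairing_munit hq0 hq1).
  rewrite [RHS](_ : _ = c * pairing H (symbol L T1) (munit q u v) +
    1 * pairing H (symbol L T2) (munit q u v)).
    rewrite !sP //; try exact: linearP.
    apply: (tr_lin H) => [||h]; try by apply: finrank_comp (fT _ fuv); exact: linearP.
    by rewrite scale1r.
  by rewrite !(pairing_munit hq0 hq1) mul1r mulrDr mulrCA.
- have lT : linear T by exact: linearP.
  have lt := act_End_linear p t lT.
  rewrite !sE //; refine (distr_ext hq0 hq1 (H := H) (psi := symbol L _) (psi' := act_distr H a _ _) _) => u v.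
  have fuv := finite_munit q u v.
  rewrite (pairing_act hq0 hq1) // !sP //; last exact: finite_act.
  exact: tr_adjoint.
Qed.
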